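(* For some $\gamma\in(0,1)$ let $W\in\mathcal{C}^\gamma([0,T],H)$, and let $A\in\mathcal{L}(H)$. For any $\alpha>1-\gamma$ let $$X(t)=\frac{1}{\Gamma(\alpha)}\int_0^t(t-s)^{\alpha-1}dW(s),$$ and let $y\in H$. Then there exists a unique solution $Y\in\mathcal{C}^\rho([0,T],H)$ with $\rho<\gamma+\alpha-1$ to the equation $$Y(t)=y+A\,I^\alpha(Y)(t)+X(t),\qquad t\in[0,T].$$ Moreover, the solution satisfies the analytic formula $$Y(t)=E_{\alpha,1}(At^\alpha)\,y+\int_0^t(t-s)^{\alpha-1}E_{\alpha,\alpha}\big(A(t-s)^\alpha\big)\,dW(s).$$
   Context: $T>0$, $H$ is a separable Hilbert space, $\mathcal{L}(H)$ the bounded linear operators on $H$; $\mathcal{C}^\rho([0,T],H)$ is the space of $\rho$-Hölder continuous functions $[0,T]\to H$. The fractional integral of order $\alpha>0$ is $I^\alpha(f)(t)=\frac{1}{\Gamma(\alpha)}\int_0^t(t-s)^{\alpha-1}f(s)\,ds$ (Bochner integral). The Mittag-Leffler operator is $E_{\alpha,\beta}(At)=\sum_{i=0}^\infty\frac{A^{\circ i}t^i}{\Gamma(\alpha i+\beta)}$, where $A^{\circ i}$ is the $i$-fold composition of $A$. For an operator-valued (or scalar) kernel $k(t,s)$, $0\le s<t\le T$, the pathwise Volterra–Young integral is $\int_0^tk(t,s)\,dW(s):=\lim_{|\mathcal{P}|\to0}\sum_{[u,v]\in\mathcal{P}}k(t,u)(W(v)-W(u))$, the limit taken in $H$ over partitions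 $\mathcal{P}$ of $[0,t]$ with mesh $|\mathcal{P}|\to0$. The integrals in the claim are understood in this sense. *)

(* Defs.v *)
From HB Require Import structures.
From mathcomp Require Export all_boot all_order all_algebra.
From mathcomp Require Export all_classical all_reals all_analysis.

Export Order.TTheory GRing.Theory Num.Theory numFieldNormedType.Exports.

#[export] Set Implicit Arguments.
#[export] Unset Strict Implicit.
#[export] Unset Printing Implicit Defensive.

Local Open Scope classical_set_scope.
Local Open Scope ring_scope.

Definition separable (T : topologicalType) : Prop :=
  exists2 D : set T, countable D & dense D.

Definition bounded_operator (R : realType) (H : normedModType R)
    (A : H -> H) : Prop :=
  exists M : R, forall x, `|A x| <= M * `|x|.

Definition hoelder_on (R : realType) (H : normedModType R) (T r : R)
    (f : R -> H) : Prop :=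
  exists C : R, forall s t, 0 <= s <= T -> 0 <= t <= T ->
    `|f t - f s| <= C * `|t - s| `^ r.

Definition Gamma (R : realType) (a : R) : R :=
  \int[lebesgue_measure]_(x in `]0, +oo[) (x `^ (a - 1) * expR (- x)).

Section Bochner.
Context (d : measure_display) (T : measurableType d) (R : realType).
Context (H : completeNormedModType R) (mu : {measure set T -> \bar R}).
Implicit Types (D : set T) (f : T -> H) (v : H).

Definition bochner_simple D (s : T -> H) : Prop :=
  [/\ finite_set (range s),
      forall v, measurable (s @^-1` [set v]) &
      forall v, v != 0 -> (mu (D `&` s @^-1` [set v]) < +oo)%E].

Definition bochner_simple_integral D (s : T -> H) : H :=
  \sum_(v \in range s) fine (mu (D `&` s @^-1` [set v])) *: v.

(* The almost everywhere convergence is the strong measurability of f; without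
   it the integrals of the norms below would only be lower integrals. *)
Definition bochner_approx D f (s : nat -> T -> H) : Prop :=
  [/\ forall n, bochner_simple D (s n),
      {ae mu, forall x, D x -> s n x @[n --> \oo] --> f x} &
      (\int[mu]_(x in D) `|f x - s n x|%:E)%E @[n --> \oo] --> 0%E].

Definition bochner_integrable D f : Prop := exists s, bochner_approx D f s.

Definition is_bochner_integral D f v : Prop :=
  exists2 s, bochner_approx D f s &
    bochner_simple_integral D (s n) @[n --> \oo] --> v.

Definition bochner_integral D f : H := xget 0 (is_bochner_integral D f).

End Bochner.

Definition frac_kernel (R : realType) (a t s : R) : R := (t - s) `^ (a - 1).

Definition frac_integrable (R : realType) (H : completeNormedModType R)
    (a : R) (f : R -> H) (t : R) : Prop :=
  bochner_integrable lebesgue_measure `[0, t]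
    (fun s => frac_kernel a t s *: f s).

Definition frac_integral (R : realType) (H : completeNormedModType R)
    (a : R) (f : R -> H) (t : R) : H :=
  (Gamma a)^-1 *: bochner_integral lebesgue_measure `[0, t]
    (fun s => frac_kernel a t s *: f s).

Section MittagLeffler.
Context (R : realType) (H : normedModType R).

Definition mittag_leffler_sum (a b : R) (A : H -> H) (t : R) (n : nat)
    (x : H) : H :=
  \sum_(0 <= i < n) (t ^+ i / Gamma (a * i%:R + b)) *: iter i A x.

(* E is the sum of the series for the operator norm. *)
Definition is_mittag_leffler (a b : R) (A : H -> H) (t : R) (E : H -> H) :
    Prop :=
  forall e : R, 0 < e -> \forall n \near \oo,
    forall x, `|E x - mittag_leffler_sum a b A t n x| <= e * `|x|.

Definition mittag_leffler (a b : R) (A : H -> H) (t : R) : H -> H :=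
  xget (fun=> 0) (is_mittag_leffler a b A t).

End MittagLeffler.

(* A partition of [a, b] is the list p of its points other than a, as in
   itv_partition; the sub-intervals are the [nth b (a :: p) i, nth b p i]. *)
Definition mesh (R : realType) (a b : R) (p : seq R) : R :=
  \big[Num.max/0]_(0 <= i < size p) (nth b p i - nth b (a :: p) i).

Definition mesh_filter (R : realType) (a b : R) : set_system (seq R) :=
  filter_from [set d : R | 0 < d]
    (fun d => [set p | itv_partition a b p /\ mesh a b p < d]).

(* The limit along mesh_filter a b is the limit over all partitions of [a, b]
   as the mesh tends to 0. *)
#[export] Instance mesh_filter_filter (R : realType) (a b : R) :
  Filter (mesh_filter a b).
Proof.
apply: filter_from_filter; first by exists 1 => /=.
move=> i j i0 j0; exists (Num.min i j) => /=; first by rewrite lt_min i0 j0.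
by move=> p [] pab; rewrite lt_min => /andP[pi pj].
Qed.

Section VolterraYoung.
Context (R : realType) (H : normedModType R).
Implicit Types (k : R -> R -> H -> H) (W : R -> H) (t : R).

Definition volterra_sum k W t (p : seq R) : H :=
  \sum_(0 <= i < size p)
    k t (nth t (0 :: p) i) (W (nth t p i) - W (nth t (0 :: p) i)).

Definition volterra_integrable k W t : Prop :=
  cvg (volterra_sum k W t @ mesh_filter 0 t).

Definition volterra_integral k W t : H :=
  lim (volterra_sum k W t @ mesh_filter 0 t).

End VolterraYoung.

Definition frac_noise_kernel (R : realType) (H : normedModType R) (a : R) :
    R -> R -> H -> H :=
  fun t s h => frac_kernel a t s *: h.

Definition ml_noise_kernel (R : realType) (H : normedModType R) (a : R)
    (A : H -> H) : R -> R -> H -> H :=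
  fun t s h => frac_kernel a t s *: mittag_leffler a a A ((t - s) `^ a) h.

(* A solution is required to have a Bochner integrable I^a(Y) integrand, since
   bochner_integral takes the junk value 0 otherwise. *)
Definition is_solution (R : realType) (H : completeNormedModType R)
    (T a : R) (A : H -> H) (y : H) (X Y : R -> H) : Prop :=
  forall t, 0 <= t <= T ->
    frac_integrable a Y t /\ Y t = y + A (frac_integral a Y t) + X t.

(* Main.v *)
(* For b > 1 - gamma the Young sums of (t-u)^(b-1) dW over two partitions are
   compared by inserting the smaller of their next points; Cauchy's mean value
   theorem makes the resulting defects telescope against a power of t - u, so the
   integral J_b W(t) exists with an error bound in the mesh.  Existence for the
   Mittag-Leffler kernel follows by summing over its terms.

   Elements of H are tested against functionals phi with phi(v) = |v|, so that
   identities between Bochner integrals reduce to scalar Lebesgue integrals.  The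
   semigroup property I^a J_b = Gamma(b) / Gamma(a+b) J_(a+b) is the Beta
   convolution applied to each term of a Young sum, in the limit.

   Hence the Picard iterates are the partial sums of the series with terms
   A^n I^(alpha n) (y + X); the series converges geometrically because
   Gamma(a) >= K^(a-1) e^(-K-1) for every K > 0, its sum is the stated formula, and
   iterating the equation for a difference of two solutions gives uniqueness. *)
From HB Require Import structures.
From mathcomp Require Import finmap.
Require Import Defs.
From mathcomp Require Import measurable_realfun ring lra.
Local Open Scope classical_set_scope.
Local Open Scope ring_scope.

(** * Gamma and Beta functions *)

(** The Hoelder exponent is split as [gamma = eps + (gamma - eps)]. The first share pays for the
    mesh; the second, added to the kernel exponent [b - 1], must leave a positive power that can
    telescope, and this is where $b>1-\gamma$ is consumed. The semigroup identity is the delicate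
    point. For [b < 1] the kernel of $J_bW(s)$ is singular at [s], and a partition of $[0,t]$ cut at
    [s] leaves an error on the block containing [s] that is unbounded in [s]. The cut-off Young sums
    over one fixed partition thus need not converge uniformly in [s]; only the fractional integral
    of the error is small, and [last_block_weight] is its explicit majorant. Regularity of the
    series comes from the fact that $I^\alpha$ turns a sup bound into a Hoelder bound: each Picard
    term after the first takes its Hoelder constant from the sup norm of the preceding one, and
    these decay geometrically. Every series is compared with the ratio 1/2, so that remainders are
    uniform in time and interchange with the mesh limit and with $I^\alpha$. *)

Section affine_change_of_variable.
Context {R : realType}.
Local Notation mu := (@lebesgue_measure R).
Local Open Scope ereal_scope.

(** The rescaled image measure agrees with Lebesgue measure on half-open intervals, and these values
    determine the latter. *)
Lemma lebesgue_measure_affine (c d : R) (A : set R) : (0 < c)%R ->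
  measurable A ->
  mu A = c%:E * pushforward mu
    (fun x : measurableTypeR R => (c * x + d)%R : measurableTypeR R) A.
Proof.
move=> c0 mA.
pose f : measurableTypeR R -> measurableTypeR R := fun x => (c * x + d)%R.
have mf : measurable_fun setT f.
  by apply: measurable_funD => //; exact: measurable_funM.
pose g : {mfun measurableTypeR R >-> measurableTypeR R} :=
  HB.pack f (isMeasurableFun.Build _ _ _ _ f mf).
rewrite (@lebesgue_measure_unique _ (mscale (NngNum (ltW c0)) (pushforward mu g)))//.
move=> _ [[a b]] _ <-.
have gE : f @^-1` [set` `]a, b]%R] = [set` `]((a - d) / c), ((b - d) / c)]%R].
  apply/seteqP; split => x /=; rewrite !in_itv/= /f ltr_pdivrMr// ler_pdivlMr//;
  by rewrite ltrBlDr lerBrDr mulrC.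
transitivity (c%:E * mu (f @^-1` [set` `]a, b]%R])) => //.
rewrite gE !lebesgue_measure_itv/= !lte_fin ltr_pM2r ?invr_gt0//.
rewrite ltrD2r; case: ifPn => _; last by rewrite mule0.
rewrite -!EFinD -EFinM; congr EFin; field.
by rewrite gt_eqF.
Qed.

Lemma ge0_integral_affine (c d : R) (f : R -> \bar R) : (0 < c)%R ->
  measurable_fun [set: R] f -> (forall x, 0 <= f x) ->
  \int[mu]_x f x = c%:E * \int[mu]_x f (c * x + d)%R.
Proof.
move=> c0 mf f0.
pose g0 : measurableTypeR R -> measurableTypeR R := fun x => (c * x + d)%R.
have mg : measurable_fun setT g0.
  by apply: measurable_funD => //; exact: measurable_funM.
pose g : {mfun measurableTypeR R >-> measurableTypeR R} :=
  HB.pack g0 (isMeasurableFun.Build _ _ _ _ g0 mg).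
have := @ge0_integral_pushforward _ _ (measurableTypeR R) (measurableTypeR R) R
  g0 mg mu setT f measurableT mf (fun y _ => f0 y).
rewrite preimage_setT /comp/= => <-.
rewrite -[RHS](@ge0_integral_mscale _ _ _ (pushforward mu g) setT measurableT (NngNum (ltW c0)))//.
apply: eq_measure_integral => A mA _.
exact: (lebesgue_measure_affine d c0).
Qed.

End affine_change_of_variable.

Lemma gt0_powRD (R : realType) (x r s : R) : 0 < x ->
  x `^ (r + s) = x `^ r * x `^ s.
Proof. by move=> x0; rewrite powRD// (gt_eqF x0) implybT. Qed.

(* Cutting the power off at 0 turns fractional integrals into convolutions over
   the whole line. *)
Definition pos_powR (R : realType) (a x : R) : R :=
  if 0 < x then x `^ (a - 1) else 0.

Section pos_powR_theory.
Context {R : realType}.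
Implicit Types a b c u t x z : R.

Lemma pos_powR_gt0E a x : 0 < x -> pos_powR a x = x `^ (a - 1).
Proof. by rewrite /pos_powR => ->. Qed.

Lemma pos_powR_le0E a x : x <= 0 -> pos_powR a x = 0.
Proof. by rewrite /pos_powR leNgt => /negbTE ->. Qed.

Lemma pos_powR_ge0 a x : 0 <= pos_powR a x.
Proof. by rewrite /pos_powR; case: ifP => // _; exact: powR_ge0. Qed.

Lemma measurable_pos_powR a : measurable_fun [set: R] (pos_powR a).
Proof.
apply: measurable_fun_ifT; first exact: measurable_fun_ltr.
- exact: measurable_powR.
- exact: measurable_cst.
Qed.

Lemma pos_powRM a c x : 0 < c -> pos_powR a (c * x) = c `^ (a - 1) * pos_powR a x.
Proof.
move=> c0; rewrite /pos_powR pmulr_rgt0//; case: ifPn => x0; last by rewrite mulr0.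
by rewrite powRM// ltW.
Qed.

Lemma measurable_conv_kernel a b z :
  measurable_fun [set: R] (fun x => pos_powR a (z - x) * pos_powR b x).
Proof.
apply: measurable_funM; last exact: measurable_pos_powR.
apply: measurableT_comp; first exact: measurable_pos_powR.
by apply: measurable_funB.
Qed.

Local Notation mu := (@lebesgue_measure R).
Local Open Scope ereal_scope.

(** Gamma and Beta integrals are first taken in the extended reals and over the whole line, where
    Tonelli and substitution apply before finiteness is known. *)
Definition egamma a := \int[mu]_x (pos_powR a x * expR (- x))%:E.
Definition ebeta a b := \int[mu]_x (pos_powR a (1 - x) * pos_powR b x)%:E.

Lemma egamma_ge0 a : 0 <= egamma a.
Proof.
by apply: integral_ge0 => x _; rewrite lee_fin mulr_ge0 ?pos_powR_ge0 ?expR_ge0.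
Qed.

Lemma ebeta_ge0 a b : 0 <= ebeta a b.
Proof.
by apply: integral_ge0 => x _; rewrite lee_fin mulr_ge0 ?pos_powR_ge0.
Qed.

(** Rescaling the variable by [z] pulls one power of [z] out of each factor and one out of the
    measure; for [z <= 0] the two factors have disjoint supports. *)
Lemma conv_pos_powR a b z :
  \int[mu]_x (pos_powR a (z - x) * pos_powR b x)%:E =
  (pos_powR (a + b) z)%:E * ebeta a b.
Proof.
have [z0|z0] := ltP 0%R z; last first.
  rewrite pos_powR_le0E// mul0e integral0_eq// => x _.
  have [x0|x0] := ltP 0%R x; last by rewrite (pos_powR_le0E b x0) mulr0.
  by rewrite (@pos_powR_le0E a)// ?mul0r// subr_le0 (le_trans z0)// ltW.
rewrite (ge0_integral_affine 0 z0); last 2 first.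
- by apply/measurable_EFinP; exact: measurable_conv_kernel.
- by move=> x; rewrite lee_fin mulr_ge0 ?pos_powR_ge0.
under eq_integral => x _.
  rewrite addr0 (_ : (z - z * x = z * (1 - x))%R); last by ring.
  rewrite !pos_powRM// mulrACA EFinM.
  over.
rewrite ge0_integralZl//=; last 3 first.
- by apply/measurable_EFinP; exact: measurable_conv_kernel.
- by move=> x _; rewrite lee_fin mulr_ge0 ?pos_powR_ge0.
- by rewrite lee_fin mulr_ge0 ?powR_ge0.
rewrite muleA -EFinM; congr (_%:E * _).
rewrite pos_powR_gt0E// -gt0_powRD// -[X in (X * _)%R](powRr1 (ltW z0)) -gt0_powRD//.
by congr powR; ring.
Qed.

(** Euler's argument: shifting the inner variable makes the exponential depend on [z] alone, and
    after Tonelli the integral in [x] is the convolution [conv_pos_powR]. *)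
Lemma egammaM a b : egamma a * egamma b = egamma (a + b) * ebeta b a.
Proof.
have mg c : measurable_fun setT (fun x : R => (pos_powR c x * expR (- x))%:E).
  apply/measurable_EFinP; apply: measurable_funM; first exact: measurable_pos_powR.
  by apply: measurableT_comp => //; exact: measurableT_comp.
have g0 c (x : R) : 0 <= (pos_powR c x * expR (- x))%:E.
  by rewrite lee_fin mulr_ge0 ?pos_powR_ge0 ?expR_ge0.
rewrite -ge0_integralZr//; [|exact: mg|exact: egamma_ge0].
transitivity (\int[mu]_x \int[mu]_z
    (pos_powR b (z - x) * pos_powR a x * expR (- z))%:E).
  apply: eq_integral => x _.
  rewrite {1}/egamma (ge0_integral_affine (- x) ltr01)// mul1e.
  rewrite -ge0_integralZl//; last first.
    apply: (measurableT_comp (mg b)).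
    by apply: measurable_funD => //; exact: measurable_funM.
  apply: eq_integral => z _; rewrite -EFinM; congr EFin.
  rewrite mul1r (_ : expR (- z) = expR (- x) * expR (- (z - x)))%R; first by ring.
  by rewrite -expRD; congr expR; ring.
pose f (p : R * R) := (pos_powR b (p.2 - p.1) * pos_powR a p.1 * expR (- p.2))%:E.
rewrite (@fubini_tonelli _ _ _ _ _ mu mu f)/=; last 2 first.
- apply/measurable_EFinP; apply: measurable_funM; first apply: measurable_funM.
  + apply: measurableT_comp; first exact: measurable_pos_powR.
    by apply: measurable_funB.
  + by apply: measurableT_comp; first exact: measurable_pos_powR.
  + by apply: measurableT_comp => //; exact: measurableT_comp.
- by move=> p; rewrite lee_fin !mulr_ge0 ?pos_powR_ge0 ?expR_ge0.
rewrite -ge0_integralZr//; [|exact: mg|exact: ebeta_ge0].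
apply: eq_integral => z _; rewrite /f/=.
under eq_integral do rewrite EFinM.
rewrite ge0_integralZr//=; last 2 first.
- by apply/measurable_EFinP; exact: measurable_conv_kernel.
- by move=> x _; rewrite lee_fin mulr_ge0 ?pos_powR_ge0.
by rewrite conv_pos_powR EFinM [(b + a)%R]addrC muleAC.
Qed.

End pos_powR_theory.

Section gamma_theory.
Context {R : realType}.
Implicit Types a b c u t x z : R.
Local Notation mu := (@lebesgue_measure R).

Lemma gt0_continuous_powR a x : 0 < x -> {for x, continuous (@powR R ^~ a)}.
Proof.
move=> x0; apply/differentiable_continuous/derivable1_diffP.
by apply: derivable_powR; rewrite in_itv/= x0.
Qed.

Lemma within_continuous_powR a c d : 0 < c ->
  {within `[c, d], continuous (@powR R ^~ a)}.
Proof.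
move=> c0; apply: continuous_in_subspaceT => x /set_mem /=.
rewrite in_itv/= => /andP[cx _]; apply: gt0_continuous_powR.
exact: lt_le_trans cx.
Qed.

Lemma integral_powR b c : 0 < b -> 0 < c -> c < 1 ->
  (\int[mu]_(x in `[c, 1%R]) (x `^ (b - 1))%:E = ((1 - c `^ b) / b)%:E)%E.
Proof.
move=> b0 c0 c1.
rewrite (@continuous_FTC2 _ _ (fun x => x `^ b / b) c 1)//.
- by rewrite powR1 -EFinB -mulrBl.
- exact: within_continuous_powR.
- split.
  + move=> x; rewrite in_itv/= => /andP[cx _]; apply: derivableM => //.
    by apply: derivable_powR; rewrite in_itv/= (lt_trans c0).
  + apply: cvgM; last exact: cvg_cst.
    by apply: cvg_at_right_filter; exact: gt0_continuous_powR.
  + apply: cvgM; last exact: cvg_cst.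
    by apply: cvg_at_left_filter; exact: gt0_continuous_powR.
- move=> x; rewrite in_itv/= => /andP[cx _].
  have x0 : 0 < x by exact: lt_trans cx.
  rewrite derive1E deriveM//; last by apply: derivable_powR; rewrite in_itv/= x0.
  rewrite derive_cst scaler0 add0r -derive1E powR_derive1 ?in_itv/= ?x0//.
  by rewrite -[RHS]scale1r -(mulVf (lt0r_neq0 b0)) -scalerA.
Qed.

(** The integrand may be unbounded at 0, so the fundamental theorem of calculus is used away from 0
    and monotone convergence does the rest. *)
Lemma ebeta1 b : 0 < b -> ebeta 1 b = (b^-1)%:E.
Proof.
move=> b0.
(* The offset 2 makes the left endpoint strictly less than 1 already for [n = 0]. *)
pose F n : set R := `[n.+2%:R^-1, 1]%classic.
have n2 n : 0 < n.+2%:R^-1 :> R by rewrite invr_gt0.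
have n21 n : n.+2%:R^-1 < 1 :> R by rewrite invf_lt1// ltr1n.
have ndF : nondecreasing_seq F.
  move=> m n mn; apply/subsetPset => x; rewrite /F/= !in_itv/= => /andP[mx ->].
  by rewrite (le_trans _ mx)// lef_pV2 ?posrE// ler_nat.
have mpow D : measurable_fun D (fun x : R => (x `^ (b - 1))%:E).
  apply/measurable_EFinP; apply: measurable_funS (@measurable_powR R (b - 1)) => //.
have := @ge0_nondecreasing_set_cvg_integral _ (measurableTypeR R) R F
  (fun x : R => (x `^ (b - 1))%:E) (@lebesgue_measure R) ndF (fun=> measurable_itv _)
  (fun i => mpow (F i)) (fun i x _ => powR_ge0 _ _).
have UF : \bigcup_i F i = `]0, 1]%classic.
  apply/seteqP; split => x /=.
    by move=> [n _]; rewrite /F/= !in_itv/= => /andP[nx ->]; rewrite (lt_le_trans _ nx).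
  rewrite in_itv/= => /andP[x0 x1].
  have [n _ /(_ n (leqnn n)) nx] := near_infty_natSinv_lt (PosNum x0).
  exists n => //; rewrite /F/= in_itv/= x1 andbT (le_trans _ (ltW nx))//=.
  by rewrite lef_pV2 ?posrE// ler_nat.
rewrite UF.
have -> : (\int[mu]_(x in `]0%R, 1%R]) (x `^ (b - 1))%:E = ebeta 1 b)%E.
  rewrite -integral_itv_bndo_bndc; last exact: mpow.
  rewrite /ebeta integral_mkcond; apply: eq_integral => x _.
  rewrite patchE /pos_powR subr_gt0; have [x1|x1] := ltP x 1; last first.
    by rewrite mul0r memNset//= in_itv/= [x < 1]ltNge x1 andbF.
  rewrite subrr powRr0 mul1r; have [x0|x0] := ltP 0 x; last first.
    by rewrite memNset//= in_itv/= ltNge x0.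
  by rewrite mem_set//= in_itv/= x0.
move=> cvgF; apply/esym; apply: (cvg_unique _ _ cvgF) => //=.
under eq_fun do rewrite integral_powR//.
apply: cvg_EFin; first by near=> n.
rewrite -[X in _ --> X]mul1r -[in X in _ --> X](subr0 1).
apply: cvgM; last exact: cvg_cst.
apply: cvgB; first exact: cvg_cst.
apply/cvgrPdist_lt => e e0; have e'0 : 0 < e `^ b^-1 by rewrite powR_gt0.
near=> n.
rewrite sub0r normrN ger0_norm ?powR_ge0//.
rewrite (_ : e = (e `^ b^-1) `^ b); last by rewrite -powRrM mulVf ?lt0r_neq0// powRr1// ltW.
rewrite gt0_ltr_powR ?nnegrE ?powR_ge0// ?(ltW (n2 _))//.
rewrite (@lt_trans _ _ n.+1%:R^-1)//.
  by rewrite ltf_pV2 ?posrE// ltr_nat.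
by near: n; exact: (near_infty_natSinv_lt (PosNum e'0)).
Unshelve. all: by end_near. Qed.

Lemma egammaE a :
  egamma a = (\int[mu]_(x in `]0%R, +oo[) (x `^ (a - 1) * expR (- x))%:E)%E.
Proof.
rewrite [RHS]integral_mkcond; apply: eq_integral => x _.
rewrite patchE /pos_powR; have [x0|x0] := ltP 0 x; last first.
  by rewrite mul0r memNset//= in_itv/= ltNge x0.
by rewrite mem_set//= in_itv/= x0.
Qed.

Lemma GammaE a : Gamma a = fine (egamma a).
Proof. by rewrite egammaE. Qed.

Lemma egamma1 : egamma (1 : R) = 1%E.
Proof.
rewrite egammaE -[RHS](@integral_exponential_pdf R 1 ltr01).
rewrite integral_itv_obnd_cbnd; last first.
  apply/measurable_EFinP; apply: measurable_funM.
    by apply: measurable_funS (@measurable_powR R _) => //.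
  by apply: measurableT_comp => //; exact: measurableT_comp.
rewrite integral_mkcond; apply: eq_integral => x _.
rewrite /exponential_pdf !patchE; case: ifP => // _.
by rewrite subrr powRr0 mulN1r.
Qed.

(** Taking one argument of [egammaM] equal to 1 replaces an integration by parts, and is legitimate
    in the extended reals. *)
Lemma egammaS b : 0 < b -> (egamma b = egamma (1 + b) * (b^-1)%:E)%E.
Proof.
by move=> b0; rewrite -ebeta1// addrC -egammaM egamma1 mule1.
Qed.
End gamma_theory.

Section gamma_beta.
Context {R : realType}.
Implicit Types a b c u t x z : R.
Local Notation mu := (@lebesgue_measure R).

Lemma measurable_egamma_fun a :
  measurable_fun [set: R] (fun x => (pos_powR a x * expR (- x))%:E).
Proof.
apply/measurable_EFinP; apply: measurable_funM; first exact: measurable_pos_powR.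
by apply: measurableT_comp => //; exact: measurableT_comp.
Qed.

(** The recursion gives finiteness at the positive integers; for [b >= 1] the power is dominated by
    1 plus an integer power; a last use of the recursion reaches arguments below 1. *)
Lemma egamma_lty a : 0 < a -> (egamma a < +oo)%E.
Proof.
have gS b : 0 < b -> (egamma b < +oo -> egamma (1 + b) < +oo)%E.
  move=> b0; rewrite (egammaS b0).
  have := egamma_ge0 (1 + b); case: (egamma (1 + b)) => //.
    by move=> r _ _; rewrite ltry.
  by move=> _; rewrite mulyr gtr0_sg ?invr_gt0// mul1e.
have gn n : (egamma (n.+1%:R : R) < +oo)%E.
  elim: n => [|n ih]; first by rewrite egamma1 ltry.
  by rewrite -natr1 addrC gS// ltr0n.
have ge1 b : 1 <= b -> (egamma b < +oo)%E.
  move=> b1; pose n := Num.truncn b.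
  rewrite (@le_lt_trans _ _ (egamma 1 + egamma (n.+2%:R : R))%E)//; last first.
    by rewrite lte_add_pinfty// egamma1 ltry.
  rewrite /egamma -ge0_integralD//; last 4 first.
  - by move=> x _; rewrite lee_fin mulr_ge0 ?pos_powR_ge0 ?expR_ge0.
  - exact: measurable_egamma_fun.
  - by move=> x _; rewrite lee_fin mulr_ge0 ?pos_powR_ge0 ?expR_ge0.
  - exact: measurable_egamma_fun.
  apply: ge0_le_integral => //.
  - by move=> x _; rewrite lee_fin mulr_ge0 ?pos_powR_ge0 ?expR_ge0.
  - exact: measurable_egamma_fun.
  - by apply: emeasurable_funD; exact: measurable_egamma_fun.
  move=> x _; rewrite -EFinD lee_fin -mulrDl ler_wpM2r ?expR_ge0//.
  have [x0|x0] := ltP 0 x; last by rewrite !pos_powR_le0E// addr0.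
  rewrite !pos_powR_gt0E// subrr powRr0.
  have [x1|x1] := leP 1 x.
    rewrite (@le_trans _ _ (x `^ (n.+2%:R - 1)))//; last by rewrite lerDr.
    apply: ler_powR => //; rewrite lerD2r.
    have b0 : 0 <= b by rewrite (le_trans _ b1).
    have /andP[_ /ltW bn] := truncn_itv b0.
    by rewrite (le_trans bn)// ler_nat.
  rewrite -[leLHS]addr0 lerD ?powR_ge0//.
  have := @ger_powR R x _ 0 (b - 1); rewrite powRr0; apply; last by rewrite subr_ge0.
  by rewrite x0 ltW.
move=> a0; rewrite egammaS//.
have := ge1 (1 + a); rewrite lerDl (ltW a0) => /(_ isT).
have := egamma_ge0 (1 + a); case: (egamma (1 + a)) => //.
by move=> r _ _; rewrite -EFinM ltry.
Qed.

Lemma egamma_Gamma a : 0 < a -> egamma a = (Gamma a)%:E.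
Proof.
by move=> a0; rewrite GammaE fineK// ge0_fin_numE ?egamma_ge0// egamma_lty.
Qed.

(** Only the part of the integral over $[K,K+1]$ is kept, each factor being replaced by its minimum
    there. [K] stays free so that a later choice can beat a given geometric growth. *)
Lemma Gamma_lower_bound (K a : R) : 0 < K -> 1 <= a ->
  K `^ (a - 1) * expR (- (K + 1)) <= Gamma a.
Proof.
move=> K0 a1; rewrite -lee_fin -egamma_Gamma; last exact: lt_le_trans a1.
have le_egamma : (\int[mu]_(x in `[K, (K + 1)%R])
    (pos_powR a x * expR (- x))%:E <= egamma a)%E.
  apply: ge0_subset_integral => //; first exact: measurable_egamma_fun.
  by move=> x _; rewrite lee_fin mulr_ge0 ?pos_powR_ge0 ?expR_ge0.
apply: le_trans le_egamma.
have -> : (K `^ (a - 1) * expR (- (K + 1)))%:E =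
    (\int[mu]_(x in `[K, (K + 1)%R]) (K `^ (a - 1) * expR (- (K + 1)))%:E)%E.
  rewrite integral_cst//= lebesgue_measure_itv/= lte_fin ltrDl ltr01.
  by rewrite -EFinD -EFinM; congr EFin; ring.
apply: ge0_le_integral => //.
- by move=> x _; rewrite lee_fin mulr_ge0 ?powR_ge0 ?expR_ge0.
- by apply: measurable_funS (@measurable_egamma_fun a).
move=> x; rewrite /= in_itv/= => /andP[Kx xK].
have x0 : 0 < x by rewrite (lt_le_trans K0).
rewrite lee_fin pos_powR_gt0E// ler_pM ?powR_ge0 ?expR_ge0//.
  by apply: ge0_ler_powR; rewrite ?nnegrE ?subr_ge0// ltW.
by rewrite ler_expR lerN2.
Qed.

Lemma GammaS a : 0 < a -> Gamma (1 + a) = a * Gamma a.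
Proof.
move=> a0; have := egammaS a0; rewrite !egamma_Gamma ?addr_gt0// -EFinM => -[->].
by rewrite mulrCA divff ?mulr1// lt0r_neq0.
Qed.

Lemma Gamma1 : Gamma (1 : R) = 1.
Proof. by have := @egamma1 R; rewrite egamma_Gamma// => -[]. Qed.

Lemma Gamma_gt0 a : 0 < a -> 0 < Gamma a.
Proof.
move=> a0; have : 0 < Gamma (1 + a).
  apply: lt_le_trans (Gamma_lower_bound ltr01 _).
    by rewrite mulr_gt0 ?powR_gt0 ?expR_gt0.
  by rewrite lerDl ltW.
by rewrite GammaS// pmulr_rgt0.
Qed.

(** An infinite Beta integral is excluded because the product in [egammaM] is finite while
    $\Gamma(a+b)>0$. *)
Lemma ebetaE a b : 0 < a -> 0 < b ->
  ebeta a b = (Gamma a * Gamma b / Gamma (a + b))%:E.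
Proof.
move=> a0 b0; have := @egammaM R b a.
have ab0 : 0 < a + b by rewrite addr_gt0.
have G0 := Gamma_gt0 ab0.
rewrite [b + a]addrC !egamma_Gamma// -EFinM.
have := @ebeta_ge0 R a b; case: (ebeta a b) => [r _|_|//].
  rewrite -EFinM => -[E]; congr EFin.
  by rewrite mulrC in E; rewrite E mulrAC divff ?mul1r// lt0r_neq0.
by rewrite gt0_muley ?lte_fin.
Qed.

(** A translate of [conv_pos_powR]. The cut-off makes it valid for all [u] and [t], so that a Young
    sum over a fixed partition can be integrated term by term. *)
Lemma beta_convolution a b u t : 0 < a -> 0 < b ->
  (\int[mu]_s (pos_powR a (t - s) * pos_powR b (s - u))%:E =
   (Gamma a * Gamma b / Gamma (a + b) * pos_powR (a + b) (t - u))%:E)%E.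
Proof.
move=> a0 b0; rewrite (ge0_integral_affine u ltr01); last 2 first.
- apply/measurable_EFinP; apply: measurable_funM;
    apply: measurableT_comp (@measurable_pos_powR R _) _; exact: measurable_funB.
- by move=> x; rewrite lee_fin mulr_ge0 ?pos_powR_ge0.
rewrite mul1e mulrC EFinM -ebetaE// -conv_pos_powR.
apply: eq_integral => x _; congr (_ * _)%:E; congr pos_powR; ring.
Qed.

End gamma_beta.

(** * Fractional integrals of Hoelder functions *)

(** The normalisation $1/\Gamma(a)$ is left out here and reappears in [functional_frac_integral]. *)
Definition scalar_frac_integral (R : realType) (a t : R) (g : R -> R) : R :=
  \int[lebesgue_measure]_(s in `[0, t]) (frac_kernel a t s * g s).

Section scalar_frac_integral.
Context {R : realType}.
Implicit Types (a b c u t s x z : R) (g h : R -> R).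
Local Notation mu := (@lebesgue_measure R).

Lemma frac_kernel_ge0 a t s : 0 <= frac_kernel a t s.
Proof. exact: powR_ge0. Qed.

Lemma measurable_frac_kernel a t D : measurable_fun D (frac_kernel a t).
Proof.
apply: measurable_funTS; rewrite /frac_kernel.
apply: (measurableT_comp (@measurable_powR R (a - 1))).
exact: measurable_funB.
Qed.

Lemma integral_frac_kernel_pos_powR a b u t : 0 < a -> 0 < b -> 0 <= u ->
  (\int[mu]_(s in `[0%R, t]) (frac_kernel a t s * pos_powR b (s - u))%:E =
   (Gamma a * Gamma b / Gamma (a + b) * pos_powR (a + b) (t - u))%:E)%E.
Proof.
move=> a0 b0 u0; rewrite -beta_convolution//.
(* The endpoint [s = t] is dropped: for [a = 1] the kernel is 1 there, while the cut-off power is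
   0. *)
rewrite -integral_itv_bndo_bndc; last first.
  apply/measurable_EFinP; apply: measurable_funM; first exact: measurable_frac_kernel.
  apply: measurable_funTS.
  apply: measurableT_comp (@measurable_pos_powR R _) _; exact: measurable_funB.
rewrite integral_mkcond; apply: eq_integral => s _.
rewrite patchE; have [st|ts] := ltP s t; last first.
  rewrite memNset/= ?in_itv/= ?[s < t]ltNge ?ts ?andbF//.
  by rewrite (@pos_powR_le0E _ a) ?subr_le0// mul0r.
have [us|su] := ltP u s; last first.
  by rewrite (@pos_powR_le0E _ b) ?subr_le0// !mulr0; case: ifP.
rewrite mem_set/= ?in_itv/= ?st ?(le_trans u0 (ltW us))//.
by rewrite (@pos_powR_gt0E _ a) ?subr_gt0.
Qed.

Lemma integral_frac_kernel_powR a c t : 0 < a -> 0 <= c -> 0 <= t ->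
  (\int[mu]_(s in `[0%R, t]) (frac_kernel a t s * s `^ c)%:E =
   (Gamma a * Gamma (c + 1) / Gamma (a + c + 1) * t `^ (a + c))%:E)%E.
Proof.
move=> a0 c0; rewrite le_eqVlt => /predU1P[<-|t0].
  by rewrite set_itv1 integral_set1 powR0 ?mulr0// lt0r_neq0// ltr_wpDr.
have c10 : 0 < c + 1 by rewrite ltr_wpDl.
have := @integral_frac_kernel_pos_powR a (c + 1) 0 t a0 c10 (lexx 0).
rewrite subr0 pos_powR_gt0E// !addrA addrK => <-.
have mp : measurable_fun `[0, t] (fun s : R => (frac_kernel a t s * s `^ c)%:E).
  apply/measurable_EFinP; apply: measurable_funM; first exact: measurable_frac_kernel.
  by apply: measurable_funTS; exact: measurable_powR.
rewrite -integral_itv_obnd_cbnd; last first.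
  by apply: measurable_funS mp => //; exact: subset_itv_oc_cc.
rewrite -[RHS]integral_itv_obnd_cbnd; last first.
  apply/measurable_EFinP; apply: measurable_funM; first exact: measurable_frac_kernel.
  apply: measurable_funTS.
  apply: measurableT_comp (@measurable_pos_powR R _) _; exact: measurable_funB.
apply: eq_integral => s; rewrite inE/= in_itv/= => /andP[s0 _].
by rewrite subr0 pos_powR_gt0E// addrK.
Qed.

Lemma integral_frac_kernel a t : 0 < a -> 0 <= t ->
  (\int[mu]_(s in `[0%R, t]) (frac_kernel a t s)%:E = (t `^ a / a)%:E)%E.
Proof.
move=> a0 t0; have := integral_frac_kernel_powR a0 (lexx 0) t0.
under eq_integral do rewrite powRr0 mulr1.
move=> ->; rewrite addr0 add0r Gamma1 mulr1 [a + 1]addrC GammaS//; congr EFin.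
by field; rewrite !gt_eqF// Gamma_gt0.
Qed.

Lemma integrable_frac_kernel a t : 0 < a -> 0 <= t ->
  mu.-integrable `[0, t] (EFin \o frac_kernel a t).
Proof.
move=> a0 t0; apply/integrableP; split.
  by apply/measurable_EFinP; exact: measurable_frac_kernel.
under eq_integral do rewrite /= ger0_norm ?frac_kernel_ge0//.
by rewrite integral_frac_kernel// ltry.
Qed.

Lemma integrable_frac_kernelM a t g (M : R) : 0 < a -> 0 <= t ->
  measurable_fun `[0, t] g -> (forall s, 0 <= s <= t -> `|g s| <= M) ->
  mu.-integrable `[0, t] (EFin \o (fun s => frac_kernel a t s * g s)).
Proof.
move=> a0 t0 mg gM.
have iM : mu.-integrable `[0, t] (EFin \o (fun s => frac_kernel a t s * M)).
  have := @integrableZr _ _ _ mu `[0, t] (measurable_itv _) M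
    (EFin \o frac_kernel a t) (integrable_frac_kernel a0 t0).
  by apply: eq_integrable => // s _ /=; rewrite EFinM.
apply: le_integrable iM => //.
  by apply/measurable_EFinP; apply: measurable_funM => //; exact: measurable_frac_kernel.
move=> s /=; rewrite in_itv/= => st.
rewrite lee_fin !normrM ler_wpM2l//.
by rewrite (le_trans (gM _ st))// ler_norm.
Qed.

Lemma scalar_frac_integral_powR a c t : 0 < a -> 0 <= c -> 0 <= t ->
  scalar_frac_integral a t (fun s => s `^ c) =
  Gamma a * Gamma (c + 1) / Gamma (a + c + 1) * t `^ (a + c).
Proof.
by move=> a0 c0 t0; rewrite /scalar_frac_integral /Rintegral integral_frac_kernel_powR.
Qed.

Lemma scalar_frac_integral_cst a t (M : R) : 0 < a -> 0 <= t ->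
  scalar_frac_integral a t (fun=> M) = M * (t `^ a / a).
Proof.
move=> a0 t0.
rewrite /scalar_frac_integral RintegralZr//; last exact: integrable_frac_kernel.
by rewrite mulrC /Rintegral integral_frac_kernel.
Qed.

Section bounded.
Context (a t : R).
Hypotheses (a0 : 0 < a) (t0 : 0 <= t).

Lemma eq_scalar_frac_integral g h : (forall s, 0 <= s <= t -> g s = h s) ->
  scalar_frac_integral a t g = scalar_frac_integral a t h.
Proof.
by move=> gh; apply: eq_Rintegral => s; rewrite inE/= in_itv/= => /gh ->.
Qed.

Lemma scalar_frac_integralD g h (M N : R) :
  measurable_fun `[0, t] g -> measurable_fun `[0, t] h ->
  (forall s, 0 <= s <= t -> `|g s| <= M) ->
  (forall s, 0 <= s <= t -> `|h s| <= N) ->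
  scalar_frac_integral a t (fun s => g s + h s) =
  scalar_frac_integral a t g + scalar_frac_integral a t h.
Proof.
move=> mg mh gM hN; rewrite -RintegralD//.
- by apply: eq_Rintegral => s _; rewrite mulrDr.
- exact: integrable_frac_kernelM gM.
- exact: integrable_frac_kernelM hN.
Qed.

Lemma scalar_frac_integralZ c g (M : R) :
  measurable_fun `[0, t] g -> (forall s, 0 <= s <= t -> `|g s| <= M) ->
  scalar_frac_integral a t (fun s => c * g s) = c * scalar_frac_integral a t g.
Proof.
move=> mg gM; rewrite -RintegralZl//; last exact: integrable_frac_kernelM gM.
by apply: eq_Rintegral => s _; rewrite mulrCA.
Qed.

Lemma le_norm_scalar_frac_integral g h (M : R) :
  measurable_fun `[0, t] g -> measurable_fun `[0, t] h ->
  (forall s, 0 <= s <= t -> `|g s| <= h s) ->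
  (forall s, 0 <= s <= t -> h s <= M) ->
  `|scalar_frac_integral a t g| <= scalar_frac_integral a t h.
Proof.
move=> mg mh gh hM.
have gM s : 0 <= s <= t -> `|g s| <= M.
  by move=> st; rewrite (le_trans (gh _ st))// hM.
have hM' s : 0 <= s <= t -> `|h s| <= M.
  by move=> st; rewrite ger0_norm ?hM// (le_trans _ (gh _ st)).
have ig := integrable_frac_kernelM a0 t0 mg gM.
apply: le_trans (le_normr_Rintegral _ ig) _ => //.
apply: le_Rintegral => //.
- exact: integrable_norm ig.
- exact: integrable_frac_kernelM hM'.
- move=> s /=; rewrite in_itv/= => /gh ?.
  by rewrite normrM ger0_norm ?frac_kernel_ge0// ler_wpM2l ?frac_kernel_ge0.
Qed.

End bounded.
End scalar_frac_integral.

(** Bounded functionals are bare maps with an explicit constant, so that multiples and compositions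
    with operators keep a computable bound. *)
Definition functional (R : realType) (H : normedModType R) (C : R)
    (phi : H -> R) : Prop :=
  [/\ forall x y, phi (x + y) = phi x + phi y,
      forall c x, phi (c *: x) = c * phi x &
      forall x, `|phi x| <= C * `|x|].

Section functional_theory.
Context {R : realType} {H : normedModType R}.
Implicit Types (C : R) (phi : H -> R).

Lemma functional0 C phi : functional C phi -> phi 0 = 0.
Proof. by move=> [_ phiZ _]; rewrite -(scale0r (0 : H)) phiZ mul0r. Qed.

Lemma functionalN C phi x : functional C phi -> phi (- x) = - phi x.
Proof. by move=> [_ phiZ _]; rewrite -scaleN1r phiZ mulN1r. Qed.

Lemma functionalB C phi x y : functional C phi -> phi (x - y) = phi x - phi y.
Proof. by move=> fphi; have [phiD _ _] := fphi; rewrite phiD (functionalN _ fphi). Qed.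

Lemma functional_sum C phi I (r : seq I) (P : pred I) (F : I -> H) :
  functional C phi -> phi (\sum_(i <- r | P i) F i) = \sum_(i <- r | P i) phi (F i).
Proof.
move=> fphi; have [phiD _ _] := fphi.
by apply: (big_morph phi) => //; exact: functional0 fphi.
Qed.

Lemma functional_scale C phi c : functional C phi -> functional (`|c| * C) (fun x => c * phi x).
Proof.
move=> [phiD phiZ phile]; split.
- by move=> x y; rewrite phiD mulrDr.
- by move=> d x; rewrite phiZ mulrCA.
- by move=> x; rewrite normrM -mulrA ler_wpM2l.
Qed.

Lemma functional_le C C' phi : C <= C' -> functional C phi -> functional C' phi.
Proof.
move=> CC' [phiD phiZ phile]; split => // x.
by rewrite (le_trans (phile _))// ler_wpM2r.
Qed.

End functional_theory.

Section hoelder_scalar.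
Context {R : realType}.

Lemma powR_small (r e : R) : 0 < r -> 0 < e ->
  exists2 d, 0 < d & forall x, 0 <= x < d -> x `^ r < e.
Proof.
move=> r0 e0; exists (e `^ r^-1); first exact: powR_gt0.
move=> x /andP[x0 xd].
rewrite (_ : e = (e `^ r^-1) `^ r); last first.
  by rewrite -powRrM mulVf ?lt0r_neq0// powRr1// ltW.
by rewrite gt0_ltr_powR// ?nnegrE ?powR_ge0.
Qed.

Lemma hoelder_bound (H : normedModType R) (T r : R) (f : R -> H) :
  hoelder_on T r f -> exists2 C : R, 0 <= C & forall s t,
    0 <= s <= T -> 0 <= t <= T -> `|f t - f s| <= C * `|t - s| `^ r.
Proof.
move=> [C fC]; exists `|C| => // s t sT tT.
by rewrite (le_trans (fC _ _ sT tT))// ler_wpM2r ?powR_ge0// ler_norm.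
Qed.

Lemma hoelder_bounded (H : normedModType R) (T r : R) (f : R -> H) : 0 <= r ->
  hoelder_on T r f -> exists2 M : R, 0 <= M & forall s, 0 <= s <= T -> `|f s| <= M.
Proof.
move=> r0 /hoelder_bound[C C0 fC].
have [T0|T0] := leP 0 T; last first.
  by exists 0 => // s /andP[s0 sT]; have := lt_le_trans T0 (le_trans s0 sT); rewrite ltxx.
exists (`|f 0| + C * T `^ r) => [|s sT].
  by rewrite addr_ge0// mulr_ge0// powR_ge0.
rewrite -[f s](subrK (f 0)) addrC (le_trans (ler_normD _ _))// lerD2l.
rewrite (le_trans (fC _ _ _ _))// ?lexx ?T0// subr0 ler_wpM2l//.
have /andP[s0 sT'] := sT.
by rewrite ger0_norm// ge0_ler_powR// nnegrE.
Qed.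

Lemma hoelder_measurable (T r : R) (f : R -> R) : 0 < r ->
  hoelder_on T r f -> measurable_fun `[0, T] f.
Proof.
move=> r0 /hoelder_bound[C C0 fC].
apply: subspace_continuous_measurable_fun; first exact: measurable_itv.
apply/subspace_continuousP => x xT; apply/cvgrPdist_lt => e e0.
have [d d0 dE] := powR_small r0 (divr_gt0 e0 (ltr_pwDl ltr01 C0)).
apply/nbhs_ballP; exists d => //= y xy yT.
move: xT yT; rewrite /= !in_itv/= => xT yT.
rewrite (le_lt_trans (fC _ _ yT xT))//.
have := dE `|x - y|; rewrite normr_ge0/= => /(_ xy).
rewrite ltr_pdivlMr ?(ltr_pwDl ltr01 C0)//; apply: le_lt_trans.
by rewrite mulrC ler_wpM2l ?powR_ge0// lerDr.
Qed.

Lemma functional_hoelder (H : normedModType R) (T r C : R) (f : R -> H) phi :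
  functional C phi -> hoelder_on T r f -> hoelder_on T r (phi \o f : R -> R).
Proof.
move=> fphi /hoelder_bound[L L0 fL]; exists (`|C| * L) => s t sT tT /=.
rewrite -(functionalB _ _ fphi); have [_ _ phile] := fphi.
rewrite (le_trans (phile _))// -mulrA.
rewrite (@le_trans _ _ (`|C| * `|f t - f s|))// ?ler_wpM2r ?ler_norm//.
by rewrite ler_wpM2l// fL.
Qed.

End hoelder_scalar.

(** * Bochner integrals of fractional kernels times Hoelder functions *)

Section simple_integral.
Context {R : realType} {H : completeNormedModType R}.
Local Notation mu := (@lebesgue_measure R).
Variables (D : set R) (mD : measurable D) (finD : (mu D < +oo)%E).

(** [phi \o s] is a finite combination of indicators of level sets; all of them, including that of
    the value 0, meet [D] in finite measure because [D] has finite measure. *)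
Lemma functional_simple_integral (C : R) (phi : H -> R) (s : R -> H) :
  functional C phi -> bochner_simple mu D s ->
  mu.-integrable D (EFin \o (phi \o s)) /\
  \int[mu]_(x in D) phi (s x) = phi (bochner_simple_integral mu D s).
Proof.
move=> fphi [fs ms _].
have [phiD phiZ _] := fphi.
pose F := fset_set (range s).
have phisE x : (phi (s x))%:E =
    (\sum_(v <- F) (phi v)%:E * (\1_(s @^-1` [set v]) x)%:E)%E.
  rewrite (bigD1_seq (s x))/=; last 2 first.
  - by rewrite /F in_fset_set//; apply/mem_set; exists x.
  - exact: fset_uniq.
  rewrite big1 ?adde0; first by rewrite indicE mem_set// mule1.
  by move=> v vsx; rewrite indicE memNset ?mule0//= => /esym/eqP; apply/negP.
have finDv v : (mu (s @^-1` [set v] `&` D) < +oo)%E.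
  apply: le_lt_trans finD; apply: le_measure.
  - by apply/mem_set; apply: measurableI => //; exact: ms.
  - exact/mem_set.
  - exact: subIsetr.
have i1 v : mu.-integrable D (fun x => (\1_(s @^-1` [set v]) x)%:E).
  apply/integrableP; split.
    by apply/measurable_EFinP; exact: measurable_indic.
  under eq_integral do rewrite /= ger0_norm//.
  by rewrite integral_indic; [exact: finDv|exact: mD|exact: ms].
have iF v : mu.-integrable D (fun x => (phi v)%:E * (\1_(s @^-1` [set v]) x)%:E)%E.
  exact: integrableZl.
split.
  apply: (@eq_integrable _ _ _ mu D mD
    (fun x => (\sum_(v <- F) (phi v)%:E * (\1_(s @^-1` [set v]) x)%:E)%E)).
    by move=> x _; rewrite /= -phisE.
  exact: integrable_sum.
rewrite /Rintegral.
under eq_integral do rewrite phisE.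
rewrite integral_sum//.
under eq_bigr => v _.
  rewrite integralZl// integral_indic; [|exact: mD|exact: ms].
  rewrite -[X in (_ * X)%E]fineK ?ge0_fin_numE//; last exact: finDv.
  rewrite -EFinM setIC.
  over.
rewrite sumEFin /= /bochner_simple_integral fsbig_finite// (functional_sum _ _ _ fphi).
by apply: eq_bigr => v _; rewrite phiZ mulrC.
Qed.

(** Monotonicity without measurability, read off from the supremum over simple functions. It serves
    for norms of differences of [H]-valued functions, whose measurability is not established. *)
Lemma le_integral_nonneg (f g : R -> \bar R) :
  (forall x, D x -> 0 <= f x)%E -> (forall x, D x -> f x <= g x)%E ->
  (\int[mu]_(x in D) f x <= \int[mu]_(x in D) g x)%E.
Proof.
move=> f0 fg; have g0 x : D x -> (0 <= g x)%E.
  by move=> Dx; apply: le_trans (fg _ Dx); exact: f0.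
rewrite !ge0_integralE//; apply: ereal_sup_le => _ [h hf <-]; exists h => // x.
apply: le_trans (hf x) _; rewrite !patchE; case: ifPn => // /set_mem; exact: fg.
Qed.

End simple_integral.

Import HBNNSimple.

Section bochner_frac.
Context {R : realType} {H : completeNormedModType R}.
Local Notation mu := (@lebesgue_measure R).
Variables (a t T r : R) (Z : R -> H).
Hypotheses (a0 : 0 < a) (t0 : 0 <= t) (tT : t <= T) (r0 : 0 < r).
Hypothesis hZ : hoelder_on T r Z.
Let D : set R := `[0, t]%classic.
Let f s := frac_kernel a t s *: Z s.

Let mD : measurable D. Proof. exact: measurable_itv. Qed.

Let finD : (mu D < +oo)%E.
Proof. by rewrite lebesgue_measure_itv/=; case: ifP; rewrite ?ltry// -EFinD ltry. Qed.

Let mK : measurable_fun D (EFin \o frac_kernel a t).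
Proof. by apply/measurable_EFinP; exact: measurable_frac_kernel. Qed.

Let mI : measurable_fun D (EFin \o id : R -> \bar R).
Proof. exact/measurable_EFinP. Qed.

(** Explicit approximants: [g n] and [h n] are simple and increase to the kernel and to the identity
    on [D], so [s n] has finite range and converges by continuity of [Z]. Since [0 <= h n x <= x] on
    [D], [Z] is only evaluated there where its Hoelder bound holds. *)
Let g n : R -> R := nnsfun_approx mD mK n.
Let h n : R -> R := nnsfun_approx mD mI n.
Let s n x := g n x *: Z (h n x).

Let g0 n x : 0 <= g n x. Proof. exact: fun_ge0. Qed.
Let h0 n x : 0 <= h n x. Proof. exact: fun_ge0. Qed.

Let K0 x : D x -> (0 <= (EFin \o frac_kernel a t) x)%E.
Proof. by move=> _; rewrite lee_fin frac_kernel_ge0. Qed.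

Let I0 x : D x -> (0 <= (EFin \o id : R -> \bar R) x)%E.
Proof. by rewrite /D/= in_itv/= lee_fin => /andP[]. Qed.

Let gK n x : D x -> g n x <= frac_kernel a t x.
Proof. by move=> Dx; rewrite -lee_fin /g nnsfun_approxE; exact: le_approx. Qed.

Let hI n x : D x -> h n x <= x.
Proof. by move=> Dx; rewrite -lee_fin /h nnsfun_approxE; exact: le_approx. Qed.

Let cvg_g x : D x -> g n x @[n --> \oo] --> frac_kernel a t x.
Proof.
move=> Dx; have /= := @cvg_nnsfun_approx _ _ _ _ mD _ mK K0 x Dx.
by move/fine_cvg.
Qed.

Let cvg_h x : D x -> h n x @[n --> \oo] --> x.
Proof.
move=> Dx; have /= := @cvg_nnsfun_approx _ _ _ _ mD _ mI I0 x Dx.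
by move/fine_cvg.
Qed.

Let bochner_simple_s n : bochner_simple mu D (s n).
Proof.
have ms v : measurable (s n @^-1` [set v]).
  pose J := [set p : R * R | (range (g n) `*` range (h n)) p /\ p.1 *: Z p.2 = v].
  rewrite (_ : _ @^-1` _ = \bigcup_(p in J)
      ((g n @^-1` [set p.1]) `&` (h n @^-1` [set p.2]))); last first.
    apply/seteqP; split => x /=.
      by move=> sx; exists (g n x, h n x) => //; split => //=; split; exists x.
    by move=> [[p q] [_ /= <-]] [/= <- <-].
  apply: fin_bigcup_measurable => [|p _].
    apply: (@sub_finite_set _ _ (range (g n) `*` range (h n))); first by move=> p [].
    by apply: finite_setX; exact: fimfunP.
  by apply: measurableI; exact: measurable_funPTI.
split => //.
- apply: (@sub_finite_set _ _
    [set p.1 *: Z p.2 | p in range (g n) `*` range (h n)]).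
    by move=> _ [x _ <-]; exists (g n x, h n x) => //; split; exists x.
  by apply: finite_image; apply: finite_setX; exact: fimfunP.
- move=> v _; apply: le_lt_trans finD; apply: le_measure.
  + by apply/mem_set; apply: measurableI => //; exact: ms.
  + exact/mem_set.
  + exact: subIsetl.
Qed.

Lemma bochner_approx_frac : exists s, bochner_approx mu D f s.
Proof.
have DT x : D x -> 0 <= x <= T.
  by rewrite /D/= in_itv/= => /andP[-> xt]; rewrite (le_trans xt).
have hT n x : D x -> 0 <= h n x <= T.
  by move=> Dx; rewrite h0 (le_trans (hI n Dx))//; case/andP: (DT _ Dx).
have [C C0 CZ] := hoelder_bound hZ.
have [M M0 MZ] := hoelder_bounded (ltW r0) hZ.
have ZhZ n x : D x -> `|Z x - Z (h n x)| <= C * (x - h n x) `^ r.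
  move=> Dx; rewrite (le_trans (CZ _ _ (hT n _ Dx) (DT _ Dx)))//.
  by rewrite ger0_norm// subr_ge0 hI.
have cvg_powh x : D x -> (x - h n x) `^ r @[n --> \oo] --> 0.
  move=> Dx; apply/cvgrPdist_lt => e e0; have [d d0 dE] := powR_small r0 e0.
  have /cvgrPdist_lt/(_ d d0) := cvg_h Dx; apply: filterS => n.
  rewrite sub0r normrN !ger0_norm ?powR_ge0// ?subr_ge0 ?hI// => xd.
  by apply: dE; rewrite subr_ge0 hI.
have cvg_Zh x : D x -> Z (h n x) @[n --> \oo] --> Z x.
  move=> Dx; apply/cvgrPdist_lt => e e0.
  have : C * (x - h n x) `^ r @[n --> \oo] --> 0.
    by rewrite -[X in _ --> X](mulr0 C); apply: cvgM; [exact: cvg_cst|exact: cvg_powh].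
  move=> /cvgrPdist_lt/(_ e e0); apply: filterS => n.
  rewrite sub0r normrN ger0_norm ?mulr_ge0 ?powR_ge0//.
  by apply: le_lt_trans; exact: ZhZ.
exists s; split => //.
- apply: aeW => x Dx; apply: cvgZ; [exact: cvg_g|exact: cvg_Zh].
(* A scalar, measurable majorant of the approximation error; dominated convergence is applied to it
   instead of to the norm. *)
pose b n x := frac_kernel a t x * (C * (x - h n x) `^ r) + (frac_kernel a t x - g n x) * M.
have sb n x : D x -> `|f x - s n x| <= b n x.
  move=> Dx.
  rewrite (_ : f x - s n x = frac_kernel a t x *: (Z x - Z (h n x)) +
    (frac_kernel a t x - g n x) *: Z (h n x)); last first.
    by rewrite scalerBr scalerBl addrA subrK.
  rewrite (le_trans (ler_normD _ _))// !normrZ lerD//.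
    by rewrite ger0_norm ?frac_kernel_ge0// ler_wpM2l ?frac_kernel_ge0// ZhZ.
  rewrite ger0_norm ?subr_ge0 ?gK// ler_wpM2l ?subr_ge0 ?gK//.
  exact/MZ/hT.
have mb n : measurable_fun D (EFin \o b n).
  apply/measurable_EFinP; apply: measurable_funD; apply: measurable_funM => //.
  - exact: measurable_frac_kernel.
  - apply: measurable_funM => //; apply: measurableT_comp (@measurable_powR R r) _.
    by apply: measurable_funB => //; apply: measurable_funTS; exact: measurable_funPT.
  - apply: measurable_funB; first exact: measurable_frac_kernel.
    by apply: measurable_funTS; exact: measurable_funPT.
have b0 n x : D x -> 0 <= b n x.
  move=> Dx; rewrite addr_ge0// mulr_ge0 ?frac_kernel_ge0 ?subr_ge0 ?gK//.
  by rewrite mulr_ge0 ?powR_ge0.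
have bcvg x : D x -> b n x @[n --> \oo] --> 0.
  move=> Dx; rewrite [X in _ --> X](_ : 0 = frac_kernel a t x * (C * 0) +
    (frac_kernel a t x - frac_kernel a t x) * M); last by rewrite subrr mul0r !mulr0 addr0.
  apply: cvgD; apply: cvgM; try exact: cvg_cst.
    apply: cvgM; first exact: cvg_cst.
    exact: cvg_powh.
  apply: cvgB; first exact: cvg_cst.
  exact: cvg_g.
have ib : mu.-integrable D (EFin \o (fun x => frac_kernel a t x * (C * t `^ r + M))).
  by apply: (integrable_frac_kernelM (M := `|C * t `^ r + M|)).
have bdom n x : D x -> `|b n x| <= frac_kernel a t x * (C * t `^ r + M).
  move=> Dx; rewrite ger0_norm ?b0// mulrDr lerD//.
    rewrite ler_wpM2l ?frac_kernel_ge0// ler_wpM2l//.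
    rewrite ge0_ler_powR ?nnegrE ?subr_ge0 ?hI ?(ltW r0)//.
    by move: Dx; rewrite /D/= in_itv/= => /andP[_ xt]; rewrite lerBlDr ler_wpDr.
  by rewrite ler_wpM2r// gerBl.
have bcvgE : {ae mu, forall x, D x -> (EFin \o b n) x @[n --> \oo] --> cst 0%E x}.
  by apply: aeW => x Dx; apply: cvg_EFin; [exact: nearW|exact: bcvg].
have bdomE : {ae mu, forall x n, D x -> (`|(EFin \o b n) x| <=
    (frac_kernel a t x * (C * t `^ r + M))%:E)%E}.
  by apply: aeW => x n Dx; rewrite /= lee_fin; exact: bdom.
have [_ _] := @dominated_convergence _ _ R mu D mD (fun n => EFin \o b n) (cst 0%E) _
  mb (@measurable_cst _ _ _ _ D 0%E) bcvgE ib bdomE.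
rewrite integral_cst//= mul0e => cvgb.
apply: (squeeze_cvge _ (cvg_cst 0%E) cvgb); apply: nearW => n /=.
rewrite integral_ge0//=.
apply: le_integral_nonneg => x Dx; first by rewrite lee_fin.
by rewrite lee_fin sb.
Qed.

Let phiZ_measurable C (phi : H -> R) : functional C phi -> measurable_fun D (phi \o Z).
Proof.
move=> fphi; have := hoelder_measurable r0 (functional_hoelder fphi hZ).
by apply: measurable_funS => //; apply: subset_itvl; rewrite bnd_simp.
Qed.

Let phiZ_bounded C (phi : H -> R) : functional C phi ->
  exists M, forall s, 0 <= s <= t -> `|phi (Z s)| <= M.
Proof.
move=> fphi; have [M _ MZ] := hoelder_bounded (ltW r0) (functional_hoelder fphi hZ).
by exists M => x /andP[x0 xt]; apply: MZ; rewrite x0 (le_trans xt).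
Qed.

(** The estimate is uniform over functionals of bound 1; this uniformity later turns scalar
    information into convergence in norm. *)
Let phi_simple_integral (phi : H -> R) (u : R -> H) : functional 1 phi ->
  bochner_simple mu D u ->
  (`|phi (bochner_simple_integral mu D u) - scalar_frac_integral a t (phi \o Z)|%:E
   <= \int[mu]_(x in D) `|f x - u x|%:E)%E.
Proof.
move=> fphi su; have [iu <-] := functional_simple_integral mD finD fphi su.
have [M MZ] := phiZ_bounded fphi.
have iZ := integrable_frac_kernelM a0 t0 (phiZ_measurable fphi) MZ.
have iB : mu.-integrable D
    (EFin \o (fun x => phi (u x) - frac_kernel a t x * (phi \o Z) x)).
  have := @integrableB _ _ _ mu D mD _ _ iu iZ.
  by apply: (@eq_integrable _ _ _ mu D mD) => x _ /=; rewrite EFinB.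
rewrite -RintegralB// EFin_normr_Rintegral//.
apply: (@le_trans _ _ (\int[mu]_(x in D)
    `|(phi (u x) - frac_kernel a t x * (phi \o Z) x)%:E|)%E).
  apply: le_abse_integral => //.
  by have /integrableP[] := iB.
apply: le_integral_nonneg => x Dx; first exact: abse_ge0.
rewrite /= lee_fin /f; have [_ phiH phile] := fphi.
by rewrite -phiH -(functionalB _ _ fphi) distrC -[leRHS]mul1r (le_trans _ (phile _)).
Qed.

Hypothesis norming : forall v : H, exists2 phi, functional 1 phi & phi v = `|v|.

Let bochner_approx_near u (e : R) : bochner_approx mu D f u -> 0 < e ->
  \forall n \near \oo, forall phi, functional 1 phi ->
    `|phi (bochner_simple_integral mu D (u n)) -
      scalar_frac_integral a t (phi \o Z)| < e.
Proof.
move=> [su _ cvgu] e0.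
have : \forall n \near \oo, (\int[mu]_(x in D) `|f x - u n x|%:E < e%:E)%E.
  apply: (cvgu [set y | y < e%:E]%E); apply: open_nbhs_nbhs; split; last by rewrite /= lte_fin.
  exact: open_ereal_lt_ereal.
apply: filterS => n ne phi fphi.
by rewrite -lte_fin; apply: le_lt_trans ne; exact: phi_simple_integral.
Qed.

(** The functional that norms a difference of two integrals varies with the index, so the Cauchy
    property rests on the uniformity in [bochner_approx_near]. *)
Let approx_cvg u : bochner_approx mu D f u ->
  exists v : H, bochner_simple_integral mu D (u n) @[n --> \oo] --> v.
Proof.
move=> au; apply/cvg_ex; apply: cauchy_cvg; apply: cauchy_exP => e e0.
have e20 : 0 < e / 2 by rewrite divr_gt0.
have [N _ Nu] := bochner_approx_near au e20.
exists (bochner_simple_integral mu D (u N)).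
exists N => // n Nn; rewrite /= -ball_normE /=.
have [phi fphi <-] := norming (bochner_simple_integral mu D (u N) - bochner_simple_integral mu D (u n)).
rewrite (functionalB _ _ fphi).
have := Nu N (leqnn N) phi fphi; have := Nu n Nn phi fphi.
rewrite !ltr_norml => /andP[n1 n2] /andP[n3 n4].
lra.
Qed.

Let is_bochner_phi u (v : H) phi : functional 1 phi -> bochner_approx mu D f u ->
  bochner_simple_integral mu D (u n) @[n --> \oo] --> v ->
  phi v = scalar_frac_integral a t (phi \o Z).
Proof.
move=> fphi au cv; apply/eqP; rewrite -subr_eq0 -normr_le0; apply/ler_addgt0Pr => e e0.
have e20 : 0 < e / 2 by rewrite divr_gt0.
near \oo => n.
have n1 : `|phi (bochner_simple_integral mu D (u n)) -
    scalar_frac_integral a t (phi \o Z)| < e / 2.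
  by near: n; apply: filterS (bochner_approx_near au e20) => n; exact.
have n2 : `|v - bochner_simple_integral mu D (u n)| < e / 2.
  by near: n; move/cvgrPdist_lt : cv; exact.
have n3 : `|phi v - phi (bochner_simple_integral mu D (u n))| < e / 2.
  rewrite -(functionalB _ _ fphi); have [_ _ phile] := fphi.
  by rewrite (le_lt_trans (phile _))// mul1r.
rewrite add0r -[phi v](subrK (phi (bochner_simple_integral mu D (u n)))) -addrA.
rewrite (le_trans (ler_normD _ _))// [leRHS](splitr e) lerD ?ltW//.
Unshelve. all: by end_near. Qed.

Lemma frac_integrable_hoelder : frac_integrable a Z t.
Proof. exact: bochner_approx_frac. Qed.

Lemma functional_frac_integral C (phi : H -> R) : functional C phi ->
  phi (frac_integral a Z t) = (Gamma a)^-1 * scalar_frac_integral a t (phi \o Z).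
Proof.
move=> fphi.
have [phiD phiH phile] := fphi.
rewrite phiH; congr (_ * _).
have [u au] := bochner_approx_frac.
have [v cv] := approx_cvg au.
(* Existence of one limit excludes the default value of [xget]; the argument continues with the
   sequence [u'] behind the value actually chosen. *)
have : is_bochner_integral mu D f (bochner_integral mu D f).
  by apply: xgetPex; exists v; exists u.
move=> [u' au' cv'].
(* Rescaling brings the bound of [phi] down to 1; the added 1 keeps the denominator positive when
   [C = 0]. *)
pose c := (`|C| + 1)^-1.
have C10 : 0 < `|C| + 1 by rewrite ltr_wpDl.
have c0 : 0 < c by rewrite invr_gt0.
have fphi' : functional 1 (fun x => c * phi x).
  apply: functional_le (functional_scale c fphi).
  rewrite gtr0_norm// /c mulrC ler_pdivrMr// mul1r (le_trans (ler_norm _))//.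
  by rewrite lerDl.
have := is_bochner_phi fphi' au' cv'.
have [M MZ] := phiZ_bounded fphi.
rewrite (scalar_frac_integralZ a0 t0 c (phiZ_measurable fphi) MZ).
by apply: mulfI; rewrite lt0r_neq0.
Qed.
End bochner_frac.

(** * Young sums *)

(* [path (mesh_rel m) a p] says that p partitions [a, last a p] with mesh less
   than m. *)
Definition mesh_rel (R : numDomainType) (m : R) : rel R :=
  fun x y => (x < y) && (y - x < m).

(** Recursive form of [volterra_sum], with the time frozen in the kernel and an arbitrary left end,
    as inductions over partitions require. *)
Fixpoint young_sum (R : realType) (V W : normedModType R) (k : R -> V -> W)
    (f : R -> V) (a : R) (p : seq R) : W :=
  if p is v :: p' then k a (f v - f a) + young_sum k f v p' else 0.

Section partitions.
Context {R : realType}.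
Implicit Types (a b t m : R) (p : seq R).

Lemma volterra_sumE (H : normedModType R) (k : R -> R -> H -> H) (W : R -> H) t p :
  volterra_sum k W t p = young_sum (k t) W 0 p.
Proof.
rewrite /volterra_sum; move: (k t) => {}k.
elim: p (0 : R) => [|v p ih] a; first by rewrite big_geq.
by rewrite [size _]/= big_ltn// big_add1/= ih.
Qed.

Lemma meshE a b v p : mesh a b (v :: p) = Num.max (v - a) (mesh v b p).
Proof. by rewrite /mesh [size _]/= big_ltn// big_add1. Qed.

Lemma itv_partition_mesh_rel a b m p : itv_partition a b p -> mesh a b p < m ->
  path (mesh_rel m) a p /\ last a p = b.
Proof.
move=> [ap /eqP pb] pm; split => //.
elim: p a ap {pb} pm => [//|v p ih] a /= /andP[av vp].
by rewrite meshE gt_max => /andP[vm pm]; rewrite /mesh_rel av vm ih.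
Qed.

Lemma mesh_rel_itv_partition a b m p : 0 < m ->
  path (mesh_rel m) a p -> last a p = b ->
  itv_partition a b p /\ mesh a b p < m.
Proof.
move=> m0; elim: p a => [|v p ih] a /=.
  by move=> _ <-; split; [split => //=|rewrite /mesh big_geq].
move=> /andP[/andP[av vm] vp] /(ih _ vp)[[vp' vb] pm].
split; first by split => //=; rewrite av.
by rewrite meshE gt_max vm.
Qed.

Lemma mesh_rel_le_last a m p : path (mesh_rel m) a p -> a <= last a p.
Proof.
elim: p a => [//|v p ih] a /= /andP[/andP[av _] /ih]; exact/le_trans/ltW.
Qed.

Lemma mesh_rel_lt_last a v m p : path (mesh_rel m) a (v :: p) -> a < last v p.
Proof.
by move=> /= /andP[/andP[av _] /mesh_rel_le_last]; exact: lt_le_trans.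
Qed.

Definition uniform_partition a (h : R) n := [seq a + i.+1%:R * h | i <- iota 0 n].

Lemma uniform_partitionS a h n :
  uniform_partition a h n.+1 = (a + h) :: uniform_partition (a + h) h n.
Proof.
rewrite /uniform_partition /= mul1r; congr (_ :: _).
rewrite (iotaDl 1) -map_comp; apply: eq_map => i /=.
rewrite add1n -[i.+2%:R]natr1 mulrDl mul1r; ring.
Qed.

Lemma uniform_partition_mesh_rel a h m n : 0 < h -> h < m ->
  path (mesh_rel m) a (uniform_partition a h n).
Proof.
move=> h0 hm; elim: n a => [//|n ih] a; rewrite uniform_partitionS/= ih andbT.
by rewrite /mesh_rel ltrDl h0 addrC addKr.
Qed.

Lemma last_uniform_partition a h n : last a (uniform_partition a h n) = a + n%:R * h.
Proof.
elim: n a => [|n ih] a; first by rewrite mul0r addr0.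
by rewrite uniform_partitionS/= ih -natr1 mulrDl mul1r addrAC addrA.
Qed.

Lemma partition_exists a b m : a <= b -> 0 < m ->
  exists2 p, path (mesh_rel m) a p & last a p = b.
Proof.
rewrite le_eqVlt => /predU1P[->|ab] m0; first by exists [::].
have ba0 : 0 < b - a by rewrite subr_gt0.
have [n _ /(_ n (leqnn n)) /= nm] := near_infty_natSinv_lt (PosNum (divr_gt0 m0 ba0)).
exists (uniform_partition a ((b - a) / n.+1%:R) n.+1).
  apply: uniform_partition_mesh_rel; first by rewrite divr_gt0.
  by rewrite mulrC -ltr_pdivlMr.
by rewrite last_uniform_partition mulrC divfK// addrC subrK.
Qed.

Lemma mesh_filter_proper a b : a <= b -> ProperFilter (mesh_filter a b).
Proof.
move=> ab; split; last exact: mesh_filter_filter.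
move=> [d /= d0 dP]; have [p ap pb] := partition_exists ab d0.
by apply: (dP p); exact: mesh_rel_itv_partition.
Qed.

End partitions.

Section power_difference.
Context {R : realType}.

(** The ratio of the two increments is $(p/q)z^{p-q}$ with $y<z<x$; since $p\le q$ it is at most its
    modulus at $y$, which the weight on the left absorbs. The right-hand side is an increment, hence
    telescopes along a partition. *)
Lemma power_difference_gt0 (p q x y : R) : 0 < q -> p <= q -> 0 < y -> y < x ->
  `|x `^ p - y `^ p| * y `^ (q - p) <= `|p| / q * (x `^ q - y `^ q).
Proof.
move=> q0 pq y0 yx.
have cont c : {within `[y, x], continuous (@powR R ^~ c)}.
  exact: within_continuous_powR.
have der c z : z \in `]y, x[ -> is_derive z 1 (@powR R ^~ c) (c * z `^ (c - 1)).
  by rewrite in_itv/= => /andP[yz _]; apply: is_derive1_powR; exact: lt_trans yz.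
have dg0 z : z \in `]y, x[ -> q * z `^ (q - 1) != 0.
  rewrite in_itv/= => /andP[yz _].
  by rewrite lt0r_neq0// mulr_gt0// powR_gt0// (lt_trans y0).
have [z] := cauchy_MVT yx (cont p) (cont q) (der p) (der q) dg0.
rewrite in_itv/= => /andP[yz zx] E.
have z0 : 0 < z by exact: lt_trans yz.
have xyq : 0 < x `^ q - y `^ q.
  by rewrite subr_gt0 gt0_ltr_powR// ?nnegrE ltW// (lt_trans y0).
have -> : x `^ p - y `^ p = p / q * z `^ (p - q) * (x `^ q - y `^ q).
  rewrite -[LHS](divfK (lt0r_neq0 xyq)) -E; congr (_ * _).
  have -> : p - 1 = (p - q) + (q - 1) by ring.
  rewrite gt0_powRD//; field.
  by rewrite lt0r_neq0//= lt0r_neq0// powR_gt0.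
rewrite !normrM (gtr0_norm xyq) normfV (gtr0_norm q0) (ger0_norm (powR_ge0 _ _)).
rewrite -!mulrA ler_wpM2l// ler_wpM2l ?invr_ge0 ?(ltW q0)//.
rewrite mulrCA -[leRHS]mulr1 ler_wpM2l ?(ltW xyq)//.
rewrite -(opprB q p) powRN mulrC ler_pdivrMr ?powR_gt0// mul1r.
by rewrite ge0_ler_powR ?nnegrE ?subr_ge0// ltW.
Qed.

End power_difference.

Section young_sum.
Context {R : realType} {H : normedModType R}.
Variables (K G : R -> R) (W : R -> H) (t : R).
Hypothesis nincG : forall a v, a <= v -> v <= t -> G v <= G a.
Notation S := (young_sum (fun u (h : H) => K u *: h) W).

Lemma young_sum_insert a c v p :
  S a (v :: p) = S a (c :: v :: p) + (K a - K c) *: (W v - W c).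
Proof.
rewrite /= scalerBl (_ : W v - W a = (W c - W a) + (W v - W c)); last first.
  by rewrite [RHS]addrC addrA subrK.
rewrite scalerDr -!addrA; congr (_ + _).
by rewrite [in RHS]addrCA addrC [X in _ = _ + X]addrC subrK.
Qed.

Lemma young_sum_consB a v p q : S a (v :: p) - S a (v :: q) = S v p - S v q.
Proof. by rewrite /= opprD addrACA subrr add0r. Qed.

(** Bounds the defect in [young_sum_insert] for blocks shorter than [m] by a decrement of [G]; [b]
    is a lower bound for the points involved. *)
Definition young_control (b m e : R) :=
  forall a c v, b <= a -> a < c -> c < v -> v <= t -> v - a < m ->
    `|K a - K c| * `|W v - W c| <= e * (G a - G c).

(* Both sums are compared by inserting the smaller of the two next points into
   the other partition; the defects telescope against the control G. *)
Lemma young_sum_compare b m n e d a p q : 0 <= e -> 0 <= d -> b <= a ->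
  young_control b m e -> young_control b n d ->
  path (mesh_rel m) a p -> last a p = t -> path (mesh_rel n) a q -> last a q = t ->
  `|S a p - S a q| <= (e + d) * (G a - G t).
Proof.
move=> e0 d0 + ce cd; move: {2}(size p + size q)%N (leqnn (size p + size q)) => N.
have stop c x (l : seq R) : path (mesh_rel x) c l -> last c l = t -> c <= t.
  by move=> cl <-; exact: mesh_rel_le_last cl.
elim: N a p q => [|N ih] a p q.
  rewrite leqn0 addn_eq0 !size_eq0 => /andP[/eqP-> /eqP->] _ _ /= -> _ _.
  by rewrite subrr normr0 subrr mulr0.
case: p => [_ _ _ /= at0 aq|v p].
  case: q aq => [_ _|c q aq /= qt]; first by rewrite !subrr normr0 at0 subrr mulr0.
  by move: (mesh_rel_lt_last aq); rewrite qt at0 ltxx.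
case: q => [_ _ /= ap pt _ at0|c q sz ba ap pt aq qt].
  by move: (mesh_rel_lt_last ap); rewrite pt at0 ltxx.
have [/andP[av vm] vp] : mesh_rel m a v /\ path (mesh_rel m) v p by exact/andP.
have [/andP[ac cm] cq] : mesh_rel n a c /\ path (mesh_rel n) c q by exact/andP.
have vt := stop _ _ _ vp pt; have ct := stop _ _ _ cq qt.
(* In the strict cases one list keeps its head and the other loses it, so the total length drops by
   one; the shortened first block still respects its mesh bound. *)
have [cv|vc|vc] := ltgtP c v.
- rewrite (young_sum_insert a c v p) -(subrK (G c) (G a)) -[_ - _ + _ - _]addrA mulrDr.
  rewrite (_ : _ + _ - _ = (K a - K c) *: (W v - W c) + (S c (v :: p) - S c q)); last first.
    by rewrite addrAC [LHS]addrC; congr (_ + _); exact: young_sum_consB.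
  rewrite (le_trans (ler_normD _ _))// lerD//.
    rewrite normrZ (le_trans (ce _ _ _ ba ac cv vt vm))// ler_wpM2r ?lerDl//.
    by rewrite subr_ge0 nincG// ltW.
  apply: ih => //=.
  + by move: sz; rewrite /= addnS ltnS.
  + exact: le_trans (ltW ac).
  + by rewrite {1}/mesh_rel cv vp andbT (le_lt_trans _ vm)// lerD2l lerN2 ltW.
- rewrite (young_sum_insert a v c q) -(subrK (G v) (G a)) -[_ - _ + _ - _]addrA mulrDr.
  rewrite (_ : _ - _ = - ((K a - K v) *: (W c - W v)) + (S v p - S v (c :: q))); last first.
    by rewrite -(young_sum_consB a v p (c :: q)) opprD addrA [RHS]addrC.
  rewrite (le_trans (ler_normD _ _))// lerD//.
    rewrite normrN normrZ (le_trans (cd _ _ _ ba av vc ct cm))// ler_wpM2r ?lerDr//.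
    by rewrite subr_ge0 nincG// ltW.
  apply: ih => //=.
  + exact: le_trans (ltW av).
  + by rewrite {1}/mesh_rel vc cq andbT (le_lt_trans _ cm)// lerD2l lerN2 ltW.
- subst c; rewrite young_sum_consB.
  have sz' : (size p + size q <= N)%N.
    by move: sz; rewrite /= addSn ltnS addnS; exact: ltnW.
  apply: le_trans (ih v p q sz' (le_trans ba (ltW av)) vp pt cq qt) _.
  by rewrite ler_wpM2l ?addr_ge0// lerD2r nincG// ltW.
Qed.

End young_sum.

(** The rate of the Cauchy estimate survives in the limit: the second partition is drawn at once
    from a fine mesh and from a neighbourhood of the limit. *)
Lemma mesh_filter_cvg (R : realType) (H : completeNormedModType R)
    (F : seq R -> H) (t C eps : R) : 0 <= t -> 0 <= C -> 0 < eps ->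
  (forall m n p q, 0 < m -> 0 < n ->
    path (mesh_rel m) 0 p -> last 0 p = t -> path (mesh_rel n) 0 q -> last 0 q = t ->
    `|F p - F q| <= C * (m `^ eps + n `^ eps)) ->
  cvg (F @ mesh_filter 0 t) /\
  forall m p, 0 < m -> path (mesh_rel m) 0 p -> last 0 p = t ->
    `|F p - lim (F @ mesh_filter 0 t)| <= C * m `^ eps.
Proof.
move=> t0 C0 eps0 FC; have PF := mesh_filter_proper t0.
have small e : 0 < e -> exists2 m, 0 < m & C * m `^ eps < e.
  move=> e0; have C10 : 0 < C + 1 by rewrite ltr_wpDl.
  have [d d0 dE] := powR_small eps0 (divr_gt0 e0 C10).
  exists (d / 2); first by rewrite divr_gt0.
  have := dE (d / 2); rewrite ltW ?divr_gt0//= gtr_pMr// invf_lt1// ltr1n => /(_ isT).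
  rewrite ltr_pdivlMr//; apply: le_lt_trans.
  by rewrite mulrC ler_wpM2l ?powR_ge0// lerDl.
have cF : cvg (F @ mesh_filter 0 t).
  apply: cauchy_cvg; apply: cauchy_exP => e e0.
  have [m m0 me] := small _ (divr_gt0 e0 (ltr0n R 2)).
  have [p pm pt] := partition_exists t0 m0.
  exists (F p); exists m => // q [q0 qm]; rewrite /= -ball_normE /=.
  have [qm' qt] := itv_partition_mesh_rel q0 qm.
  apply: le_lt_trans (FC _ _ _ _ m0 m0 pm pt qm' qt) _.
  by rewrite mulrDr [ltRHS]splitr ltrD.
split=> // m p m0 pm pt; apply/ler_addgt0Pr => e e0.
have [n n0 ne] := small _ (divr_gt0 e0 (ltr0n R 2)).
have e20 : 0 < e / 2 by rewrite divr_gt0.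
have nearF : mesh_filter 0 t [set q | `|lim (F @ mesh_filter 0 t) - F q| < e / 2].
  by move/cvgrPdist_lt : cF => /(_ _ e20).
have nearn : mesh_filter 0 t [set q | path (mesh_rel n) 0 q /\ last 0 q = t].
  by exists n => // q [q0 qn]; exact: itv_partition_mesh_rel.
have [q [Fq [qn qt]]] := filter_ex (filterI nearF nearn).
have := FC _ _ _ _ m0 n0 pm pt qn qt => Fpq.
rewrite -(subrK (F q) (F p)) -addrA (le_trans (ler_normD _ _))//.
rewrite /= distrC in Fq; move: Fpq; rewrite mulrDr => Fpq.
lra.
Qed.

Definition frac_noise (R : realType) (H : normedModType R) (b : R) (W : R -> H)
  (t : R) : H := volterra_integral (frac_noise_kernel b) W t.

Section frac_noise.
Context {R : realType} {H : completeNormedModType R}.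
Variables (T gamma eps L : R) (W : R -> H).
Hypotheses (eps0 : 0 < eps) (eps_gamma : eps <= gamma) (L0 : 0 <= L).
Hypothesis hW : forall s t, 0 <= s <= T -> 0 <= t <= T ->
  `|W t - W s| <= L * `|t - s| `^ gamma.
Implicit Types (b t m : R).
(** The exponent of the telescoping power: kernel exponent plus the share of [gamma] that is not
    spent on the mesh. *)
Let q b := b - 1 + gamma - eps.

(** In the Hoelder bound of [W] over [[c, v]], the power [eps] uses [v - c <= m] and the power
    [gamma - eps] uses [v - c <= t - c]. The latter is exactly the weight that
    [power_difference_gt0] asks for. *)
Lemma frac_noise_control b t m : 0 < q b -> t <= T ->
  young_control (fun u => (t - u) `^ (b - 1)) (fun u => (t - u) `^ q b) W t 0 m
    (L * (`|b - 1| / q b) * m `^ eps).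
Proof.
move=> q0 tT a c v a0 ac cv vt vam.
have pq : b - 1 <= q b by rewrite /q -addrA lerDl subr_ge0.
have tc0 : 0 < t - c by rewrite subr_gt0 (lt_le_trans cv).
have := @power_difference_gt0 R (b - 1) (q b) (t - a) (t - c) q0 pq tc0.
rewrite ltrD2l ltrN2 => /(_ ac).
rewrite (_ : q b - (b - 1) = gamma - eps); last by rewrite /q; ring.
move=> Dp.
have c0 : 0 <= c by rewrite (le_trans a0)// ltW.
have Wvc : `|W v - W c| <= L * m `^ eps * (t - c) `^ (gamma - eps).
  rewrite (le_trans (hW _ _))//.
  - by rewrite c0 (le_trans (ltW cv))// (le_trans vt).
  - by rewrite (le_trans c0 (ltW cv)) (le_trans vt).
  - have vc0 : 0 < v - c by rewrite subr_gt0.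
    have E : (v - c) `^ gamma = (v - c) `^ eps * (v - c) `^ (gamma - eps).
      by rewrite -gt0_powRD//; congr powR; ring.
    rewrite gtr0_norm// -mulrA ler_wpM2l// E.
    have m0 : 0 < m by apply: lt_trans vam; rewrite subr_gt0 (lt_trans ac).
    have vcm : v - c <= m by lra.
    have vtc : v - c <= t - c by lra.
    rewrite ler_pM ?powR_ge0//; apply: ge0_ler_powR => //;
      by rewrite ?nnegrE ?(ltW tc0) ?(ltW eps0) ?(ltW m0) ?subr_ge0 ?(ltW cv).
apply: le_trans (ler_wpM2l (normr_ge0 _) Wvc) _.
have := ler_wpM2l (mulr_ge0 L0 (powR_ge0 m eps)) Dp.
by congr (_ <= _); ring.
Qed.

Lemma frac_noise_control_nincr b t a v : 0 < q b -> a <= v -> v <= t ->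
  (t - v) `^ q b <= (t - a) `^ q b.
Proof.
move=> q0 av vt; apply: ge0_ler_powR; rewrite ?nnegrE ?(ltW q0)//; lra.
Qed.

(** The left end is arbitrary because the time regularity of the noise integral needs the estimate
    on $[t,t']$ alone, with a small factor from the length of that interval. *)
Lemma frac_noise_compare b a t m n (p p' : seq R) : 0 < q b -> 0 <= a -> t <= T ->
  path (mesh_rel m) a p -> last a p = t -> path (mesh_rel n) a p' -> last a p' = t ->
  `|young_sum (fun u (h : H) => (t - u) `^ (b - 1) *: h) W a p -
    young_sum (fun u (h : H) => (t - u) `^ (b - 1) *: h) W a p'| <=
  L * (`|b - 1| / q b) * (m `^ eps + n `^ eps) * (t - a) `^ q b.
Proof.
move=> q0 a0 tT pm pt pn pt'.
have C0 x : 0 <= L * (`|b - 1| / q b) * x `^ eps.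
  by rewrite !mulr_ge0 ?powR_ge0// invr_ge0 ltW.
have := young_sum_compare (fun a v => @frac_noise_control_nincr b t a v q0)
  (C0 m) (C0 n) a0 (frac_noise_control q0 tT) (frac_noise_control q0 tT)
  pm pt pn pt'.
by rewrite subrr powR0 ?lt0r_neq0// subr0 mulrDr.
Qed.

Lemma frac_noise_cvg b t : 0 < q b -> 0 <= t <= T ->
  volterra_integrable (frac_noise_kernel b) W t /\
  forall m p, 0 < m -> path (mesh_rel m) 0 p -> last 0 p = t ->
    `|young_sum (fun u (h : H) => (t - u) `^ (b - 1) *: h) W 0 p - frac_noise b W t| <=
      L * (`|b - 1| / q b) * t `^ q b * m `^ eps.
Proof.
move=> q0 /andP[t0 tT].
pose F (p : seq R) := volterra_sum (frac_noise_kernel b) W t p.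
have FE p : F p = young_sum (fun u (h : H) => (t - u) `^ (b - 1) *: h) W 0 p.
  by rewrite /F volterra_sumE.
have [] := @mesh_filter_cvg R H F t (L * (`|b - 1| / q b) * t `^ q b) eps t0 _ eps0.
- by rewrite !mulr_ge0 ?powR_ge0// invr_ge0 ltW.
- move=> m n p p' m0 n0 pm pt pn pt'; rewrite !FE.
  by have := frac_noise_compare q0 (lexx 0) tT pm pt pn pt'; rewrite subr0 mulrAC.
- by move=> cF err; split => // m p m0 pm pt; rewrite -FE; exact: err.
Qed.

(** Comparison with the partition consisting of one block, whose sum is explicit. *)
Lemma frac_noise_le b t : 0 < q b -> 0 <= t <= T ->
  `|frac_noise b W t| <= L * (1 + 2 `^ eps * (`|b - 1| / q b)) * t `^ (b - 1 + gamma).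
Proof.
move=> q0 tT; have [_ err] := frac_noise_cvg q0 tT.
have bg : b - 1 + gamma != 0 by rewrite gt_eqF//; move: eps0 q0; rewrite /q; lra.
have /andP[t0 tT'] := tT.
move: t0; rewrite le_eqVlt => /predU1P[t0|t0].
  (* At [t = 0] the partition is empty and the error bound vanishes, so the integral is 0. *)
  have := err 1 [::] ltr01 isT t0; rewrite -t0 !powR0// ?lt0r_neq0//.
  by rewrite !(mulr0, mul0r) /= sub0r normrN.
(* [mesh_rel] is strict, so the single block of length [t] is given the mesh bound [2 * t]; hence
   the factor [2 ^ eps] in the constant. *)
have t20 : 0 < 2 * t by rewrite mulr_gt0.
have pm : path (mesh_rel (2 * t)) 0 [:: t].
  by rewrite /= /mesh_rel t0 subr0 andbT mulr2n mulrDl mul1r ltrDl.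
have := err (2 * t) [:: t] t20 pm erefl.
rewrite /= addr0 subr0 powRM ?(ltW t0)// => E.
rewrite -(subrK ((t `^ (b - 1)) *: (W t - W 0)) (frac_noise b W t)).
rewrite (le_trans (ler_normD _ _))// mulrDr mulrDl addrC mulr1 lerD//.
  rewrite normrZ ger0_norm ?powR_ge0// (gt0_powRD (b - 1) gamma)// mulrCA ler_wpM2l ?powR_ge0//.
  rewrite (le_trans (hW _ _)) ?lexx ?(le_trans (ltW t0))//.
  by rewrite subr0 gtr0_norm.
rewrite distrC (le_trans E)// le_eqVlt; apply/orP; left; apply/eqP.
rewrite (_ : b - 1 + gamma = q b + eps) ?(gt0_powRD (q b) eps)//; last by rewrite /q; ring.
ring.
Qed.

End frac_noise.

(** * Hoelder regularity of the noise *)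

Section power_estimates.
Context {R : realType}.
Implicit Types x y h r s T : R.

Lemma powR_MVT s x y : 0 < y -> y < x ->
  exists2 z, y < z < x & x `^ s - y `^ s = s * z `^ (s - 1) * (x - y).
Proof.
move=> y0 yx.
have der z : z \in `]y, x[ -> is_derive z 1 (@powR R ^~ s) (s * z `^ (s - 1)).
  by rewrite in_itv/= => /andP[yz _]; apply: is_derive1_powR; exact: lt_trans yz.
have [z] := MVT yx der (@within_continuous_powR _ s y x y0).
by rewrite in_itv/= => yzx ->; exists z.
Qed.

Lemma ler_powRD r x y : 0 < r <= 1 -> 0 <= x -> 0 <= y ->
  (x + y) `^ r <= x `^ r + y `^ r.
Proof.
move=> /andP[r0 r1]; rewrite le_eqVlt => /predU1P[<-|x0].
  by rewrite powR0 ?gt_eqF// !add0r.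
rewrite le_eqVlt => /predU1P[<-|y0]; first by rewrite powR0 ?gt_eqF// !addr0.
have xy0 : 0 < x + y by rewrite addr_gt0.
have H z : 0 < z -> z <= x + y -> z * (x + y) `^ (r - 1) <= z `^ r.
  move=> z0 zxy.
  have -> : z `^ r = z * z `^ (r - 1).
    by rewrite -[X in X * _](powRr1 (ltW z0)) -gt0_powRD//; congr powR; ring.
  rewrite ler_wpM2l ?(ltW z0)// -(opprB 1 r) !powRN lef_pV2 ?posrE ?powR_gt0//.
  by apply: ge0_ler_powR; rewrite ?nnegrE ?subr_ge0// ltW.
have -> : (x + y) `^ r = x * (x + y) `^ (r - 1) + y * (x + y) `^ (r - 1).
  rewrite -mulrDl -[X in X * _](powRr1 (ltW xy0)) -gt0_powRD//; congr powR; ring.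
by rewrite lerD// H// ?lerDl ?lerDr ltW.
Qed.

(** The power is viewed as $(x^r)^{s/r}$: the mean value theorem handles the outer exponent
    $s/r\ge1$, and subadditivity gives $x^r-y^r\le(x-y)^r$. *)
Lemma powR_hoelder (T r s : R) : 0 < r <= 1 -> r <= s -> 0 < T ->
  hoelder_on T r (fun t : R => t `^ s : R^o).
Proof.
move=> /andP[r0 r1] rs T0; exists (s / r * T `^ (s - r)).
have s0 : 0 < s by exact: lt_le_trans rs.
suff main y x : 0 <= y -> y <= x -> x <= T ->
    x `^ s - y `^ s <= s / r * T `^ (s - r) * (x - y) `^ r.
  move=> y x /andP[y0 yT] /andP[x0 xT]; have [yx|xy] := leP y x.
    rewrite [leLHS]ger0_norm; last by rewrite subr_ge0 ge0_ler_powR ?nnegrE// ltW.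
    by rewrite [ `|x - y|]ger0_norm ?subr_ge0// main.
  rewrite distrC [ `|x - y|]distrC.
  rewrite [leLHS]ger0_norm; last by rewrite subr_ge0 ge0_ler_powR ?nnegrE// ltW.
  by rewrite [ `|y - x|]ger0_norm ?subr_ge0 ?(ltW xy)// main// ltW.
have C0 : 0 <= s / r * T `^ (s - r).
  by rewrite !mulr_ge0 ?powR_ge0 ?invr_ge0// ltW.
move=> y0; rewrite le_eqVlt => /predU1P[<- _|yx xT].
  by rewrite subrr mulr_ge0// powR_ge0.
have sub : x `^ r - y `^ r <= (x - y) `^ r.
  rewrite lerBlDl -{1}(subrK y x) addrC ler_powRD ?r0// subr_ge0 ltW//.
have x0 : 0 < x by exact: le_lt_trans yx.
rewrite (le_trans _ (ler_wpM2l C0 sub))//.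
move: y0; rewrite le_eqVlt => /predU1P[<-|y0].
  rewrite !powR0 ?gt_eqF// !subr0 -{1}(subrK r s) (gt0_powRD (s - r) r)//.
  rewrite ler_wpM2r ?powR_ge0//.
  rewrite -[leLHS]mul1r ler_pM ?powR_ge0//.
    by rewrite ler_pdivlMr// mul1r.
  by rewrite ge0_ler_powR ?nnegrE ?subr_ge0// ltW.
have yr0 : 0 < y `^ r by exact: powR_gt0.
have yxr : y `^ r < x `^ r by rewrite gt0_ltr_powR// nnegrE ltW.
have [z /andP[yz zx]] := powR_MVT (s / r) yr0 yxr.
rewrite -!powRrM mulrCA divff ?mulr1 ?gt_eqF// => ->.
rewrite ler_wpM2r ?subr_ge0 ?(ltW yxr)// ler_wpM2l ?divr_ge0 ?(ltW s0) ?(ltW r0)//.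
have -> : s - r = r * (s / r - 1) by field; rewrite gt_eqF.
rewrite powRrM ge0_ler_powR ?nnegrE ?powR_ge0// ?subr_ge0 ?ler_pdivlMr ?mul1r//.
  exact: ltW (lt_trans yr0 yz).
by rewrite (le_trans (ltW zx))// ge0_ler_powR ?nnegrE// ltW.
Qed.

(** Interpolation, with exponents $1-r$ and $r$, between the crude bound [B] and the mean value
    bound, which carries the extra factor $|s|(x-y)/y$. The maximum and minimum with 0 treat both
    signs of [s] at once. *)
Lemma powR_increment s r T : 0 < r <= 1 -> 0 < T ->
  exists2 C : R, 0 <= C & forall x y : R, 0 < y -> y < x -> x <= T ->
  `|x `^ s - y `^ s| <= C * (x - y) `^ r * y `^ (Num.min s 0 - r).
Proof.
move=> /andP[r0 r1] T0; exists (`|s| `^ r * T `^ (Num.max s 0)).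
  by rewrite mulr_ge0 ?powR_ge0.
move=> x y y0 yx xT.
pose B := T `^ (Num.max s 0) * y `^ (Num.min s 0).
have B0 : 0 <= B by rewrite mulr_ge0 ?powR_ge0.
have zB z : y <= z -> z <= x -> z `^ s <= B.
  move=> yz zx; have z0 : 0 < z by exact: lt_le_trans yz.
  rewrite /B; have [s0|s0] := leP 0 s.
    rewrite powRr0 mulr1 ge0_ler_powR ?nnegrE ?(ltW z0) ?(ltW T0)//.
    exact: le_trans xT.
  rewrite powRr0 mul1r -(opprK s) !(powRN _ (- s)) lef_pV2 ?posrE ?powR_gt0//.
  by rewrite ge0_ler_powR ?nnegrE ?oppr_ge0 ?(ltW z0) ?(ltW y0) ?(ltW s0).
have D1 : `|x `^ s - y `^ s| <= B.
  have := zB x (ltW yx) (lexx x); have := zB y (lexx y) (ltW yx).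
  have := powR_ge0 x s; have := powR_ge0 y s.
  by rewrite ler_norml => *; apply/andP; split; lra.
have D2 : `|x `^ s - y `^ s| <= B * (`|s| * (x - y) / y).
  have [z /andP[yz zx] ->] := powR_MVT s y0 yx.
  have z0 : 0 < z by exact: lt_trans yz.
  rewrite !normrM (ger0_norm (powR_ge0 _ _)) [ `|x - y|]gtr0_norm ?subr_gt0//.
  have -> : B * (`|s| * (x - y) / y) = `|s| * (B / y) * (x - y) by ring.
  rewrite ler_wpM2r ?subr_ge0 ?(ltW yx)// ler_wpM2l//.
  rewrite (gt0_powRD s (-1))// powR_inv1 ?(ltW z0)//.
  rewrite ler_pM ?powR_ge0 ?invr_ge0 ?(ltW z0) ?zB ?ltW//.
  by rewrite ltf_pV2 ?posrE.
have [->|d0] := eqVneq (`|x `^ s - y `^ s|) 0.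
  by rewrite !mulr_ge0 ?powR_ge0.
have dp : 0 < `|x `^ s - y `^ s| by rewrite lt0r d0 normr_ge0.
have Bp : 0 < B by exact: lt_le_trans D1.
have split_powR u : 0 < u -> u `^ r * u `^ (1 - r) = u.
  by move=> u0; rewrite -gt0_powRD// (_ : r + (1 - r) = 1) ?powRr1 ?(ltW u0)//; ring.
rewrite -[leLHS](split_powR _ dp).
apply: (@le_trans _ _ ((B * (`|s| * (x - y) / y)) `^ r * B `^ (1 - r))).
  rewrite ler_pM ?powR_ge0// ge0_ler_powR ?nnegrE ?subr_ge0 ?(ltW r0)//.
  by rewrite (le_trans _ D2).
have xy0 : 0 <= x - y by rewrite subr_ge0 ltW.
have yV0 : 0 <= y^-1 by rewrite invr_ge0 ltW.
have sxy0 : 0 <= `|s| * (x - y) by rewrite mulr_ge0.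
rewrite (powRM r B0 (mulr_ge0 sxy0 yV0)) mulrAC (split_powR _ Bp).
rewrite (powRM r sxy0 yV0) (powRM r (normr_ge0 s) xy0).
rewrite /B (gt0_powRD _ (- r))// -(powR_inv1 (ltW y0)) -powRrM mulN1r.
rewrite le_eqVlt; apply/orP; left; apply/eqP; ring.
Qed.

End power_estimates.

Section young_sum_algebra.
Context {R : realType} {H : normedModType R}.
Implicit Types (W : R -> H) (p : seq R).

Lemma young_sum_cat (k : R -> H -> H) W a p p' :
  young_sum k W a (p ++ p') = young_sum k W a p + young_sum k W (last a p) p'.
Proof. by elim: p a => [|v p ih] a /=; rewrite ?add0r// ih addrA. Qed.

Lemma young_sum_kernelB (K K' : R -> R) W a p :
  young_sum (fun u (h : H) => K u *: h) W a p - young_sum (fun u (h : H) => K' u *: h) W a p =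
  young_sum (fun u (h : H) => (K u - K' u) *: h) W a p.
Proof.
elim: p a => [|v p ih] a /=; first by rewrite subrr.
by rewrite opprD addrACA ih scalerBl.
Qed.

End young_sum_algebra.

Section power_difference_shift.
Context {R : realType}.

(* Regularity of [t^(b-1)] under a time shift [h]; the weight [y^gamma] is
   supplied by the Hoelder continuity of the noise. *)
Lemma shifted_power_difference (p r gamma T : R) : 0 < r <= 1 -> r < p + gamma ->
  0 < gamma -> 0 < T ->
  exists2 C : R, 0 <= C & exists2 q : R, 0 < q & forall h x y : R, 0 < h -> 0 < y -> y < x -> x + h <= T ->
  `|((x + h) `^ p - x `^ p) - ((y + h) `^ p - y `^ p)| * y `^ gamma <=
  C * h `^ r * (x `^ q - y `^ q).
Proof.
move=> r01 rpg g0 T0.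
have /andP[r0 r1] := r01.
have [C C0 HC] := powR_increment (p - 1) r01 T0.
(* Chosen so that $z^{q-1}$ is the singular factor of [powR_increment] at exponent [p - 1] times
   $z^\gamma$; the quotient in Cauchy's mean value theorem then loses its dependence on [z]. *)
pose q := Num.min (p - 1) 0 - r + gamma + 1.
have q0 : 0 < q by rewrite /q; have [?|?] := leP (p - 1) 0; lra.
exists (`|p| * C / q); first by rewrite !mulr_ge0 ?invr_ge0// ltW.
exists q => // h x y h0 y0 yx xhT.
pose K z := (z + h) `^ p - z `^ p.
pose dK z := p * (z + h) `^ (p - 1) - p * z `^ (p - 1).
have derK (z : R) : 0 < z -> is_derive z 1 K (dK z).
  move=> z0; have zh0 : 0 < z + h by rewrite addr_gt0.
  apply: is_deriveB; last exact: is_derive1_powR.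
  have := is_derive1_comp (is_derive1_powR p zh0 : is_derive (shift h z) 1 _ _)
    (is_derive_shift z 1 h).
  by rewrite mulr1.
have pos (z : R) : z \in `]y, x[ -> 0 < z.
  by rewrite in_itv/= => /andP[yz _]; exact: lt_trans yz.
have contK : {within `[y, x], continuous K}.
  apply: continuous_in_subspaceT => z /set_mem/=; rewrite in_itv/= => /andP[yz _].
  have z0 : 0 < z by exact: lt_le_trans yz.
  by apply/differentiable_continuous/derivable1_diffP; have [] := derK z z0.
have dg0 (z : R) : z \in `]y, x[ -> q * z `^ (q - 1) != 0.
  by move=> /pos z0; rewrite lt0r_neq0// mulr_gt0// powR_gt0.
have [z] := cauchy_MVT yx contK (@within_continuous_powR _ q y x y0)
  (fun z zyx => derK z (pos z zyx)) (fun z zyx => is_derive1_powR q (pos z zyx)) dg0.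
move=> zyx E; have z0 := pos _ zyx.
move: zyx; rewrite in_itv/= => /andP[yz zx].
have xyq : 0 < x `^ q - y `^ q.
  by rewrite subr_gt0 gt0_ltr_powR// ?nnegrE ltW// (lt_trans y0).
have dKz : `|dK z| <= `|p| * (C * h `^ r * z `^ (Num.min (p - 1) 0 - r)).
  rewrite /dK -mulrBr normrM ler_wpM2l//.
  have := HC (z + h) z z0; rewrite ltrDl h0 addrAC subrr add0r => /(_ isT).
  by apply; rewrite (le_trans _ xhT)// lerD2r ltW.
have -> : (x + h) `^ p - x `^ p - ((y + h) `^ p - y `^ p) =
    dK z / (q * z `^ (q - 1)) * (x `^ q - y `^ q).
  by rewrite E divfK// lt0r_neq0.
rewrite !normrM (gtr0_norm xyq) normfV (@gtr0_norm _ (q * _)) ?mulr_gt0 ?powR_gt0//.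
apply: (@le_trans _ _ (`|p| * (C * h `^ r * z `^ (Num.min (p - 1) 0 - r)) /
    (q * z `^ (q - 1)) * (x `^ q - y `^ q) * z `^ gamma)).
  apply: ler_pM; rewrite ?powR_ge0 ?mulr_ge0 ?invr_ge0 ?mulr_ge0 ?powR_ge0 ?(ltW q0) ?(ltW xyq)//.
    rewrite ler_wpM2r ?(ltW xyq)// ler_wpM2r// invr_ge0 mulr_ge0 ?powR_ge0 ?(ltW q0)//.
  by rewrite ge0_ler_powR ?nnegrE ?(ltW g0) ?(ltW y0) ?(ltW z0) ?(ltW yz).
have -> : z `^ (q - 1) = z `^ (Num.min (p - 1) 0 - r) * z `^ gamma.
  by rewrite -gt0_powRD//; congr powR; rewrite /q; ring.
rewrite le_eqVlt; apply/orP; left; apply/eqP; field.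
by rewrite !lt0r_neq0 ?powR_gt0.
Qed.

End power_difference_shift.

Section frac_noise_hoelder.
Context {R : realType} {H : completeNormedModType R}.
Variables (T gamma b r : R) (W : R -> H).
Hypotheses (T0 : 0 < T) (gamma0 : 0 < gamma) (hW : hoelder_on T gamma W).
Hypotheses (r01 : 0 < r <= 1) (rb : r < b - 1 + gamma).

(** The increment splits at [t]: on $[0,t]$ the kernel changes, and [shifted_power_difference]
    supplies a control with factor $h^r$; on $[t,t']$ everything is new and is compared with a
    single block of length [h], which gives $h^{b-1+\gamma}$. *)
Lemma frac_noise_hoelder : hoelder_on T r (frac_noise b W).
Proof.
have /andP[r0 r1] := r01.
have [L L0 WL] := hoelder_bound hW.
pose eps := Num.min gamma ((b - 1 + gamma) / 2).
have eps0 : 0 < eps by rewrite lt_min gamma0 divr_gt0// (lt_trans r0).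
have epsg : eps <= gamma by rewrite ge_min lexx.
have epsb : eps <= (b - 1 + gamma) / 2 by rewrite ge_min lexx orbT.
pose q := b - 1 + gamma - eps.
have q0 : 0 < q by rewrite /q; lra.
have [C1 C10 [q1 q10 HC1]] := @shifted_power_difference R (b - 1) r gamma T r01 rb gamma0 T0.
have pg0 : 0 < b - 1 + gamma by exact: lt_trans rb.
have /hoelder_bound[C2 C20 HC2] := @powR_hoelder R T r (b - 1 + gamma) r01 (ltW rb) T0.
pose k u v := (u - v) `^ (b - 1).
pose S u a p := young_sum (fun v (h : H) => k u v *: h) W a p.
pose D := L * (`|b - 1| / q) * T `^ q.
have D0 : 0 <= D by rewrite !mulr_ge0 ?powR_ge0 ?invr_ge0// ltW.
(* In [A], the doubled term is the comparison with the one-block sum on $[0,t]$ and the other bounds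
   that sum itself; in [B] the summand 1 is the one-block sum on $[t,t']$. *)
pose A := L * C1 * T `^ q1 *+ 2 + L * (`|b - 1| / (b - 1 + gamma)) * C2.
pose B := L * (1 + `|b - 1| / q * (1 + 2 `^ eps)) * T `^ (b - 1 + gamma - r).
suff main t t' : 0 <= t -> t < t' -> t' <= T ->
    `|frac_noise b W t' - frac_noise b W t| <= (A + B) * (t' - t) `^ r.
  exists (A + B) => s t /andP[s0 sT] /andP[t0 tT].
  have [st|ts|->] := ltgtP s t; last by rewrite !subrr !normr0 powR0 ?gt_eqF// mulr0.
    by rewrite [ `|t - s|]gtr0_norm ?subr_gt0// main.
  by rewrite distrC [ `|t - s|]distrC [ `|s - t|]gtr0_norm ?subr_gt0// main.
move=> t0 tt' t'T.
have t'0 : 0 < t' by exact: le_lt_trans tt'.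
have tT : t <= T by rewrite (le_trans (ltW tt')).
pose h := t' - t; have h0 : 0 < h by rewrite subr_gt0.
have hT : h <= T by rewrite /h lerBlDr (le_trans t'T)// lerDl.
have SA m p : path (mesh_rel m) 0 p -> last 0 p = t -> `|S t' 0 p - S t 0 p| <= A * h `^ r.
  move=> pm pt; rewrite /S young_sum_kernelB.
  have ctl n : young_control (fun u => k t' u - k t u) (fun u => (t - u) `^ q1) W t 0 n
      (L * C1 * h `^ r).
    move=> a c v a0 ac cv vt van.
    have tc0 : 0 < t - c by rewrite subr_gt0 (lt_le_trans cv).
    have c0 : 0 <= c by rewrite (le_trans a0)// ltW.
    have := HC1 h (t - a) (t - c) h0 tc0; rewrite ltrD2l ltrN2 => /(_ ac).
    have -> : t - a + h = t' - a by rewrite /h; ring.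
    have -> : t - c + h = t' - c by rewrite /h; ring.
    have t'aT : t' - a <= T by lra.
    move=> /(_ t'aT) HC1'.
    have Wvc : `|W v - W c| <= L * (t - c) `^ gamma.
      have vT : v <= T by exact: le_trans tT.
      have cT : c <= T by exact: ltW (lt_le_trans cv vT).
      have v0 : 0 <= v by exact: le_trans (ltW cv).
      rewrite (le_trans (WL _ _ _ _)) ?c0 ?v0// ler_wpM2l//.
      rewrite gtr0_norm ?subr_gt0//; apply: ge0_ler_powR; rewrite ?nnegrE; lra.
    apply: le_trans (ler_wpM2l (normr_ge0 _) Wvc) _.
    have := ler_wpM2l L0 HC1'.
    by congr (_ <= _); rewrite /k; ring.
  have e0 : 0 <= L * C1 * h `^ r by rewrite !mulr_ge0 ?powR_ge0.
  have ninc a v : a <= v -> v <= t -> (t - v) `^ q1 <= (t - a) `^ q1.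
    by move=> av vt; apply: ge0_ler_powR; rewrite ?nnegrE ?(ltW q10)//; lra.
  move: t0; rewrite le_eqVlt => /predU1P[t0|t0].
    case: p pm pt => [_ _|v p pm pt]; last first.
      by have := mesh_rel_lt_last pm; rewrite /= in pt; rewrite pt -t0 ltxx.
    rewrite /= normr0 mulr_ge0 ?powR_ge0// addr_ge0//.
      by rewrite mulrn_wge0// !mulr_ge0 ?powR_ge0.
    by rewrite !mulr_ge0// invr_ge0 ltW.
  have t1 : path (mesh_rel (t + 1)) 0 [:: t].
    by rewrite /= /mesh_rel t0 subr0 ltrDl ltr01.
  have := young_sum_compare ninc e0 e0 (lexx 0) (ctl m) (ctl (t + 1)) pm pt t1 erefl.
  rewrite subr0 subrr [0 `^ _]powR0 ?gt_eqF// subr0 /= addr0.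
  set X := young_sum _ _ _ _; set Y := _ *: _ => XY.
  rewrite -(subrK Y X) (le_trans (ler_normD _ _))// /A mulrDl lerD//.
    apply: le_trans XY _.
    have -> : L * C1 * T `^ q1 *+ 2 * h `^ r = (L * C1 * h `^ r + L * C1 * h `^ r) * T `^ q1.
      by ring.
    rewrite ler_wpM2l ?addr_ge0//.
    by rewrite ge0_ler_powR ?nnegrE ?(ltW q10) ?(ltW t0) ?(ltW T0).
  rewrite /Y normrZ /k !subr0.
  have Wt : `|W t - W 0| <= L * t `^ gamma.
    by rewrite (le_trans (WL _ _ _ _)) ?lexx ?(ltW T0) ?(ltW t0)// subr0 gtr0_norm.
  apply: le_trans (ler_wpM2l (normr_ge0 _) Wt) _.
  have pq : b - 1 <= b - 1 + gamma by rewrite lerDl ltW.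
  have := power_difference_gt0 pg0 pq t0 tt'.
  rewrite (_ : b - 1 + gamma - (b - 1) = gamma); last by ring.
  move=> Hpd; rewrite mulrCA -!mulrA ler_wpM2l// (le_trans Hpd)//.
  rewrite mulrA ler_wpM2l ?divr_ge0 ?(ltW pg0)//.
  have := HC2 t t'; rewrite (ltW t0) tT (ltW t'0) t'T => /(_ isT isT).
  rewrite [ `|t' - t|]gtr0_norm//; apply: le_trans; exact: ler_norm.
have SB m p : 0 < m -> m <= h -> path (mesh_rel m) t p -> last t p = t' ->
    `|S t' t p| <= B * h `^ r.
  move=> m0 mh pm pt.
  have h2 : path (mesh_rel (2 * h)) t [:: t'].
    by rewrite /= /mesh_rel tt' mulr2n mulrDl mul1r ltrDl h0.
  have := @frac_noise_compare R H T gamma eps L W eps0 epsg L0 WL b t t' m (2 * h) p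
    [:: t'] q0 t0 t'T pm pt h2 erefl.
  rewrite -/q -/h /= addr0.
  rewrite -/(S t' t p); set Y := _ *: _ => XY.
  have hE : h `^ (b - 1 + gamma) = h `^ r * h `^ (b - 1 + gamma - r).
    by rewrite -gt0_powRD//; congr powR; ring.
  have hq : h `^ eps * h `^ q = h `^ (b - 1 + gamma).
    by rewrite -gt0_powRD//; congr powR; rewrite /q; ring.
  have hT' : h `^ (b - 1 + gamma - r) <= T `^ (b - 1 + gamma - r).
    by apply: ge0_ler_powR; rewrite ?nnegrE ?(ltW h0) ?(ltW T0)// subr_ge0 ltW.
  have fin : L * (1 + `|b - 1| / q * (1 + 2 `^ eps)) * h `^ (b - 1 + gamma) <= B * h `^ r.
    rewrite hE mulrCA mulrC ler_wpM2r ?powR_ge0// /B ler_wpM2l//.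
    by rewrite !(mulr_ge0, addr_ge0) ?powR_ge0 ?invr_ge0// ltW.
  apply: le_trans fin.
  rewrite -(subrK Y (S t' t p)) (le_trans (ler_normD _ _))//.
  rewrite addrC mulrDr mulr1 mulrDl lerD//.
    rewrite /Y normrZ ger0_norm ?powR_ge0// (gt0_powRD (b - 1) gamma)// mulrCA.
    rewrite ler_wpM2l ?powR_ge0//.
    by rewrite (le_trans (WL _ _ _ _)) ?t0 ?tT ?t'T ?(ltW t'0)// gtr0_norm.
  apply: le_trans XY _; rewrite -hq powRM ?(ltW h0)//.
  have -> : L * (`|b - 1| / q * (1 + 2 `^ eps)) * (h `^ eps * h `^ q) =
    L * (`|b - 1| / q) * (h `^ eps + 2 `^ eps * h `^ eps) * h `^ q by ring.
  rewrite ler_wpM2r ?powR_ge0// ler_wpM2l; last 2 first.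
  - by rewrite !mulr_ge0// invr_ge0 ltW.
  - by rewrite lerD2r ge0_ler_powR ?nnegrE ?(ltW eps0) ?(ltW m0) ?(ltW h0).
  by [].
apply/ler_addgt0Pr => e e0.
have D10 : 0 < D + 1 by rewrite ltr_wpDl.
have [d d0 dE] := powR_small eps0 (divr_gt0 (divr_gt0 e0 (ltr0n R 2)) D10).
pose m := Num.min (d / 2) h.
have m0 : 0 < m by rewrite lt_min h0 divr_gt0.
have md : m < d.
  by rewrite (@le_lt_trans _ _ (d / 2)) ?ge_min ?lexx// gtr_pMr// invf_lt1// ltr1n.
have mh : m <= h by rewrite ge_min lexx orbT.
have Dm : D * m `^ eps < e / 2.
  have := dE m; rewrite (ltW m0) md => /(_ isT); rewrite ltr_pdivlMr//.
  by apply: le_lt_trans; rewrite mulrC ler_wpM2l ?powR_ge0// lerDl.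
have [p1 p1m p1t] := partition_exists t0 m0.
have [p2 p2m p2t] := partition_exists (ltW tt') m0.
(* Since [t] is a point of this partition, the sum for [t'] splits there exactly. *)
have pm : path (mesh_rel m) 0 (p1 ++ p2) by rewrite cat_path p1m p1t.
have pt : last 0 (p1 ++ p2) = t' by rewrite last_cat p1t.
have errD u p : 0 <= u <= T -> path (mesh_rel m) 0 p -> last 0 p = u ->
    `|S u 0 p - frac_noise b W u| < e / 2.
  move=> /andP[u0 uT] um uu.
  have [_ err] := @frac_noise_cvg R H T gamma eps L W eps0 epsg L0 WL b u q0
    (introT andP (conj u0 uT)).
  apply: le_lt_trans (err m p m0 um uu) _; apply: le_lt_trans Dm.
  rewrite ler_wpM2r ?powR_ge0// ler_wpM2l//; first by rewrite !mulr_ge0// invr_ge0 ltW.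
  by rewrite ge0_ler_powR ?nnegrE ?(ltW q0) ?(ltW T0).
have := errD t' (p1 ++ p2); rewrite (ltW t'0) t'T pm pt => /(_ isT isT erefl) E1.
have := errD t p1; rewrite t0 tT p1m p1t => /(_ isT isT erefl) E2.
have -> : frac_noise b W t' - frac_noise b W t =
    (S t' 0 p1 - S t 0 p1) + S t' t p2 +
    ((S t 0 p1 - frac_noise b W t) - (S t' 0 (p1 ++ p2) - frac_noise b W t')).
  rewrite (_ : S t' 0 (p1 ++ p2) = S t' 0 p1 + S t' t p2); last first.
    by rewrite /S young_sum_cat p1t.
  rewrite opprB [_ - _ + S t' t p2]addrAC -[S t 0 p1 - _ + _]addrA subrKA.
  by rewrite [RHS]addrC -addrA subrK addrC.
rewrite (le_trans (ler_normD _ _))// lerD//.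
  by rewrite (le_trans (ler_normD _ _))// mulrDl lerD//; [exact: SA p1m p1t|exact: SB m0 mh p2m p2t].
rewrite (le_trans (ler_normB _ _))//; lra.
Qed.
End frac_noise_hoelder.

(** * Fractional integral of the noise *)

Section block_integral.
Context {R : realType}.
Local Notation mu := (@lebesgue_measure R).

Lemma powR_half_bound (c x y : R) : 0 < x -> x / 2 <= y -> y <= x ->
  y `^ c <= Num.max 1 (2 `^ (- c)) * x `^ c.
Proof.
move=> x0 xy yx; have x20 : 0 < x / 2 by rewrite divr_gt0.
have y0 : 0 < y by exact: lt_le_trans xy.
have [c0|c0] := leP 0 c.
  apply: (@le_trans _ _ (1 * x `^ c)).
    by rewrite mul1r ge0_ler_powR ?nnegrE// ltW.
  by rewrite ler_wpM2r ?powR_ge0// le_max lexx.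
apply: (@le_trans _ _ (2 `^ (- c) * x `^ c)); last first.
  by rewrite ler_wpM2r ?powR_ge0// le_max lexx orbT.
have -> : 2 `^ (- c) * x `^ c = (x / 2) `^ c.
  by rewrite powRM ?invr_ge0 ?(ltW x0)// mulrC -[in RHS]powR_inv1// -powRrM mulN1r.
rewrite -(opprK c) !(powRN _ (- c)) lef_pV2 ?posrE ?powR_gt0//.
by rewrite ge0_ler_powR ?nnegrE ?oppr_ge0 ?(ltW y0) ?(ltW x20) ?(ltW c0).
Qed.

(** Converts a kernel value times a block length into an increment that telescopes. For [a < 1] the
    mean value point lies below [x], where the power with exponent [a - 1] is larger. *)
Lemma powR_increment_lower (a x y : R) : 0 < a -> 0 <= y -> y < x ->
  Num.min 1 a * (x `^ (a - 1) * (x - y)) <= x `^ a - y `^ a.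
Proof.
move=> a0 y0 yx; have x0 : 0 < x by exact: le_lt_trans yx.
have xE z : 0 < z -> z `^ a = z `^ (a - 1) * z.
  move=> z0; rewrite -[X in _ * X](powRr1 (ltW z0)) -gt0_powRD//.
  by congr powR; ring.
have xy0 : 0 <= x - y by rewrite subr_ge0 ltW.
have [a1|a1] := leP 1 a.
  rewrite mul1r mulrBr -xE// lerD2l lerN2.
  move: y0; rewrite le_eqVlt => /predU1P[<-|y0].
    by rewrite powR0 ?gt_eqF// mulr0.
  rewrite xE// ler_wpM2r ?(ltW y0)//.
  by rewrite ge0_ler_powR ?nnegrE ?subr_ge0 ?(ltW y0) ?(ltW x0) ?(ltW yx).
move: y0; rewrite le_eqVlt => /predU1P[<-|y0].
  rewrite powR0 ?gt_eqF// !subr0 -xE// -[leRHS]mul1r ler_wpM2r ?powR_ge0//.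
  exact: ltW.
have [z /andP[yz zx] ->] := powR_MVT a y0 yx.
have z0 : 0 < z by exact: lt_trans yz.
rewrite mulrA ler_wpM2r// ler_wpM2l ?(ltW a0)//.
rewrite -(opprB 1 a) !(powRN _ (1 - a)) lef_pV2 ?posrE ?powR_gt0//.
by rewrite ge0_ler_powR ?nnegrE ?subr_ge0 ?(ltW a1) ?(ltW x0) ?(ltW z0) ?(ltW zx).
Qed.

Lemma measurable_pos_powR_left (a t : R) :
  measurable_fun [set: R] (fun s : R => pos_powR a (t - s)).
Proof. by apply: measurableT_comp (@measurable_pos_powR R a) _; exact: measurable_funB. Qed.

Lemma measurable_pos_powR_right (a t : R) :
  measurable_fun [set: R] (fun s : R => pos_powR a (s - t)).
Proof. by apply: measurableT_comp (@measurable_pos_powR R a) _; exact: measurable_funB. Qed.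

(** [pos_powR 1] is the indicator of the positive reals, so the Beta convolution also computes
    integrals over an interval. *)
Lemma beta_convolution1l (b u v : R) : 0 < b -> u < v ->
  (\int[mu]_s (pos_powR 1 (v - s) * pos_powR b (s - u))%:E = ((v - u) `^ b / b)%:E)%E.
Proof.
move=> b0 uv; rewrite beta_convolution// Gamma1 mul1r GammaS// pos_powR_gt0E ?subr_gt0//.
rewrite [1 + b]addrC addrK; congr EFin; field.
by rewrite !gt_eqF// Gamma_gt0.
Qed.

Lemma beta_convolution1r (a u t : R) : 0 < a -> u <= t ->
  (\int[mu]_s (pos_powR a (t - s) * pos_powR 1 (s - u))%:E = ((t - u) `^ a / a)%:E)%E.
Proof.
move=> a0; rewrite beta_convolution// Gamma1 mulr1 [a + 1]addrC GammaS//.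
rewrite le_eqVlt => /predU1P[->|ut].
  by rewrite subrr pos_powR_le0E// powR0 ?gt_eqF// mulr0 mul0r.
rewrite pos_powR_gt0E ?subr_gt0// [1 + a]addrC addrK; congr EFin; field.
by rewrite !gt_eqF// Gamma_gt0.
Qed.

Lemma integral_indicator_le (a u v t : R) : 0 < a -> u < v -> v <= t ->
  (\int[mu]_s (pos_powR a (t - s) * (pos_powR 1 (v - s) * pos_powR 1 (s - u)))%:E <=
   (((t - u) `^ a - (t - v) `^ a) / a)%:E)%E.
Proof.
move=> a0 uv vt; rewrite mulrBl EFinB -beta_convolution1r//; last exact: le_trans (ltW uv) vt.
rewrite leeBrDr//.
rewrite -(beta_convolution1r a0 vt) -ge0_integralD//=; last 4 first.
- by move=> s _; rewrite lee_fin !mulr_ge0 ?pos_powR_ge0.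
- apply/measurable_EFinP; apply: measurable_funM; first exact: measurable_pos_powR_left.
  by apply: measurable_funM; [exact: measurable_pos_powR_left|exact: measurable_pos_powR_right].
- by move=> s _; rewrite lee_fin !mulr_ge0 ?pos_powR_ge0.
- apply/measurable_EFinP; apply: measurable_funM; first exact: measurable_pos_powR_left.
  exact: measurable_pos_powR_right.
apply: le_integral_nonneg => s _; first by rewrite -EFinD lee_fin addr_ge0// !mulr_ge0 ?pos_powR_ge0.
rewrite -EFinD lee_fin -mulrDr ler_wpM2l ?pos_powR_ge0//.
rewrite /pos_powR !subrr !powRr0 !subr_gt0.
by case: (ltP s v) => sv; case: (ltP u s) => us; case: (ltP v s) => vs;
  rewrite ?mulr1 ?mulr0 ?addr0 ?add0r//; lra.
Qed.

(** Cutting the block at its midpoint separates the singularities: in the left half [t - s] is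
    comparable with [t - u], in the right half [s - u] is comparable with [v - u]. Both pieces are
    then bounded by the same telescoping increment. *)
Lemma block_integral_le (a b : R) : 0 < a -> 0 < b ->
  exists2 C : R, 0 <= C & forall u v t, u < v -> v <= t ->
  (\int[mu]_s (pos_powR a (t - s) * (pos_powR 1 (v - s) * pos_powR b (s - u)))%:E <=
   (C * (v - u) `^ (b - 1) * ((t - u) `^ a - (t - v) `^ a))%:E)%E.
Proof.
move=> a0 b0.
pose ca : R := Num.max 1 (2 `^ (- (a - 1))).
pose cb : R := Num.max 1 (2 `^ (- (b - 1))).
have ca0 : 0 <= ca by rewrite le_max ler01.
have cb0 : 0 <= cb by rewrite le_max ler01.
have ma0 : 0 < Num.min 1 a by rewrite lt_min ltr01.
exists (ca / b / Num.min 1 a + cb / a).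
  by rewrite addr_ge0// !mulr_ge0 ?invr_ge0// ltW.
move=> u v t uv vt.
have vu0 : 0 < v - u by rewrite subr_gt0.
have tu0 : 0 < t - u by rewrite subr_gt0 (lt_le_trans uv).
apply: (@le_trans _ _ (\int[mu]_s
    ((ca * (t - u) `^ (a - 1))%:E * (pos_powR 1 (v - s) * pos_powR b (s - u))%:E +
     (cb * (v - u) `^ (b - 1))%:E *
       (pos_powR a (t - s) * (pos_powR 1 (v - s) * pos_powR 1 (s - u)))%:E))%E).
  apply: le_integral_nonneg => s _; first by rewrite lee_fin !mulr_ge0 ?pos_powR_ge0.
  rewrite -!EFinM -EFinD lee_fin.
  have [sv|vs] := ltP s v; last first.
    by rewrite (@pos_powR_le0E _ 1 (v - s)) ?subr_le0// !(mul0r, mulr0) addr0.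
  have [us|su] := ltP u s; last first.
    by rewrite !(@pos_powR_le0E _ _ (s - u)) ?subr_le0// !(mul0r, mulr0) addr0.
  have su0 : 0 < s - u by rewrite subr_gt0.
  have st : s < t by exact: lt_le_trans vt.
  rewrite !pos_powR_gt0E ?subr_gt0// !subrr !powRr0 !mul1r mulr1.
  have [h|h] := leP (s - u) ((v - u) / 2).
    apply: ler_wpDr; first by rewrite !mulr_ge0 ?powR_ge0.
    rewrite ler_wpM2r ?powR_ge0// powR_half_bound//; lra.
  apply: ler_wpDl; first by rewrite !mulr_ge0 ?powR_ge0.
  rewrite mulrC ler_wpM2r ?powR_ge0// powR_half_bound//; lra.
have m1 : measurable_fun [set: R] (fun s => (pos_powR 1 (v - s) * pos_powR b (s - u))%:E).
  apply/measurable_EFinP; apply: measurable_funM; first exact: measurable_pos_powR_left.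
  exact: measurable_pos_powR_right.
have m2 : measurable_fun [set: R] (fun s =>
    (pos_powR a (t - s) * (pos_powR 1 (v - s) * pos_powR 1 (s - u)))%:E).
  apply/measurable_EFinP; apply: measurable_funM; first exact: measurable_pos_powR_left.
  by apply: measurable_funM; [exact: measurable_pos_powR_left|exact: measurable_pos_powR_right].
have ca'0 : 0 <= ca * (t - u) `^ (a - 1) by rewrite mulr_ge0 ?powR_ge0.
have cb'0 : 0 <= cb * (v - u) `^ (b - 1) by rewrite mulr_ge0 ?powR_ge0.
rewrite ge0_integralD//=; last 4 first.
- by move=> s _; rewrite -EFinM lee_fin !mulr_ge0 ?pos_powR_ge0 ?powR_ge0.
- exact: measurable_funeM.
- by move=> s _; rewrite -EFinM lee_fin !mulr_ge0 ?pos_powR_ge0 ?powR_ge0.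
- exact: measurable_funeM.
rewrite !ge0_integralZl//=; last 2 first.
- by move=> s _; rewrite lee_fin !mulr_ge0 ?pos_powR_ge0.
- by move=> s _; rewrite lee_fin !mulr_ge0 ?pos_powR_ge0.
rewrite beta_convolution1l//.
apply: (@le_trans _ _ ((ca * (t - u) `^ (a - 1))%:E * ((v - u) `^ b / b)%:E +
   (cb * (v - u) `^ (b - 1))%:E * (((t - u) `^ a - (t - v) `^ a) / a)%:E)%E).
  by rewrite leeD2l// lee_wpmul2l ?lee_fin// integral_indicator_le.
rewrite -!EFinM -EFinD lee_fin.
have := @powR_increment_lower a (t - u) (t - v) a0.
rewrite subr_ge0 vt ltrD2l ltrN2 uv => /(_ isT isT).
rewrite (_ : t - u - (t - v) = v - u); last by ring.
rewrite mulrC -ler_pdivlMr// => D1.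
have -> : (v - u) `^ b = (v - u) `^ (b - 1) * (v - u).
  rewrite -[X in _ * X](powRr1 (ltW vu0)) -gt0_powRD//; congr powR; ring.
have cbv : 0 <= ca / b * (v - u) `^ (b - 1).
  by rewrite !mulr_ge0 ?powR_ge0 ?invr_ge0// ltW.
set D := (t - u) `^ a - (t - v) `^ a in D1 *.
rewrite !mulrDl lerD//; last first.
  rewrite le_eqVlt; apply/orP; left; apply/eqP. rewrite /D; ring.
have := ler_wpM2l cbv D1; by congr (_ <= _); ring.
Qed.

End block_integral.

(* [pos_powR 1 (v - s)] is the indicator of s < v, so only the block of p that
   contains s contributes. *)
Fixpoint last_block_weight (R : realType) (b c u : R) (p : seq R) (s : R) : R :=
  if p is v :: p' then
    (v - u) `^ c * (pos_powR 1 (v - s) * pos_powR b (s - u)) +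
    last_block_weight b c v p' s
  else 0.

Section last_block_weight.
Context {R : realType}.
Local Notation mu := (@lebesgue_measure R).
Implicit Types (b c u s t m : R) (p : seq R).

Lemma last_block_weight_ge0 b c u p s : 0 <= last_block_weight b c u p s.
Proof.
by elim: p u => [//|v p ih] u /=; rewrite addr_ge0// !mulr_ge0 ?powR_ge0 ?pos_powR_ge0.
Qed.

Lemma last_block_weight_left b c u p s m : path (mesh_rel m) u p -> s <= u ->
  last_block_weight b c u p s = 0.
Proof.
elim: p u => [//|v p ih] u /= /andP[/andP[uv _] vp] su.
rewrite ih//; last by rewrite (le_trans su)// ltW.
by rewrite (@pos_powR_le0E _ b) ?subr_le0// !mulr0 addr0.
Qed.

Lemma last_block_weight_right b c u p s m : path (mesh_rel m) u p -> last u p <= s ->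
  last_block_weight b c u p s = 0.
Proof.
elim: p u => [//|v p ih] u /= /andP[_ vp] ps; rewrite ih// addr0.
rewrite (@pos_powR_le0E _ 1) ?mul0r ?mulr0// subr_le0.
by rewrite (le_trans _ ps)// (mesh_rel_le_last vp).
Qed.

Lemma measurable_last_block_weight b c u p : measurable_fun [set: R] (last_block_weight b c u p).
Proof.
elim: p u => [|v p ih] u /=; first exact: measurable_cst.
apply: measurable_funD; last exact: ih.
apply: measurable_funM; first exact: measurable_cst.
by apply: measurable_funM; [exact: measurable_pos_powR_left|exact: measurable_pos_powR_right].
Qed.

(** For [b < 1] the weight is unbounded, but after integration each block contributes at most a
    power of the mesh times an increment of $(t-u)^a$, and the increments add up to $t^a$. *)
Lemma integral_last_block_weight (a b c : R) : 0 < a -> 0 < b -> 0 <= c + b - 1 ->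
  exists2 C : R, 0 <= C & forall m t p, 0 < m -> 0 <= t ->
  path (mesh_rel m) 0 p -> last 0 p = t ->
  (\int[mu]_(s in `[0%R, t]) (frac_kernel a t s * last_block_weight b c 0 p s)%:E <=
   (C * m `^ (c + b - 1) * t `^ a)%:E)%E.
Proof.
move=> a0 b0 cb; have [C C0 HC] := block_integral_le a0 b0.
exists C => // m t p m0 t0 p0 pt.
apply: (@le_trans _ _ (\int[mu]_s (pos_powR a (t - s) * last_block_weight b c 0 p s)%:E)%E).
  rewrite integral_mkcond; apply: le_integral_nonneg => s _.
    rewrite patchE; case: ifP => _//.
    by rewrite lee_fin mulr_ge0 ?frac_kernel_ge0 ?last_block_weight_ge0.
  have r0 : 0 <= pos_powR a (t - s) * last_block_weight b c 0 p s.
    by rewrite mulr_ge0 ?pos_powR_ge0 ?last_block_weight_ge0.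
  rewrite patchE; case: ifP => _; rewrite lee_fin//.
  have [st|ts] := ltP s t; first by rewrite pos_powR_gt0E ?subr_gt0.
  by rewrite (last_block_weight_right _ _ p0) ?pt// !mulr0.
have -> : t `^ a = (t - 0) `^ a by rewrite subr0.
elim: p 0 p0 pt {t0} => [|v p ih] u /= up pt.
  rewrite integral0_eq; last by move=> s _; rewrite mulr0.
  by rewrite lee_fin !mulr_ge0 ?powR_ge0.
have {up}[/andP[uv vum] vp] := andP up.
have vt : v <= t by rewrite -pt (mesh_rel_le_last vp).
have vu0 : 0 < v - u by rewrite subr_gt0.
under eq_integral do rewrite mulrDr EFinD mulrCA EFinM.
have mb : measurable_fun [set: R] (fun s =>
    (pos_powR a (t - s) * (pos_powR 1 (v - s) * pos_powR b (s - u)))%:E).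
  apply/measurable_EFinP; apply: measurable_funM; first exact: measurable_pos_powR_left.
  by apply: measurable_funM; [exact: measurable_pos_powR_left|exact: measurable_pos_powR_right].
rewrite ge0_integralD//=; last 4 first.
- by move=> s _; rewrite -EFinM lee_fin !mulr_ge0 ?pos_powR_ge0 ?powR_ge0.
- exact: measurable_funeM.
- by move=> s _; rewrite lee_fin !mulr_ge0 ?pos_powR_ge0 ?last_block_weight_ge0.
- apply/measurable_EFinP; apply: measurable_funM; first exact: measurable_pos_powR_left.
  exact: measurable_last_block_weight.
rewrite ge0_integralZl//=; last 2 first.
- by move=> s _; rewrite lee_fin !mulr_ge0 ?pos_powR_ge0.
- by rewrite lee_fin powR_ge0.
have powm : (v - u) `^ c * (v - u) `^ (b - 1) <= m `^ (c + b - 1).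
  rewrite -gt0_powRD// addrA ge0_ler_powR ?nnegrE ?(ltW vu0) ?(ltW m0)//.
  exact: ltW.
apply: le_trans (leeD (lee_wpmul2l _ (HC u v t uv vt)) (ih v vp pt)) _.
  by rewrite lee_fin powR_ge0.
rewrite -EFinM -EFinD lee_fin.
have D0 : 0 <= (t - u) `^ a - (t - v) `^ a.
  by rewrite subr_ge0 ge0_ler_powR ?nnegrE ?(ltW a0)//; lra.
have := ler_wpM2r D0 (ler_wpM2l C0 powm).
set X := (t - u) `^ a; set Y := (t - v) `^ a => H.
rewrite -lerBrDr; apply: le_trans (le_trans H _); rewrite le_eqVlt; apply/orP; left; apply/eqP; ring.
Qed.

End last_block_weight.

Section truncation.
Context {R : realType} {H : normedModType R}.
Variables (T gamma L : R) (W : R -> H).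
Hypotheses (gamma0 : 0 < gamma) (L0 : 0 <= L).
Hypothesis hW : forall s t, 0 <= s <= T -> 0 <= t <= T ->
  `|W t - W s| <= L * `|t - s| `^ gamma.

Lemma young_sum_pos_powR_left b a p s m : path (mesh_rel m) a p -> s <= a ->
  young_sum (fun u (h : H) => pos_powR b (s - u) *: h) W a p = 0.
Proof.
elim: p a => [//|v p ih] a /= /andP[/andP[av _] vp] sa.
by rewrite ih ?(le_trans sa (ltW av))// pos_powR_le0E ?subr_le0// scale0r addr0.
Qed.

Lemma young_sum_pos_powR b a p t m : path (mesh_rel m) a p -> last a p = t ->
  young_sum (fun u (h : H) => pos_powR b (t - u) *: h) W a p =
  young_sum (fun u (h : H) => (t - u) `^ (b - 1) *: h) W a p.
Proof.
elim: p a => [//|v p ih] a ap pt; have at0 := mesh_rel_lt_last ap.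
move: ap pt at0 => /= /andP[_ vp] pt; rewrite pt => at0.
by rewrite ih// pos_powR_gt0E// subr_gt0.
Qed.

(** Cutting the partition at [s] alters only the block that contains [s], where [W v] becomes [W s];
    the Hoelder bound of that difference produces the weight. *)
Lemma young_sum_truncate b a p s m : path (mesh_rel m) a p -> 0 <= a ->
  last a p <= T -> a <= s -> s <= last a p ->
  exists p', [/\ path (mesh_rel m) a p', last a p' = s &
    `|young_sum (fun u (h : H) => (s - u) `^ (b - 1) *: h) W a p' -
      young_sum (fun u (h : H) => pos_powR b (s - u) *: h) W a p| <=
    L * last_block_weight b gamma a p s].
Proof.
elim: p a => [|v p ih] a ap a0 pT; rewrite le_eqVlt => /predU1P[as0|as0] sp.
- by exists [::]; split => //=; rewrite subrr normr0 mulr0.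
- by move: sp; rewrite leNgt as0.
- exists [::]; split => //.
  rewrite (young_sum_pos_powR_left _ ap) -?as0//= subrr normr0 mulr_ge0//.
  by rewrite (last_block_weight_ge0 b gamma a (v :: p)).
have := ap; rewrite /= => /andP[/andP[av vm] vp].
have vl := mesh_rel_le_last vp.
have [sv|vs] := leP s v; last first.
  have [p' [p'm p's E]] := ih v vp (le_trans a0 (ltW av)) pT (ltW vs) sp.
  exists (v :: p'); split => //=; first by rewrite /mesh_rel av vm.
  rewrite pos_powR_gt0E ?subr_gt0// opprD addrACA subrr add0r.
  rewrite (le_trans E)// ler_wpM2l// lerDr !mulr_ge0 ?powR_ge0 ?pos_powR_ge0//.
exists [:: s]; split => //=.
  by rewrite andbT /mesh_rel as0 (le_lt_trans _ vm)// lerD2r.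
rewrite addr0 (young_sum_pos_powR_left _ vp)// addr0 (last_block_weight_left _ _ vp)// addr0.
rewrite pos_powR_gt0E ?subr_gt0// -scalerBr opprB addrA subrK normrZ ger0_norm ?powR_ge0//.
move: sv; rewrite le_eqVlt => /predU1P[->|sv].
  by rewrite subrr normr0 mulr0 !mulr_ge0 ?powR_ge0 ?pos_powR_ge0.
rewrite [X in _ <= _ * (_ * (X * _))]pos_powR_gt0E ?subr_gt0// subrr powRr0 mul1r.
rewrite mulrC mulrA ler_wpM2r ?powR_ge0//.
have vT : v <= T by exact: le_trans pT.
have s0 : 0 <= s by rewrite (le_trans a0)// ltW.
rewrite distrC (le_trans (hW _ _)) ?s0 ?(ltW (lt_le_trans sv vT)) ?vT ?(le_trans a0 (ltW av))//.
rewrite gtr0_norm ?subr_gt0// ler_wpM2l// ge0_ler_powR ?nnegrE ?(ltW gamma0)//; lra.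
Qed.

End truncation.

Section semigroup.
Context {R : realType} {H : completeNormedModType R}.
Local Notation mu := (@lebesgue_measure R).
Variables (T gamma : R) (W : R -> H).
Hypotheses (T0 : 0 < T) (gamma0 : 0 < gamma) (hW : hoelder_on T gamma W).

Implicit Types a b t m u : R.

(** Some positive exponent is enough for the measurability and boundedness that the scalar integrals
    require. *)
Lemma frac_noise_hoelder_ex b : 0 < b - 1 + gamma ->
  exists2 r : R, 0 < r & hoelder_on T r (frac_noise b W).
Proof.
move=> bg; pose r := Num.min 1 ((b - 1 + gamma) / 2).
have r0 : 0 < r by rewrite lt_min ltr01 divr_gt0.
exists r => //; apply: (frac_noise_hoelder T0 gamma0 hW).
  by rewrite r0 ge_min lexx.
have : r <= (b - 1 + gamma) / 2 by rewrite ge_min lexx orbT.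
lra.
Qed.

(** The cut-off lets one partition serve all [s]: each block gives one Beta convolution, with the
    same Gamma quotient. *)
Lemma functional_young_sum_integral C (phi : H -> R) a b t m u p :
  functional C phi -> 0 < a -> 0 < b -> 0 <= u -> path (mesh_rel m) u p ->
  mu.-integrable `[0, t] (EFin \o (fun s => frac_kernel a t s *
    phi (young_sum (fun v (h : H) => pos_powR b (s - v) *: h) W u p))) /\
  scalar_frac_integral a t (fun s =>
    phi (young_sum (fun v (h : H) => pos_powR b (s - v) *: h) W u p)) =
  Gamma a * Gamma b / Gamma (a + b) *
    phi (young_sum (fun v (h : H) => pos_powR (a + b) (t - v) *: h) W u p).
Proof.
move=> fphi a0 b0; have [phiD phiZ _] := fphi.
have ik v : 0 <= v -> mu.-integrable `[0, t]
    (EFin \o (fun s => frac_kernel a t s * pos_powR b (s - v))).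
  move=> v0; apply/integrableP; split.
    apply/measurable_EFinP; apply: measurable_funM; first exact: measurable_frac_kernel.
    by apply: measurable_funTS; exact: measurable_pos_powR_right.
  under eq_integral do rewrite /= ger0_norm ?mulr_ge0 ?frac_kernel_ge0 ?pos_powR_ge0//.
  by rewrite integral_frac_kernel_pos_powR// ltry.
elim: p u => [|v p ih] u u0 /=.
  rewrite (functional0 fphi) mulr0 => _; split.
    apply: (@eq_integrable _ _ _ mu _ _ (cst 0%E)) => //.
      by move=> s _ /=; rewrite mulr0.
    exact: integrable0.
  rewrite /scalar_frac_integral; under eq_Rintegral do rewrite mulr0.
  by rewrite Rintegral_cst// mul0r.
move=> /andP[/andP[uv _] vp]; have v0 : 0 <= v by rewrite (le_trans u0)// ltW.
have [i1 E1] := ih v v0 vp.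
set d := W v - W u.
pose g s := frac_kernel a t s * pos_powR b (s - u).
have i2 : mu.-integrable `[0, t] (EFin \o (fun s => g s * phi d)).
  have := @integrableZr _ _ _ mu `[0, t] (measurable_itv _) (phi d) _ (ik u u0).
  by apply: (@eq_integrable _ _ _ mu _ _) => // s _ /=; rewrite EFinM.
have E s : frac_kernel a t s * phi (pos_powR b (s - u) *: d +
    young_sum (fun v (h : H) => pos_powR b (s - v) *: h) W v p) =
    g s * phi d + frac_kernel a t s *
      phi (young_sum (fun v (h : H) => pos_powR b (s - v) *: h) W v p).
  by rewrite phiD phiZ mulrDr mulrA.
split.
  have := @integrableD _ _ _ mu `[0, t] (measurable_itv _) _ _ i2 i1.
  by apply: (@eq_integrable _ _ _ mu _ _) => // s _ /=; rewrite E EFinD.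
rewrite /scalar_frac_integral; under eq_Rintegral do rewrite E.
rewrite RintegralD// RintegralZr//; last exact: ik.
rewrite phiD phiZ mulrDr; congr (_ + _); last exact: E1.
rewrite mulrA; congr (_ * _).
by rewrite /Rintegral integral_frac_kernel_pos_powR.
Qed.

(* On a fixed partition the identity is the Beta convolution, term by term; the
   errors on both sides vanish with the mesh. *)
Lemma scalar_frac_integral_frac_noise C (phi : H -> R) a b t :
  functional C phi -> 0 < a -> 0 < b -> 0 < b - 1 + gamma -> 0 <= t <= T ->
  scalar_frac_integral a t (phi \o frac_noise b W) =
  Gamma a * Gamma b / Gamma (a + b) * phi (frac_noise (a + b) W t).
Proof.
move=> fphi a0 b0 bg tT; have /andP[t0 tT'] := tT.
have [L L0 WL] := hoelder_bound hW.
pose eps := Num.min gamma ((b - 1 + gamma) / 2).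
have eps0 : 0 < eps by rewrite lt_min gamma0 divr_gt0.
have epsg : eps <= gamma by rewrite ge_min lexx.
have epsb : eps <= (b - 1 + gamma) / 2 by rewrite ge_min lexx orbT.
pose q := b - 1 + gamma - eps.
have q0 : 0 < q by rewrite /q; lra.
have qab0 : 0 < a + b - 1 + gamma - eps by move: q0 a0; rewrite /q; lra.
have gb0 : 0 <= gamma + b - 1 by lra.
have [K K0 HK] := @integral_last_block_weight R a b gamma a0 b0 gb0.
have [r r0 hJ] := frac_noise_hoelder_ex bg.
have fphi' : functional `|C| phi by apply: functional_le fphi; exact: ler_norm.
have [_ _ phile] := fphi'.
have hphiJ := functional_hoelder fphi hJ.
have [M _ phiJM] := hoelder_bounded (ltW r0) hphiJ.
have mphiJ : measurable_fun `[0, t] (phi \o frac_noise b W).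
  have := hoelder_measurable r0 hphiJ.
  by apply: measurable_funS => //; apply: subset_itvl; rewrite bnd_simp.
have iJ : mu.-integrable `[0, t] (EFin \o (fun s => frac_kernel a t s * (phi \o frac_noise b W) s)).
  apply: (integrable_frac_kernelM a0 t0 mphiJ (M := M)) => s /andP[s0 st].
  by apply: phiJM; rewrite s0 (le_trans st).
set Bab := Gamma a * Gamma b / Gamma (a + b).
have Bab0 : 0 <= Bab by rewrite !mulr_ge0 ?invr_ge0 ?ltW ?Gamma_gt0 ?addr_gt0.
pose D1 := L * (`|b - 1| / q) * T `^ q.
have D10 : 0 <= D1 by rewrite !mulr_ge0 ?powR_ge0 ?invr_ge0// ltW.
pose D2 := L * (`|a + b - 1| / (a + b - 1 + gamma - eps)) * t `^ (a + b - 1 + gamma - eps).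
have D20 : 0 <= D2 by rewrite !mulr_ge0 ?powR_ge0 ?invr_ge0// ltW.
(* [A] gathers the mesh errors of the two noise integrals, of orders [b] and [a + b]; [B] is the
   truncation error, which has its own power of the mesh. *)
pose A := `|C| * D1 * (t `^ a / a) + Bab * `|C| * D2.
pose B := `|C| * L * K * t `^ a.
have ta0 : 0 <= t `^ a / a by rewrite divr_ge0 ?powR_ge0// ltW.
have A0 : 0 <= A.
  exact: addr_ge0 (mulr_ge0 (mulr_ge0 (normr_ge0 C) D10) ta0)
    (mulr_ge0 (mulr_ge0 Bab0 (normr_ge0 C)) D20).
have B0 : 0 <= B by rewrite /B !mulr_ge0 ?powR_ge0.
have main m : 0 < m ->
    `|scalar_frac_integral a t (phi \o frac_noise b W) -
      Bab * phi (frac_noise (a + b) W t)| <= A * m `^ eps + B * m `^ (gamma + b - 1).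
  move=> m0; have [p pm pt] := partition_exists t0 m0.
  pose Jt s := young_sum (fun v (h : H) => pos_powR b (s - v) *: h) W 0 p.
  have [iJt EJt] := functional_young_sum_integral t fphi a0 b0 (lexx 0) pm.
  have E2 : `|scalar_frac_integral a t (phi \o Jt) -
      Bab * phi (frac_noise (a + b) W t)| <= Bab * `|C| * D2 * m `^ eps.
    rewrite EJt -/Bab -mulrBr -(functionalB _ _ fphi) normrM (ger0_norm Bab0).
    rewrite (_ : Bab * `|C| * D2 * m `^ eps = Bab * (`|C| * (D2 * m `^ eps))); last by ring.
    rewrite ler_wpM2l// (le_trans (phile _))// ler_wpM2l//.
    rewrite (young_sum_pos_powR W (a + b) pm pt).
    have [_ err] := frac_noise_cvg eps0 epsg L0 WL qab0 tT.
    exact: err.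
  have E1 : `|scalar_frac_integral a t (phi \o frac_noise b W) -
      scalar_frac_integral a t (phi \o Jt)| <=
      `|C| * D1 * (t `^ a / a) * m `^ eps + B * m `^ (gamma + b - 1).
    rewrite /scalar_frac_integral -RintegralB//.
    have iB : mu.-integrable `[0, t] (EFin \o (fun s =>
        frac_kernel a t s * (phi \o frac_noise b W) s - frac_kernel a t s * (phi \o Jt) s)).
      have := @integrableB _ _ _ mu `[0, t] (measurable_itv _) _ _ iJ iJt.
      by apply: (@eq_integrable _ _ _ mu _ _) => // s _ /=; rewrite EFinB.
    rewrite -lee_fin EFin_normr_Rintegral//.
    apply: le_trans (le_abse_integral _ _ _) _ => //; first by have /integrableP[] := iB.
    apply: (@le_trans _ _ (\int[mu]_(s in `[0%R, t])
      ((`|C| * D1 * m `^ eps)%:E * (frac_kernel a t s)%:E +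
       (`|C| * L)%:E * (frac_kernel a t s * last_block_weight b gamma 0 p s)%:E))%E).
      apply: le_integral_nonneg => s; first by rewrite abse_ge0.
      rewrite /= in_itv/= => /andP[s0 st].
      rewrite -mulrBr -(functionalB _ _ fphi) -!EFinM -EFinD lee_fin normrM.
      rewrite (ger0_norm (frac_kernel_ge0 _ _ _)).
      (* The partition is cut at [s] because the error bound for the noise integral at [s] concerns
         partitions of $[0,s]$. *)
      have [p' [p'm p's E]] := young_sum_truncate gamma0 L0 WL b pm (lexx 0)
        (etrans (congr1 (fun x => x <= T) pt) tT') s0 (etrans (congr1 (fun x => s <= x) pt) st).
      have sT : 0 <= s <= T by rewrite s0 (le_trans st).
      have [_ err] := frac_noise_cvg eps0 epsg L0 WL q0 sT.
      have E' : `|frac_noise b W s - Jt s| <= D1 * m `^ eps + L * last_block_weight b gamma 0 p s.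
        rewrite -(subrK (young_sum (fun u (h : H) => (s - u) `^ (b - 1) *: h) W 0 p')
          (frac_noise b W s)) -addrA (le_trans (ler_normD _ _))// lerD//.
        rewrite distrC (le_trans (err m p' m0 p'm p's))// ler_wpM2r ?powR_ge0//.
        rewrite ler_wpM2l//; first by rewrite mulr_ge0 ?divr_ge0// ltW.
        by rewrite ge0_ler_powR ?nnegrE ?(ltW q0) ?(ltW T0) ?s0//; case/andP: sT.
      rewrite (_ : `|C| * D1 * m `^ eps * frac_kernel a t s +
        `|C| * L * (frac_kernel a t s * last_block_weight b gamma 0 p s) =
        frac_kernel a t s * (`|C| * (D1 * m `^ eps + L * last_block_weight b gamma 0 p s)));
        last by ring.
      by rewrite ler_wpM2l ?frac_kernel_ge0// (le_trans (phile _))// ler_wpM2l.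
    have mk : measurable_fun `[0, t] (fun s => (frac_kernel a t s)%:E).
      by apply/measurable_EFinP; exact: measurable_frac_kernel.
    have mw : measurable_fun `[0, t] (fun s =>
        (frac_kernel a t s * last_block_weight b gamma 0 p s)%:E).
      apply/measurable_EFinP; apply: measurable_funM; first exact: measurable_frac_kernel.
      by apply: measurable_funTS; exact: measurable_last_block_weight.
    have c10 : 0 <= `|C| * D1 * m `^ eps by rewrite mulr_ge0 ?powR_ge0// mulr_ge0.
    have c20 : 0 <= `|C| * L by rewrite mulr_ge0.
    have w0 s : 0 <= frac_kernel a t s * last_block_weight b gamma 0 p s.
      by rewrite mulr_ge0 ?frac_kernel_ge0 ?last_block_weight_ge0.
    rewrite ge0_integralD//=; last 4 first.
    - by move=> s _; rewrite -EFinM lee_fin mulr_ge0 ?frac_kernel_ge0.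
    - exact: measurable_funeM.
    - by move=> s _; rewrite -EFinM lee_fin mulr_ge0.
    - exact: measurable_funeM.
    rewrite !ge0_integralZl//=; last 2 first.
    - by move=> s _; rewrite lee_fin w0.
    - by move=> s _; rewrite lee_fin frac_kernel_ge0.
    rewrite integral_frac_kernel// -EFinM.
    apply: le_trans (leeD2l _ (lee_wpmul2l _ (HK m t p m0 t0 pm pt))) _; first by rewrite lee_fin.
    rewrite -EFinM -EFinD lee_fin /B le_eqVlt; apply/orP; left; apply/eqP; ring.
  rewrite -(subrK (scalar_frac_integral a t (phi \o Jt))
    (scalar_frac_integral a t (phi \o frac_noise b W))) -addrA.
  rewrite (le_trans (ler_normD _ _))// (le_trans (lerD E1 E2))//.
  by rewrite /A mulrDl addrAC.
apply/eqP; rewrite -subr_eq0 -normr_le0; apply/ler_addgt0Pr => e e0; rewrite add0r.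
have gb0' : 0 < gamma + b - 1 by lra.
have e20 : 0 < e / 2 by rewrite divr_gt0.
have A10 : 0 < A + 1 by rewrite ltr_wpDl.
have B10 : 0 < B + 1 by rewrite ltr_wpDl.
have [d d0 dE] := powR_small eps0 (divr_gt0 e20 A10).
have [d' d'0 dE'] := powR_small gb0' (divr_gt0 e20 B10).
pose m := Num.min d d' / 2.
have mind : 0 < Num.min d d' by rewrite lt_min d0.
have m0 : 0 < m by rewrite divr_gt0.
have mm : m < Num.min d d' by rewrite gtr_pMr// invf_lt1// ltr1n.
move: (mm); rewrite lt_min => /andP[md md'].
apply: le_trans (main m m0) _; rewrite [leRHS]splitr lerD//.
  have := dE m; rewrite (ltW m0) md => /(_ isT); rewrite ltr_pdivlMr// => /ltW.
  by apply: le_trans; rewrite mulrC ler_wpM2l ?powR_ge0// lerDl.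
have := dE' m; rewrite (ltW m0) md' => /(_ isT); rewrite ltr_pdivlMr// => /ltW.
by apply: le_trans; rewrite mulrC ler_wpM2l ?powR_ge0// lerDl.
Qed.

End semigroup.

(** * Norming functionals of a Hilbert space *)

Section norming.
Context {R : realType} {H : normedModType R}.

(** For $v\ne0$ the functional is the inner product with $v/|v|$; its bound 1 is the Cauchy-Schwarz
    inequality, derived on the spot. *)
Lemma dot_norming (dot : {dot H for idfun}) :
  (forall x : H, `|x| ^+ 2 = dot x x) ->
  forall v : H, exists2 phi : H -> R, functional 1 phi & phi v = `|v|.
Proof.
move=> dotE v.
have dotD x y z : dot (x + y) z = dot x z + dot y z by rewrite linearDl.
have dotZ c x z : dot (c *: x) z = c * dot x z by rewrite linearZl_LR.
have dotDr x y z : dot x (y + z) = dot x y + dot x z by rewrite linearDr.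
have dotZr c x z : dot x (c *: z) = c * dot x z by rewrite linearZr_LR.
have dotC x z : dot x z = dot z x.
  by have := hermC dot x z; rewrite expr0 mul1r.
have [->|v0] := eqVneq v 0.
  exists (fun=> 0); last by rewrite normr0.
  split => //; first by move=> x y; rewrite addr0.
  - by move=> c x; rewrite mulr0.
  - by move=> x; rewrite normr0 mul1r.
have vn0 : 0 < `|v| by rewrite normr_gt0.
exists (fun x => `|v|^-1 * dot x v); last first.
  by rewrite -dotE expr2 mulrA mulVf ?mul1r// gt_eqF.
split.
- by move=> x y; rewrite dotD mulrDr.
- by move=> c x; rewrite dotZ mulrCA.
move=> x; rewrite mul1r normrM normfV normr_id mulrC ler_pdivrMr//.
have [->|x0] := eqVneq x 0.
  by rewrite -(scale0r (0 : H)) dotZ mul0r normr0 mulr_ge0.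
have xn0 : 0 < `|x| by rewrite normr_gt0.
have key (c : R) : 0 <= `|x| ^+ 2 + 2 * c * dot x v + c ^+ 2 * `|v| ^+ 2.
  have : 0 <= `|x + c *: v| ^+ 2 by rewrite exprn_ge0.
  rewrite dotE dotD !dotDr !dotZ !dotZr -!dotE (dotC v x).
  by congr (_ <= _); ring.
(* At this scale both squared terms equal $|x|^2$, and the two signs give the two sides of the
   inequality. *)
have k1 := key (`|x| / `|v|); have k2 := key (- (`|x| / `|v|)).
have E : (`|x| / `|v|) ^+ 2 * `|v| ^+ 2 = `|x| ^+ 2.
  by field; rewrite gt_eqF.
rewrite sqrrN E in k2; rewrite E in k1.
have F : `|x| / `|v| * (`|x| * `|v|) = `|x| ^+ 2 by field; rewrite gt_eqF.
have c0 : 0 < `|x| / `|v| by rewrite divr_gt0.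
rewrite ler_norml; apply/andP; split; rewrite -(ler_pM2l c0) ?mulrN F; nra.
Qed.

End norming.

(** * Geometric series and growth of the Gamma function *)

Section geometric.
Context {R : realType}.

Lemma half_expr_small (C e : R) : 0 <= C -> 0 < e ->
  exists N, forall n, (N <= n)%N -> C * 2^-1 ^+ n < e.
Proof.
move=> C0 e0; have : C * 2^-1 ^+ n @[n --> \oo] --> 0.
  rewrite -[X in _ --> X](mulr0 C); apply: cvgM; first exact: cvg_cst.
  by apply: cvg_expr; rewrite ger0_norm// invf_lt1// ltr1n.
move=> /cvgrPdist_lt/(_ e e0)[N _ HN]; exists N => n /HN.
by rewrite sub0r normrN ger0_norm// mulr_ge0// exprn_ge0.
Qed.

Lemma sum_half_expr n : \sum_(0 <= i < n) (2^-1 : R) ^+ i <= 2.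
Proof.
suff -> : \sum_(0 <= i < n) (2^-1 : R) ^+ i = 2 * (1 - 2^-1 ^+ n).
  by rewrite ger_pMr// gerBl exprn_ge0.
elim: n => [|n ih]; first by rewrite big_geq// expr0 subrr mulr0.
by rewrite big_nat_recr//= ih exprS; field.
Qed.

(** The remainder depends on [C] alone, so a bound uniform in time gives convergence uniform in
    time. *)
Lemma geometric_series (H : completeNormedModType R) (u : nat -> H) (C : R) :
  0 <= C -> (forall n, `|u n| <= C * 2^-1 ^+ n) ->
  exists v : H, forall N, `|v - \sum_(0 <= n < N) u n| <= 2 * C * 2^-1 ^+ N.
Proof.
move=> C0 uC.
pose s N := \sum_(0 <= n < N) u n.
have sD N m : `|s (N + m)%N - s N| <= 2 * C * 2^-1 ^+ N.
  rewrite (_ : s (N + m)%N - s N = \sum_(0 <= i < m) u (N + i)%N); last first.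
    rewrite /s (big_cat_nat (n := N))//= ?leq_addr// addrAC subrr add0r.
    by rewrite -{1}[N]add0n big_addn addKn; apply: eq_bigr => i _; rewrite addnC.
  rewrite (le_trans (ler_norm_sum _ _ _))//.
  apply: (@le_trans _ _ (\sum_(0 <= i < m) C * 2^-1 ^+ N * 2^-1 ^+ i)).
    by apply: ler_sum => i _; rewrite (le_trans (uC _))// exprD mulrA.
  rewrite -mulr_sumr [leRHS](_ : _ = C * 2^-1 ^+ N * 2); last by ring.
  by rewrite ler_wpM2l ?sum_half_expr// mulr_ge0// exprn_ge0.
have cs : cvgn s.
  apply: cauchy_cvg; apply: cauchy_exP => e e0.
  have [N HN] := half_expr_small (mulr_ge0 (ler0n R 2) C0) e0.
  exists (s N); exists N => // n /= Nn; rewrite /= -ball_normE /= distrC.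
  by rewrite -(subnKC Nn) (le_lt_trans (sD _ _))// HN.
exists (limn s) => N; apply/ler_addgt0Pr => e e0.
have /cvgrPdist_lt/(_ e e0)[M _ HM] := cs.
have := HM (N + M)%N (leq_addl _ _) => /= h1.
rewrite -(subrK (s (N + M)%N) (limn s)) -addrA (le_trans (ler_normD _ _))//.
by rewrite -/(s N) [leLHS]addrC lerD ?sD// ltW.
Qed.

(** [Gamma_lower_bound] is applied at [1 + c], which is at least 1, and brings in the factor [c] of
    the recursion; [c] grows linearly in [n] and is absorbed by $2^n$. *)
Lemma invGamma_geometric (a b x : R) : 0 < a -> 0 < b -> 0 <= x ->
  exists2 C : R, 0 <= C & forall n, x ^+ n / Gamma (a * n%:R + b) <= C * 2^-1 ^+ n.
Proof.
move=> a0 b0 x0.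
(* With $K^a=4(x+1)$ one has $K^{an}=4^n(x+1)^n$: one factor $2^n$ absorbs [c], the other is the
   geometric decay, and $(x+1)^n$ covers $x^n$. *)
pose K : R := (4 * (x + 1)) `^ a^-1.
have x10 : 0 < 4 * (x + 1) by rewrite mulr_gt0// ltr_wpDl.
have K0 : 0 < K by rewrite powR_gt0.
have Ka : K `^ a = 4 * (x + 1).
  by rewrite /K -powRrM mulVf ?gt_eqF// powRr1// ltW.
exists ((a + b) * expR (K + 1) * K `^ (- b)).
  by rewrite !mulr_ge0 ?expR_ge0 ?powR_ge0// (addr_ge0 (ltW a0) (ltW b0)).
move=> n; pose c := a * n%:R + b.
have c0 : 0 < c by rewrite ltr_wpDl// mulr_ge0// ltW.
have := @Gamma_lower_bound R K (1 + c) K0; rewrite lerDl (ltW c0) => /(_ isT).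
rewrite [1 + c]addrC addrK [c + 1]addrC GammaS// => HG.
have G0 := Gamma_gt0 c0.
rewrite ler_pdivrMr// -/c.
have HG' : K `^ c * expR (- (K + 1)) / c <= Gamma c by rewrite ler_pdivrMr// [leRHS]mulrC.
have C0 : 0 <= (a + b) * expR (K + 1) * K `^ (- b) * 2^-1 ^+ n.
  by rewrite !mulr_ge0 ?expR_ge0 ?powR_ge0 ?exprn_ge0// (addr_ge0 (ltW a0) (ltW b0)).
apply: le_trans (ler_wpM2l C0 HG').
have -> : K `^ c = 4 ^+ n * (x + 1) ^+ n * K `^ b.
  by rewrite /c gt0_powRD// powRrM Ka powR_mulrn ?(ltW x10)// exprMn.
rewrite expRN powRN exprVn.
have -> : 4 ^+ n = 2 ^+ n * 2 ^+ n :> R by rewrite -exprMn -natrM.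
have cn : c <= (a + b) * 2 ^+ n.
  have n2 : n%:R + 1 <= 2 ^+ n :> R by rewrite natr1 -natrX ler_nat ltn_expl.
  have ab0 : 0 <= a + b := addr_ge0 (ltW a0) (ltW b0).
  apply: le_trans (ler_wpM2l ab0 n2); rewrite /c.
  have n0 : 0 <= n%:R :> R by [].
  have := mulr_ge0 (ltW b0) n0; lra.
have -> : (a + b) * expR (K + 1) * (K `^ b)^-1 * (2 ^+ n)^-1 *
    (2 ^+ n * 2 ^+ n * (x + 1) ^+ n * K `^ b * (expR (K + 1))^-1 / c) =
    (a + b) * 2 ^+ n / c * (x + 1) ^+ n.
  by field; rewrite !gt_eqF// ?expR_gt0 ?powR_gt0 ?exprn_gt0.
rewrite -[leLHS]mul1r ler_pM ?exprn_ge0//; first by rewrite ler_pdivlMr// mul1r.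
by rewrite lerXn2r ?nnegrE ?lerDl// addr_ge0.
Qed.

End geometric.

(** * Time regularity of the fractional integral *)

Section kernel_increment.
Context {R : realType}.
Local Notation mu := (@lebesgue_measure R).
Implicit Types a s t r T : R.

Lemma integral_pos_powR_left a t t' : 0 < a -> 0 <= t -> t <= t' ->
  (\int[mu]_(s in `[0%R, t']) (pos_powR a (t - s))%:E = (t `^ a / a)%:E)%E.
Proof.
move=> a0 t0 tt'; have := beta_convolution1r a0 t0; rewrite subr0 => <-.
rewrite -integral_itv_obnd_cbnd; last first.
  by apply/measurable_EFinP; apply: measurable_funTS; exact: measurable_pos_powR_left.
rewrite integral_mkcond; apply: eq_integral => s _; rewrite patchE subr0.
have [s0|s0] := ltP 0 s; last first.
  rewrite (pos_powR_le0E 1 s0) mulr0 memNset//= in_itv/= => /andP[].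
  by rewrite ltNge s0.
rewrite (pos_powR_gt0E 1 s0) subrr powRr0 mulr1.
have [st|ts] := leP s t'; first by rewrite mem_set//= in_itv/= s0.
rewrite memNset/=; last by rewrite in_itv/= => /andP[_]; rewrite leNgt ts.
by rewrite pos_powR_le0E// subr_le0 (le_trans tt')// ltW.
Qed.

(** The kernel is monotone in time, so the modulus opens with a constant sign on each side of [t]
    and the integrals are explicit: $(t'^a-t^a)/a$ for $a\ge1$, and $(2(t'-t)^a+t^a-t'^a)/a$ for
    $a<1$. *)
Lemma kernel_increment_hoelder a r T : 0 < a -> 0 < r <= 1 -> r <= a -> 0 < T ->
  exists2 K : R, 0 <= K & forall t t', 0 <= t -> t < t' -> t' <= T ->
  (\int[mu]_(s in `[0%R, t']) `|frac_kernel a t' s - pos_powR a (t - s)|%:E <=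
   (K * (t' - t) `^ r)%:E)%E.
Proof.
move=> a0 r01 ra T0; have /andP[r0 r1] := r01.
have /hoelder_bound[C C0 HC] := powR_hoelder r01 ra T0.
exists (2 * T `^ (a - r) / a + C / a).
  by rewrite addr_ge0// divr_ge0 ?(ltW a0)// mulr_ge0 ?powR_ge0.
move=> t t' t0 tt' t'T.
have t'0 : 0 < t' by exact: le_lt_trans tt'.
have h0 : 0 < t' - t by rewrite subr_gt0.
have mk : measurable_fun `[0, t'] (frac_kernel a t') by exact: measurable_frac_kernel.
have mp : measurable_fun `[0, t'] (fun s => pos_powR a (t - s)).
  by apply: measurable_funTS; exact: measurable_pos_powR_left.
have m1 : measurable_fun `[0, t'] (fun s => pos_powR 1 (s - t)).
  by apply: measurable_funTS; exact: measurable_pos_powR_right.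
have md : measurable_fun `[0, t'] (fun s => `|frac_kernel a t' s - pos_powR a (t - s)|).
  by apply: measurableT_comp => //; exact: measurable_funB.
have Ik := integral_frac_kernel a0 (ltW t'0).
have Ip := integral_pos_powR_left a0 t0 (ltW tt').
have X0 : (0 <= \int[mu]_(s in `[0%R, t']) `|frac_kernel a t' s - pos_powR a (t - s)|%:E)%E.
  by apply: integral_ge0 => s _; rewrite lee_fin.
have [a1|a1] := leP 1 a.
  have : (\int[mu]_(s in `[0%R, t']) `|frac_kernel a t' s - pos_powR a (t - s)|%:E +
      \int[mu]_(s in `[0%R, t']) (pos_powR a (t - s))%:E <=
      \int[mu]_(s in `[0%R, t']) (frac_kernel a t' s)%:E)%E.
    rewrite -ge0_integralD//=; last 3 first.
    - exact/measurable_EFinP.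
    - by move=> s _; rewrite lee_fin pos_powR_ge0.
    - exact/measurable_EFinP.
    apply: le_integral_nonneg => s; first by rewrite -EFinD lee_fin addr_ge0 ?pos_powR_ge0.
    rewrite /= in_itv/= => /andP[s0 st]; rewrite -EFinD lee_fin.
    have le_pk : pos_powR a (t - s) <= frac_kernel a t' s.
      have [ts|ts] := ltP s t; last by rewrite pos_powR_le0E ?subr_le0// frac_kernel_ge0.
      rewrite pos_powR_gt0E ?subr_gt0// /frac_kernel.
      by apply: ge0_ler_powR; rewrite ?nnegrE ?subr_ge0//; lra.
    by rewrite ger0_norm ?subr_ge0// subrK.
  rewrite Ik Ip -leeBrDr// -EFinB => /le_trans; apply.
  rewrite lee_fin -mulrBl (le_trans (y := C * (t' - t) `^ r / a))//.
    rewrite ler_wpM2r ?invr_ge0 ?(ltW a0)//.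
    have := HC t t'; rewrite t0 (le_trans (ltW tt') t'T) (ltW t'0) t'T => /(_ isT isT).
    by rewrite [ `|t' - t|]gtr0_norm//; apply: le_trans; exact: ler_norm.
  rewrite mulrDl mulrAC lerDr mulr_ge0 ?powR_ge0// divr_ge0 ?(ltW a0)// mulr_ge0 ?powR_ge0//.
have I1 : (\int[mu]_(s in `[0%R, t']) (frac_kernel a t' s * pos_powR 1 (s - t))%:E =
    ((t' - t) `^ a / a)%:E)%E.
  rewrite integral_frac_kernel_pos_powR// Gamma1 mulr1 [a + 1]addrC GammaS//.
  rewrite pos_powR_gt0E// [1 + a]addrC addrK; congr EFin; field.
  by rewrite !gt_eqF// Gamma_gt0.
(* For [a < 1] the later kernel is the smaller one before [t] and stands alone after [t]. Moving it
   to the left-hand side keeps every integrand nonnegative. *)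
have : (\int[mu]_(s in `[0%R, t']) `|frac_kernel a t' s - pos_powR a (t - s)|%:E +
    \int[mu]_(s in `[0%R, t']) (frac_kernel a t' s)%:E <=
    \int[mu]_(s in `[0%R, t']) (pos_powR a (t - s))%:E +
    2%:E * \int[mu]_(s in `[0%R, t']) (frac_kernel a t' s * pos_powR 1 (s - t))%:E)%E.
  have mk1 : measurable_fun `[0, t'] (fun s => (frac_kernel a t' s * pos_powR 1 (s - t))%:E).
    by apply/measurable_EFinP; exact: measurable_funM.
  have k10 s : (0 <= (frac_kernel a t' s * pos_powR 1 (s - t))%:E)%E.
    by rewrite lee_fin mulr_ge0 ?frac_kernel_ge0 ?pos_powR_ge0.
  rewrite -ge0_integralD//=; last 3 first.
  - exact/measurable_EFinP.
  - by move=> s _; rewrite lee_fin frac_kernel_ge0.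
  - exact/measurable_EFinP.
  rewrite -ge0_integralZl//= -ge0_integralD//=; last 4 first.
  - by move=> s _; rewrite lee_fin pos_powR_ge0.
  - exact/measurable_EFinP.
  - by move=> s _; rewrite mule_ge0.
  - exact: measurable_funeM.
  apply: ae_ge0_le_integral => //.
  - by move=> s _; rewrite -EFinD lee_fin addr_ge0 ?frac_kernel_ge0.
  - by apply/measurable_EFinP; exact: measurable_funD.
  - by move=> s _; apply: adde_ge0; [rewrite lee_fin pos_powR_ge0|exact: mule_ge0].
  - apply: emeasurable_funD; first exact/measurable_EFinP.
    exact: measurable_funeM.
  (* At [s = t] both cut-off powers vanish and the inequality fails, so this point is the
     exceptional null set. *)
  exists [set t]; split => //; first exact: lebesgue_measure_set1.
  move=> s /= /not_implyP[]; rewrite in_itv/= => /andP[s0 st] H.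
  apply: contrapT => /eqP st'; apply: H.
  rewrite -!EFinM -!EFinD lee_fin.
  have [ts|ts] := ltP s t.
    rewrite (@pos_powR_le0E _ 1) ?subr_le0 ?(ltW ts)// !mulr0 addr0.
    rewrite pos_powR_gt0E ?subr_gt0// /frac_kernel ler0_norm; last first.
      have s't : s < t' by exact: lt_trans tt'.
      rewrite subr_le0 -(opprB 1 a) !(powRN _ (1 - a)) lef_pV2 ?posrE ?powR_gt0 ?subr_gt0//.
      by apply: ge0_ler_powR; rewrite ?nnegrE; lra.
    by rewrite opprB subrK.
  have ts' : t < s by rewrite lt_neqAle eq_sym st'.
  rewrite (pos_powR_le0E a) ?subr_le0// subr0 add0r ger0_norm ?frac_kernel_ge0//.
  by rewrite (@pos_powR_gt0E _ 1) ?subr_gt0// subrr powRr0 mulr1 mulr_natl mulr2n.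
rewrite Ik Ip I1 -leeBrDr// -EFinM -EFinD => /le_trans; apply.
have tat' : t `^ a <= t' `^ a.
  by rewrite ge0_ler_powR ?nnegrE ?(ltW a0) ?(ltW t'0) ?(ltW tt').
rewrite lee_fin (le_trans (y := 2 * (t' - t) `^ a / a))//.
  rewrite mulrA -mulrDl -mulrBl ler_wpM2r ?invr_ge0 ?(ltW a0)//; lra.
have hE : (t' - t) `^ a = (t' - t) `^ (a - r) * (t' - t) `^ r.
  by rewrite -gt0_powRD// subrK.
have hT : (t' - t) `^ (a - r) <= T `^ (a - r).
  by apply: ge0_ler_powR; rewrite ?nnegrE ?subr_ge0//; lra.
rewrite hE [leRHS]mulrDl; apply: ler_wpDr; first by rewrite !mulr_ge0 ?powR_ge0 ?invr_ge0 ?(ltW a0).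
rewrite (_ : 2 * ((t' - t) `^ (a - r) * (t' - t) `^ r) / a =
  2 / a * (t' - t) `^ r * (t' - t) `^ (a - r)); last by ring.
rewrite (_ : 2 * T `^ (a - r) / a * (t' - t) `^ r =
  2 / a * (t' - t) `^ r * T `^ (a - r)); last by ring.
by rewrite ler_wpM2l// !mulr_ge0 ?powR_ge0 ?invr_ge0 ?(ltW a0).
Qed.

End kernel_increment.

Section frac_integral_theory.
Context {R : realType} {H : completeNormedModType R}.
Local Notation mu := (@lebesgue_measure R).
Hypothesis norming : forall v : H, exists2 phi : H -> R, functional 1 phi & phi v = `|v|.
Variables (a T r : R).
Hypotheses (a0 : 0 < a) (T0 : 0 < T) (r0 : 0 < r).
Implicit Types (Z : R -> H) (t : R).

Lemma functional_eq (u v : H) :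
  (forall phi : H -> R, functional 1 phi -> phi u = phi v) -> u = v.
Proof.
move=> uv; apply/eqP; rewrite -subr_eq0 -normr_eq0; apply/eqP.
have [phi fphi <-] := norming (u - v).
by rewrite (functionalB _ _ fphi) uv// subrr.
Qed.

Let frac_functional Z C (phi : H -> R) t : hoelder_on T r Z -> 0 <= t <= T ->
  functional C phi ->
  phi (frac_integral a Z t) = (Gamma a)^-1 * scalar_frac_integral a t (phi \o Z).
Proof.
by move=> hZ /andP[t0 tT] fphi; exact: (functional_frac_integral a0 t0 tT r0 hZ norming fphi).
Qed.

Let phiZ_measurable Z t C (phi : H -> R) : hoelder_on T r Z -> 0 <= t <= T ->
  functional C phi -> measurable_fun `[0, t] (phi \o Z).
Proof.
move=> hZ /andP[t0 tT] fphi; have := hoelder_measurable r0 (functional_hoelder fphi hZ).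
by apply: measurable_funS => //; apply: subset_itvl; rewrite bnd_simp.
Qed.

Let phiZ_bounded Z t C (phi : H -> R) : hoelder_on T r Z -> 0 <= t <= T ->
  functional C phi -> exists M, forall s, 0 <= s <= t -> `|phi (Z s)| <= M.
Proof.
move=> hZ /andP[t0 tT] fphi.
have [M _ MZ] := hoelder_bounded (ltW r0) (functional_hoelder fphi hZ).
by exists M => x /andP[x0 xt]; apply: MZ; rewrite x0 (le_trans xt).
Qed.

Lemma norm_frac_integral_le Z (g : R -> R) (M : R) t : hoelder_on T r Z -> 0 <= t <= T ->
  measurable_fun `[0, t] g -> (forall s, 0 <= s <= t -> `|Z s| <= g s <= M) ->
  `|frac_integral a Z t| <= (Gamma a)^-1 * scalar_frac_integral a t g.
Proof.
move=> hZ tT mg Zg; have [phi fphi <-] := norming (frac_integral a Z t).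
have Ga0 := Gamma_gt0 a0.
rewrite (frac_functional hZ tT fphi) ler_wpM2l ?invr_ge0 ?(ltW Ga0)//.
apply: le_trans (ler_norm _) _; have [_ _ phile] := fphi.
have /andP[t0 _] := tT.
apply: (le_norm_scalar_frac_integral a0 t0 (M := M)) => //.
- exact: phiZ_measurable fphi.
- move=> s /Zg/andP[Zs _]; rewrite /= (le_trans (phile _))// mul1r//.
- by move=> s /Zg/andP[].
Qed.

Lemma norm_frac_integral_cst Z (M : R) t : hoelder_on T r Z -> 0 <= t <= T ->
  (forall s, 0 <= s <= t -> `|Z s| <= M) ->
  `|frac_integral a Z t| <= (Gamma a)^-1 * (M * (t `^ a / a)).
Proof.
move=> hZ tT ZM; have /andP[t0 _] := tT.
rewrite -scalar_frac_integral_cst//.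
by apply: norm_frac_integral_le => // s /ZM ->/=.
Qed.

Lemma frac_integralD Z Z' t : hoelder_on T r Z -> hoelder_on T r Z' ->
  0 <= t <= T ->
  frac_integral a (fun s => Z s + Z' s) t = frac_integral a Z t + frac_integral a Z' t.
Proof.
move=> hZ hZ' tT; apply: functional_eq => phi fphi; have [phiD _ _] := fphi.
have hD : hoelder_on T r (fun s => Z s + Z' s).
  have [C CZ] := hZ; have [C' CZ'] := hZ'; exists (C + C') => s u sT uT.
  by rewrite opprD addrACA mulrDl (le_trans (ler_normD _ _))// lerD ?CZ ?CZ'.
rewrite phiD (frac_functional hD tT fphi) (frac_functional hZ tT fphi).
rewrite (frac_functional hZ' tT fphi) -mulrDr; congr (_ * _).
have [M ZM] := phiZ_bounded hZ tT fphi; have [M' ZM'] := phiZ_bounded hZ' tT fphi.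
have /andP[t0 _] := tT.
rewrite -(scalar_frac_integralD a0 t0 (phiZ_measurable hZ tT fphi)
  (phiZ_measurable hZ' tT fphi) ZM ZM').
by apply: eq_scalar_frac_integral => s _ /=; rewrite phiD.
Qed.

(** [phi \o B] is again a bounded functional, so both sides have the same scalar images. *)
Lemma frac_integral_linear (B : H -> H) C Z t : (forall x y, B (x + y) = B x + B y) ->
  (forall c x, B (c *: x) = c *: B x) -> (forall x, `|B x| <= C * `|x|) ->
  hoelder_on T r Z -> 0 <= t <= T ->
  frac_integral a (B \o Z) t = B (frac_integral a Z t).
Proof.
move=> BD BZ BC hZ tT; apply: functional_eq => phi fphi; have [phiD phiZ phile] := fphi.
have fphiB : functional C (phi \o B).
  split => [x y|c x|x] /=; rewrite ?BD ?BZ//.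
  by rewrite (le_trans (phile _))// mul1r.
have hB : hoelder_on T r (B \o Z).
  have [L L0 LZ] := hoelder_bound hZ; exists (`|C| * L) => s u sT uT /=.
  have -> : B (Z u) - B (Z s) = B (Z u - Z s).
    by rewrite -scaleN1r -BZ -BD scaleN1r.
  rewrite (le_trans (BC _))// (@le_trans _ _ (`|C| * `|Z u - Z s|))//.
    by rewrite ler_wpM2r// ler_norm.
  by rewrite -mulrA ler_wpM2l// LZ.
rewrite (frac_functional hB tT fphi).
by have /= -> := frac_functional hZ tT fphiB.
Qed.

(** The constant involves [Z] only through its sup bound [G], not through its Hoelder constant; this
    is what makes the Hoelder constants of the Picard terms summable. *)
Lemma frac_integral_hoelder rho : 0 < rho <= 1 -> rho <= a ->
  exists2 K : R, 0 <= K & forall Z (G : R), hoelder_on T r Z -> 0 <= G ->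
    (forall s, 0 <= s <= T -> `|Z s| <= G) -> forall s t, 0 <= s <= T -> 0 <= t <= T ->
    `|frac_integral a Z t - frac_integral a Z s| <= K * G * `|t - s| `^ rho.
Proof.
move=> rho01 rhoa; have [K K0 HK] := kernel_increment_hoelder a0 rho01 rhoa T0.
have Ga0 := Gamma_gt0 a0; have /andP[rho0 _] := rho01.
exists ((Gamma a)^-1 * K) => [|Z G hZ G0 ZG]; first by rewrite mulr_ge0// invr_ge0 ltW.
suff main s t : 0 <= s -> s < t -> t <= T ->
    `|frac_integral a Z t - frac_integral a Z s| <= (Gamma a)^-1 * K * G * (t - s) `^ rho.
  move=> s t /andP[s0 sT] /andP[t0 tT].
  have [st|ts|->] := ltgtP s t; last by rewrite !subrr !normr0 powR0 ?gt_eqF// mulr0.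
    by rewrite [ `|t - s|]gtr0_norm ?subr_gt0// main.
  by rewrite distrC [ `|t - s|]distrC [ `|s - t|]gtr0_norm ?subr_gt0// main.
move=> s0 st tT.
have t0 : 0 <= t by rewrite (le_trans s0)// ltW.
have t0T : 0 <= t <= T by rewrite t0.
have s0T : 0 <= s <= T by rewrite s0 (le_trans (ltW st)).
have [phi fphi <-] := norming (frac_integral a Z t - frac_integral a Z s).
rewrite (functionalB _ _ fphi) (frac_functional hZ t0T fphi) (frac_functional hZ s0T fphi).
rewrite -mulrBr -!mulrA ler_wpM2l ?invr_ge0 ?(ltW Ga0)//.
have mz := phiZ_measurable hZ t0T fphi.
have [_ _ phile] := fphi.
have zG u : 0 <= u <= t -> `|(phi \o Z) u| <= G.
  move=> /andP[u0 ut]; rewrite /= (le_trans (phile _))// mul1r ZG// u0.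
  exact: le_trans tT.
pose z : R -> R := phi \o Z.
have ip : mu.-integrable `[0, t] (EFin \o (fun u => pos_powR a (s - u) * z u)).
  have ipG : mu.-integrable `[0, t] (EFin \o (fun u => pos_powR a (s - u) * G)).
    have i1 : mu.-integrable `[0, t] (EFin \o (fun u => pos_powR a (s - u))).
      apply/integrableP; split.
        by apply/measurable_EFinP; apply: measurable_funTS; exact: measurable_pos_powR_left.
      under eq_integral do rewrite /= ger0_norm ?pos_powR_ge0//.
      by rewrite integral_pos_powR_left ?ltry// ltW.
    have := @integrableZr _ _ _ mu `[0, t] (measurable_itv _) G _ i1.
    by apply: (@eq_integrable _ _ _ mu _ _) => // u _ /=; rewrite EFinM.
  apply: (@le_integrable _ _ _ mu `[0, t] (measurable_itv _) _ _ _ _ ipG).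
    apply/measurable_EFinP; apply: measurable_funM => //.
    by apply: measurable_funTS; exact: measurable_pos_powR_left.
  move=> u /=; rewrite in_itv/= => ut.
  by rewrite lee_fin !normrM ler_wpM2l// (le_trans (zG _ ut))// ler_norm.
have ik : mu.-integrable `[0, t] (EFin \o (fun u => frac_kernel a t u * z u)).
  exact: (integrable_frac_kernelM a0 t0 mz zG).
(* The integral up to [s] is rewritten over $[0,t]$ with the cut-off kernel, so that both integrals
   share a domain and can be subtracted. *)
have -> : scalar_frac_integral a s z = \int[mu]_(u in `[0, t]) (pos_powR a (s - u) * z u).
  rewrite /scalar_frac_integral -Rintegral_itv_bndo_bndc; last first.
    have mzs := phiZ_measurable hZ s0T fphi.
    have zGs u : 0 <= u <= s -> `|(phi \o Z) u| <= G.
      by move=> /andP[u0 us]; rewrite zG// u0 (le_trans us)// ltW.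
    have := integrable_frac_kernelM a0 s0 mzs zGs.
    by apply: integrableS => //; exact: subset_itv_co_cc.
  rewrite Rintegral_mkcond [RHS]Rintegral_mkcond; apply: eq_Rintegral => u _.
  rewrite !patchE; have [us|su] := ltP u s; last first.
    rewrite memNset/=; last by rewrite in_itv/= => /andP[_]; rewrite ltNge su.
    by rewrite pos_powR_le0E ?subr_le0// mul0r; case: ifP.
  rewrite pos_powR_gt0E ?subr_gt0//; have [u0|u0] := leP 0 u.
    by rewrite !mem_set//= in_itv/= u0 ?us// ltW// (lt_trans us).
  by rewrite !memNset//= in_itv/= => /andP[]; rewrite leNgt u0.
rewrite -RintegralB// (le_trans (ler_norm _))//.
have iB : mu.-integrable `[0, t] (EFin \o (fun u =>
    frac_kernel a t u * z u - pos_powR a (s - u) * z u)).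
  have := @integrableB _ _ _ mu `[0, t] (measurable_itv _) _ _ ik ip.
  by apply: (@eq_integrable _ _ _ mu _ _) => // u _ /=; rewrite EFinB.
rewrite -lee_fin EFin_normr_Rintegral//.
apply: le_trans (le_abse_integral _ _ _) _ => //; first by have /integrableP[] := iB.
apply: (@le_trans _ _ (\int[mu]_(u in `[0%R, t])
    (G%:E * `|frac_kernel a t u - pos_powR a (s - u)|%:E))%E).
  apply: le_integral_nonneg => u; first by rewrite abse_ge0.
  rewrite /= in_itv/= => ut; rewrite -mulrBl normrM -EFinM lee_fin mulrC.
  by rewrite ler_wpM2r// zG.
rewrite ge0_integralZl//=; last first.
  apply/measurable_EFinP; apply: measurableT_comp => //; apply: measurable_funB.
    exact: measurable_frac_kernel.
  by apply: measurable_funTS; exact: measurable_pos_powR_left.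
apply: le_trans (lee_wpmul2l _ (HK s t s0 st tT)) _; first by rewrite lee_fin.
by rewrite -EFinM lee_fin mulrCA.
Qed.

End frac_integral_theory.

(** * Mittag-Leffler kernel *)

Section iterate.
Context {R : realType} {H : normedModType R}.
Variables (A : {linear H -> H}) (M : R).
Hypotheses (M0 : 0 <= M) (AM : forall x, `|A x| <= M * `|x|).

Lemma iter_linearD n x z : iter n A (x + z) = iter n A x + iter n A z.
Proof. by elim: n => //= n ->; rewrite linearD. Qed.

Lemma iter_linearZ n (c : R) x : iter n A (c *: x) = c *: iter n A x.
Proof. by elim: n => //= n ->; rewrite linearZ. Qed.

Lemma iter_linear0 n : iter n A 0 = 0.
Proof. by elim: n => //= n ->; rewrite linear0. Qed.

Lemma iter_linearB n x z : iter n A (x - z) = iter n A x - iter n A z.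
Proof. by elim: n => //= n ->; rewrite linearB. Qed.

Lemma norm_iter_le n x : `|iter n A x| <= M ^+ n * `|x|.
Proof.
elim: n => [|n ih]; first by rewrite expr0 mul1r.
by rewrite iterS (le_trans (AM _))// exprS -mulrA ler_wpM2l.
Qed.

End iterate.

Section mittag_leffler_theory.
Context {R : realType} {H : completeNormedModType R}.
Variables (A : {linear H -> H}) (M : R).
Hypotheses (M0 : 0 <= M) (AM : forall x, `|A x| <= M * `|x|).
Implicit Types a b t : R.

(** The norms of the terms decay geometrically, hence the series converges in operator norm and the
    default value in [mittag_leffler] is not taken. *)
Lemma mittag_leffler_cvg a b t x : 0 < a -> 0 < b -> 0 <= t ->
  mittag_leffler_sum a b A t n x @[n --> \oo] --> mittag_leffler a b A t x.
Proof.
move=> a0 b0 t0.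
have [C C0 HC] := invGamma_geometric a0 b0 (mulr_ge0 t0 M0).
have termle n z : `|(t ^+ n / Gamma (a * n%:R + b)) *: iter n A z| <= C * `|z| * 2^-1 ^+ n.
  have G0 : 0 < Gamma (a * n%:R + b).
    by rewrite Gamma_gt0// ltr_wpDl// mulr_ge0// ltW.
  rewrite normrZ ger0_norm; last by rewrite divr_ge0 ?exprn_ge0// ltW.
  apply: le_trans (ler_wpM2l _ (norm_iter_le M0 AM n z)) _.
    by rewrite divr_ge0 ?exprn_ge0// ltW.
  rewrite mulrA (mulrAC C) ler_wpM2r//; apply: le_trans (HC n).
  by rewrite exprMn mulrAC.
(* The pointwise sums are assembled into one map; the remainder, linear in the norm of [z], makes
   the convergence one in operator norm. *)
have /choice[E HE] : forall z, exists v : H, forall N,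
    `|v - mittag_leffler_sum a b A t N z| <= 2 * (C * `|z|) * 2^-1 ^+ N.
  by move=> z; apply: geometric_series => //; rewrite mulr_ge0.
have isE : is_mittag_leffler a b A t E.
  move=> e e0; have [N HN] := half_expr_small (mulr_ge0 (ler0n R 2) C0) e0.
  exists N => // n /= Nn z; apply: le_trans (HE z n) _.
  by rewrite mulrA mulrAC ler_wpM2r// ltW// HN.
have isML : is_mittag_leffler a b A t (mittag_leffler a b A t).
  by apply: xgetPex; exists E.
apply/cvgrPdist_le => e e0.
have x10 : 0 < `|x| + 1 by rewrite ltr_wpDl.
have := isML (e / (`|x| + 1)) (divr_gt0 e0 x10); apply: filterS => n /(_ x) h.
apply: le_trans h _; rewrite mulrAC ler_pdivrMr// ler_wpM2l ?(ltW e0)// lerDl//.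
Qed.

End mittag_leffler_theory.

Section volterra_mittag_leffler.
Context {R : realType} {H : completeNormedModType R}.
Variables (A : {linear H -> H}) (M T gamma alpha : R) (W : R -> H).
Hypotheses (M0 : 0 <= M) (AM : forall x, `|A x| <= M * `|x|).
Hypotheses (T0 : 0 < T) (gamma0 : 0 < gamma) (hW : hoelder_on T gamma W).
Hypotheses (alpha0 : 0 < alpha) (alpha_gamma : 1 - gamma < alpha).

Let beta n : R := alpha * n%:R + alpha.

(** The integral of the n-th term of the Mittag-Leffler kernel, with the operator taken outside the
    integral. *)
Definition mittag_leffler_noise_term n t : H :=
  (Gamma (beta n))^-1 *: iter n A (frac_noise (beta n) W t).

Lemma young_sum_kernel_cvg (k : nat -> R -> H -> H) (k' : R -> H -> H) a p :
  (forall u d, k n u d @[n --> \oo] --> k' u d) ->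
  young_sum (k n) W a p @[n --> \oo] --> young_sum k' W a p.
Proof.
move=> kk'; elim: p a => [|v p ih] a /=; first exact: cvg_cst.
by apply: cvgD => //; exact: kk'.
Qed.

(** Every left endpoint is strictly below [t], so the exponents may be added:
    $(t-u)^{\alpha-1}((t-u)^\alpha)^n=(t-u)^{\beta_n-1}$. *)
Lemma young_sum_mittag_leffler_sum N t a m p : path (mesh_rel m) a p -> last a p = t ->
  \sum_(0 <= n < N) (Gamma (beta n))^-1 *:
    iter n A (young_sum (fun u (h : H) => (t - u) `^ (beta n - 1) *: h) W a p) =
  young_sum (fun u (h : H) => (t - u) `^ (alpha - 1) *:
    mittag_leffler_sum alpha alpha A ((t - u) `^ alpha) N h) W a p.
Proof.
elim: p a => [|v p ih] a ap pt.
  by rewrite /= big1// => n _; rewrite iter_linear0 scaler0.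
have at0 : a < t by move: (mesh_rel_lt_last ap); rewrite -pt.
have ta0 : 0 < t - a by rewrite subr_gt0.
move: ap pt => /= /andP[_ vp] pt; rewrite -(ih v vp pt).
under eq_bigr do rewrite iter_linearD scalerDr.
rewrite big_split/=; congr (_ + _).
rewrite /mittag_leffler_sum scaler_sumr; apply: eq_bigr => n _.
rewrite iter_linearZ !scalerA; congr (_ *: _).
rewrite -powR_mulrn ?powR_ge0// -powRrM mulrA -gt0_powRD// mulrC.
by congr (_ `^ _ / _); rewrite /beta; ring.
Qed.

(* The exponent [beta n] enters the estimates of the n-th noise integral only
   through [T^(beta n)] and the bounded factor [|beta n - 1| / q n]. *)
Lemma mittag_leffler_noise_bound : exists2 eps : R, 0 < eps & exists2 C : R, 0 <= C &
  forall n t, 0 <= t <= T ->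
    `|mittag_leffler_noise_term n t| <= C * 2^-1 ^+ n /\
    forall m p, 0 < m -> path (mesh_rel m) 0 p -> last 0 p = t ->
    `|(Gamma (beta n))^-1 *:
        iter n A (young_sum (fun u (h : H) => (t - u) `^ (beta n - 1) *: h) W 0 p) -
      mittag_leffler_noise_term n t| <= C * 2^-1 ^+ n * m `^ eps.
Proof.
have [L L0 WL] := hoelder_bound hW.
have ag0 : 0 < alpha - 1 + gamma by move: alpha_gamma; lra.
pose eps := Num.min gamma ((alpha - 1 + gamma) / 2).
have eps0 : 0 < eps by rewrite lt_min gamma0 divr_gt0.
have epsg : eps <= gamma by rewrite ge_min lexx.
have epsb : eps <= (alpha - 1 + gamma) / 2 by rewrite ge_min lexx orbT.
pose q0 := alpha - 1 + gamma - eps.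
have q00 : 0 < q0 by rewrite /q0; lra.
exists eps => //.
have Ta0 : 0 <= T `^ alpha by exact: powR_ge0.
have [C' C'0 HC] := invGamma_geometric alpha0 alpha0 (mulr_ge0 M0 Ta0).
(* Bounds [|beta n - 1| / q] for all [n]: the numerator is at most [q + gamma], and [q >= q0]. *)
pose kap := 1 + gamma / q0.
have kap0 : 0 <= kap by rewrite addr_ge0// (divr_ge0 (ltW gamma0) (ltW q00)).
pose D1 := L * (1 + 2 `^ eps * kap) * T `^ (alpha - 1 + gamma).
pose D2 := L * kap * T `^ q0.
have D10 : 0 <= D1.
  by rewrite mulr_ge0 ?powR_ge0// mulr_ge0// addr_ge0// mulr_ge0 ?powR_ge0.
have D20 : 0 <= D2 by rewrite mulr_ge0 ?powR_ge0// mulr_ge0.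
exists (C' * (D1 + D2)); first by rewrite mulr_ge0// addr_ge0.
move=> n t tT; have /andP[t0 tT'] := tT.
have an0 : 0 <= alpha * n%:R by rewrite mulr_ge0// ltW.
have b0 : 0 < beta n by rewrite /beta ltr_wpDl.
pose q := beta n - 1 + gamma - eps.
have qE : q = alpha * n%:R + q0 by rewrite /q /q0 /beta; ring.
have q_gt0 : 0 < q by rewrite qE ltr_wpDl.
have kapq : `|beta n - 1| / q <= kap.
  have q0q : q0 <= q by rewrite qE lerDr.
  have h : `|beta n - 1| <= q + gamma.
    by rewrite ler_norml; apply/andP; split; move: epsg eps0 q_gt0; rewrite /q; lra.
  rewrite (@le_trans _ _ ((q + gamma) / q))//.
    by rewrite ler_wpM2r ?invr_ge0 ?(ltW q_gt0).
  rewrite mulrDl divff ?gt_eqF// lerD2l ler_wpM2l ?(ltW gamma0)//.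
  by rewrite lef_pV2 ?posrE.
have G0 : 0 < Gamma (beta n) by exact: Gamma_gt0.
have Tpow c : 0 <= c -> t `^ (alpha * n%:R + c) <= (T `^ alpha) ^+ n * T `^ c.
  move=> c0; rewrite -powR_mulrn// -powRrM -gt0_powRD//.
  by apply: ge0_ler_powR; rewrite ?nnegrE ?addr_ge0 ?(ltW T0).
have coef x D : 0 <= x -> 0 <= D -> D <= D1 + D2 -> x <= (T `^ alpha) ^+ n * D ->
    (Gamma (beta n))^-1 * (M ^+ n * x) <= C' * (D1 + D2) * 2^-1 ^+ n.
  move=> x0 D0 DD xD.
  rewrite (@le_trans _ _ ((M * T `^ alpha) ^+ n / Gamma (beta n) * D))//.
    rewrite exprMn (_ : _ * _ / _ * _ = (Gamma (beta n))^-1 *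
      (M ^+ n * ((T `^ alpha) ^+ n * D))); last by ring.
    by rewrite ler_wpM2l ?invr_ge0 ?(ltW G0)// ler_wpM2l// exprn_ge0.
  rewrite [leRHS]mulrAC ler_pM//.
  by rewrite divr_ge0 ?(ltW G0)// exprn_ge0// mulr_ge0.
have iter_coef z : `|(Gamma (beta n))^-1 *: iter n A z| <= (Gamma (beta n))^-1 * (M ^+ n * `|z|).
  rewrite normrZ gtr0_norm ?invr_gt0// ler_wpM2l ?invr_ge0 ?(ltW G0)//.
  exact: norm_iter_le.
split.
  have := frac_noise_le eps0 epsg L0 WL q_gt0 tT; rewrite -/q => Hle.
  rewrite /mittag_leffler_noise_term; apply: le_trans (iter_coef _) _.
  apply: (coef _ D1) => //; first by rewrite lerDl.
  apply: le_trans Hle _.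
  have := Tpow _ (ltW ag0).
  rewrite (_ : alpha * n%:R + (alpha - 1 + gamma) = beta n - 1 + gamma); last by rewrite /beta; ring.
  move=> Tp; rewrite /D1 [leRHS]mulrCA ler_pM ?powR_ge0//.
    by rewrite mulr_ge0// addr_ge0// mulr_ge0 ?powR_ge0// divr_ge0// ltW.
  by rewrite ler_wpM2l// lerD2l ler_wpM2l ?powR_ge0.
move=> m p m0 pm pt.
have [_ /(_ m p m0 pm pt) Herr] := frac_noise_cvg eps0 epsg L0 WL q_gt0 tT.
rewrite /mittag_leffler_noise_term -scalerBr -iter_linearB.
apply: le_trans (iter_coef _) _.
apply: (@le_trans _ _ ((Gamma (beta n))^-1 * (M ^+ n * (L * kap * t `^ q)) * m `^ eps)).
  rewrite -!mulrA ler_wpM2l ?invr_ge0 ?(ltW G0)// ler_wpM2l ?exprn_ge0//.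
  apply: le_trans Herr _; rewrite -/q -!mulrA ler_wpM2l// !mulrA.
  by rewrite ler_wpM2r ?powR_ge0// ler_wpM2r ?powR_ge0.
rewrite ler_wpM2r ?powR_ge0//; apply: (coef _ D2) => //.
- by rewrite mulr_ge0 ?powR_ge0// mulr_ge0.
- by rewrite lerDr.
- by rewrite qE /D2 [leRHS]mulrCA ler_wpM2l ?mulr_ge0// Tpow// ltW.
Qed.

(** The mesh errors of the terms share the power [eps] and have summable constants, so summation and
    mesh limit may be interchanged. On a fixed partition the kernel series converges because the sum
    is finite. *)
Lemma volterra_mittag_leffler t : 0 <= t <= T ->
  volterra_integrable (ml_noise_kernel alpha A) W t /\
  \sum_(0 <= n < N) mittag_leffler_noise_term n t @[N --> \oo] -->
    volterra_integral (ml_noise_kernel alpha A) W t.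
Proof.
move=> tT; have /andP[t0 _] := tT.
have [eps eps0 [C C0 HC]] := mittag_leffler_noise_bound.
have [v Hv] := geometric_series C0 (fun n => (HC n t tT).1).
pose s N := \sum_(0 <= n < N) mittag_leffler_noise_term n t.
have cs : s N @[N --> \oo] --> v.
  apply/cvgrPdist_lt => e e0; have C20 : 0 <= 2 * C by rewrite mulr_ge0.
  have [N HN] := half_expr_small C20 e0.
  by exists N => // n /= /HN; apply: le_lt_trans; exact: Hv.
have err m p : 0 < m -> path (mesh_rel m) 0 p -> last 0 p = t ->
    `|volterra_sum (ml_noise_kernel alpha A) W t p - v| <= 2 * C * m `^ eps.
  move=> m0 pm pt; rewrite volterra_sumE.
  have ta0 u : 0 <= (t - u) `^ alpha by exact: powR_ge0.
  pose S N := young_sum (fun u (h : H) => (t - u) `^ (alpha - 1) *: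
    mittag_leffler_sum alpha alpha A ((t - u) `^ alpha) N h) W 0 p.
  have cS : S N @[N --> \oo] --> young_sum (ml_noise_kernel alpha A t) W 0 p.
    apply: young_sum_kernel_cvg => u d; apply: cvgZ; first exact: cvg_cst.
    by apply: (mittag_leffler_cvg M0 AM) => //; exact: powR_ge0.
  apply/ler_addgt0Pr => e e0; have e20 : 0 < e / 2 by rewrite divr_gt0.
  have /cvgrPdist_lt/(_ _ e20)[N1 _ HN1] := cS.
  have /cvgrPdist_lt/(_ _ e20)[N2 _ HN2] := cs.
  pose N := (N1 + N2)%N.
  have h1 := HN1 N (leq_addr _ _); have h2 := HN2 N (leq_addl _ _).
  have h3 : `|S N - s N| <= 2 * C * m `^ eps.
    rewrite /S /s -(young_sum_mittag_leffler_sum N pm pt) -sumrB.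
    rewrite (le_trans (ler_norm_sum _ _ _))//.
    apply: (@le_trans _ _ (\sum_(0 <= n < N) C * m `^ eps * 2^-1 ^+ n)).
      by apply: ler_sum => n _; rewrite mulrAC; exact: (HC n t tT).2.
    rewrite -mulr_sumr [leRHS](_ : _ = C * m `^ eps * 2); last by ring.
    by rewrite ler_wpM2l ?sum_half_expr// mulr_ge0 ?powR_ge0.
  set X := young_sum _ _ _ _.
  rewrite (_ : X - v = (X - S N) + ((S N - s N) - (v - s N))); last first.
    by rewrite opprB addrA addrA [X - S N + _]addrA subrK subrK.
  rewrite (le_trans (ler_normD _ _))// [e]splitr addrCA lerD//; first exact: ltW.
  by rewrite (le_trans (ler_normB _ _))// lerD// ltW.
have PF := mesh_filter_proper t0.
have cv : volterra_sum (ml_noise_kernel alpha A) W t p @[p --> mesh_filter 0 t] --> v.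
  apply/cvgrPdist_lt => e e0; have C21 : 0 < 2 * C + 1 by rewrite ltr_wpDl// mulr_ge0.
  have [d d0 dE] := powR_small eps0 (divr_gt0 e0 C21).
  exists (d / 2) => /=; first by rewrite divr_gt0.
  move=> p [pab pm]; have [pm' pt] := itv_partition_mesh_rel pab pm.
  have d20 : 0 < d / 2 by rewrite divr_gt0.
  rewrite distrC (le_lt_trans (err _ _ d20 pm' pt))//.
  have := dE (d / 2); rewrite (ltW d20) gtr_pMr// invf_lt1// ltr1n => /(_ isT).
  rewrite ltr_pdivlMr//; apply: le_lt_trans.
  by rewrite mulrC ler_wpM2l ?powR_ge0// lerDl.
split; first by apply/cvg_ex; exists v.
by rewrite /volterra_integral (cvg_lim _ cv).
Qed.

End volterra_mittag_leffler.

(** * Picard series *)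

Section solution.
Context {R : realType} {H : completeNormedModType R}.
Hypothesis norming : forall v : H, exists2 phi : H -> R, functional 1 phi & phi v = `|v|.
Variables (A : {linear H -> H}) (M T gamma alpha rho : R) (W : R -> H) (y : H).
Hypotheses (M0 : 0 <= M) (AM : forall x, `|A x| <= M * `|x|).
Hypotheses (T0 : 0 < T) (gamma0 : 0 < gamma) (gamma1 : gamma < 1) (hW : hoelder_on T gamma W).
Hypotheses (alpha_gamma : 1 - gamma < alpha).
Hypotheses (rho01 : 0 < rho <= 1) (rho_alpha : rho < gamma + alpha - 1).

Let alpha0 : 0 < alpha. Proof. by move: gamma1 alpha_gamma; lra. Qed.
Let rho0 : 0 < rho. Proof. by case/andP: rho01. Qed.
Let rhoa : rho <= alpha. Proof. by move: gamma1 rho_alpha; lra. Qed.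
Let beta n : R := alpha * n%:R + alpha.
Let an0 n : 0 <= alpha * n%:R. Proof. by rewrite mulr_ge0// ltW. Qed.
Let beta0 n : 0 < beta n. Proof. by rewrite /beta ltr_wpDl. Qed.
Let beta_gamma n : rho < beta n - 1 + gamma.
Proof. by move: (an0 n) rho_alpha; rewrite /beta; lra. Qed.

Let hoelder_addition (u v : R -> H) :
  hoelder_on T rho u -> hoelder_on T rho v -> hoelder_on T rho (fun s => u s + v s).
Proof.
move=> [C uC] [C' vC]; exists (C + C') => s t sT tT.
by rewrite opprD addrACA mulrDl (le_trans (ler_normD _ _))// lerD ?uC ?vC.
Qed.

Let hoelder_scale (c : R) (u : R -> H) :
  hoelder_on T rho u -> hoelder_on T rho (fun s => c *: u s).
Proof.
move=> [C uC]; exists (`|c| * C) => s t sT tT.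
by rewrite -scalerBr normrZ -mulrA ler_wpM2l// uC.
Qed.

Let power_hoelder n : hoelder_on T rho (fun t : R => t `^ (alpha * n%:R) *: y).
Proof.
case: n => [|n].
  by exists 0 => s t _ _; rewrite !mulr0 !powRr0 subrr normr0 mul0r.
have [C HC] : hoelder_on T rho (fun t : R => t `^ (alpha * n.+1%:R) : R^o).
  apply: powR_hoelder => //; rewrite (le_trans rhoa)// ler_peMr ?(ltW alpha0)//.
  by rewrite ler1n.
exists (C * `|y|) => s t sT tT.
by rewrite -scalerBl normrZ mulrAC ler_wpM2r// HC.
Qed.

(** This is $I^{\alpha n}(y+X)(t)$ in closed form, before the operator $A^n$ is applied. *)
Definition picard_coef n (t : R) : H :=
  (Gamma (alpha * n%:R + 1))^-1 *: (t `^ (alpha * n%:R) *: y) +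
  (Gamma (beta n))^-1 *: frac_noise (beta n) W t.

Definition picard_term n (t : R) : H := iter n A (picard_coef n t).

Lemma picard_coef_hoelder n : hoelder_on T rho (picard_coef n).
Proof.
apply: hoelder_addition; apply: hoelder_scale; first exact: power_hoelder.
exact: frac_noise_hoelder T0 gamma0 hW rho01 (beta_gamma n).
Qed.

Lemma picard_term_hoelder n : hoelder_on T rho (picard_term n).
Proof.
have [C HC] := picard_coef_hoelder n; exists (M ^+ n * C) => s t sT tT.
rewrite /picard_term -iter_linearB (le_trans (norm_iter_le M0 AM _ _))//.
by rewrite -mulrA ler_wpM2l ?exprn_ge0// HC.
Qed.

(** The power is handled by Euler's formula and the noise by the semigroup identity; the reciprocal
    Gamma factors in [picard_coef] are those for which the quotients cancel. *)
Lemma frac_integral_picard_coef n t : 0 <= t <= T ->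
  frac_integral alpha (picard_coef n) t = picard_coef n.+1 t.
Proof.
move=> tT; have /andP[t0 tT'] := tT.
apply: (functional_eq norming) => phi fphi; have [phiD phiZ _] := fphi.
rewrite (functional_frac_integral alpha0 t0 tT' rho0 (picard_coef_hoelder n) norming fphi).
have Ga0 := Gamma_gt0 alpha0.
have G1 : 0 < Gamma (alpha * n%:R + 1) by rewrite Gamma_gt0// ltr_wpDl.
have G2 : 0 < Gamma (beta n) by exact: Gamma_gt0.
pose c1 := (Gamma (alpha * n%:R + 1))^-1 * phi y.
pose c2 := (Gamma (beta n))^-1.
pose u1 (s : R) : R := s `^ (alpha * n%:R).
pose u2 : R -> R := phi \o frac_noise (beta n) W.
have hu2 : hoelder_on T rho (u2 : R -> R^o).
  apply: functional_hoelder fphi _.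
  exact: frac_noise_hoelder T0 gamma0 hW rho01 (beta_gamma n).
have mu1 : measurable_fun `[0, t] u1 by apply: measurable_funTS; exact: measurable_powR.
have mu2 : measurable_fun `[0, t] u2.
  have := hoelder_measurable rho0 hu2.
  by apply: measurable_funS => //; apply: subset_itvl; rewrite bnd_simp.
have [N2 _ b2] := hoelder_bounded (ltW rho0) hu2.
have b1 s : 0 <= s <= t -> `|u1 s| <= t `^ (alpha * n%:R).
  move=> /andP[s0 st]; rewrite ger0_norm ?powR_ge0//.
  by rewrite ge0_ler_powR ?nnegrE ?(an0 n).
have b2' s : 0 <= s <= t -> `|u2 s| <= N2.
  by move=> /andP[s0 st]; apply: b2; rewrite s0 (le_trans st).
have E s : 0 <= s <= t -> (phi \o picard_coef n) s = c1 * u1 s + c2 * u2 s.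
  by move=> _; rewrite /= phiD !phiZ /c1 /c2 /u1 /u2 -!mulrA [phi y * _]mulrC.
rewrite (eq_scalar_frac_integral alpha E).
have mc (c : R) (u : R -> R) : measurable_fun `[0, t] u -> measurable_fun `[0, t] (fun s => c * u s).
  by move=> mu; apply: measurable_funM.
have bc (c K : R) (u : R -> R) : (forall s, 0 <= s <= t -> `|u s| <= K) ->
    forall s, 0 <= s <= t -> `|c * u s| <= `|c| * K.
  by move=> uK s st; rewrite normrM ler_wpM2l// uK.
rewrite (scalar_frac_integralD alpha0 t0 (mc c1 _ mu1) (mc c2 _ mu2) (bc c1 _ _ b1) (bc c2 _ _ b2')).
rewrite (scalar_frac_integralZ alpha0 t0 c1 mu1 b1) (scalar_frac_integralZ alpha0 t0 c2 mu2 b2').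
rewrite scalar_frac_integral_powR//.
have bg0 : 0 < beta n - 1 + gamma by exact: lt_trans (beta_gamma n).
rewrite /u2 (scalar_frac_integral_frac_noise T0 gamma0 hW fphi alpha0 (beta0 n) bg0 tT).
rewrite /picard_coef phiD !phiZ.
have -> : alpha + alpha * n%:R = alpha * n.+1%:R by rewrite -natr1; ring.
have -> : alpha + beta n = beta n.+1 by rewrite /beta -natr1; ring.
have G3 : 0 < Gamma (alpha * n.+1%:R + 1) by rewrite Gamma_gt0// ltr_wpDl.
have G4 : 0 < Gamma (beta n.+1) by exact: Gamma_gt0.
move: G1 G2 G3 G4; rewrite /c1 /c2.
move: (Gamma (alpha * n%:R + 1)) (Gamma (beta n)) => g1 g2.
move: (Gamma (alpha * n.+1%:R + 1)) (Gamma (beta n.+1)) => g3 g4.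
move: (phi y) (phi _) (t `^ _) => p q r g10 g20 g30 g40.
by field; rewrite !gt_eqF.
Qed.

Lemma picard_termS n t : 0 <= t <= T ->
  A (frac_integral alpha (picard_term n) t) = picard_term n.+1 t.
Proof.
move=> tT.
have -> : frac_integral alpha (picard_term n) t = iter n A (frac_integral alpha (picard_coef n) t).
  exact: (frac_integral_linear norming alpha0 rho0 (iter_linearD A n) (iter_linearZ A n)
    (norm_iter_le M0 AM n) (picard_coef_hoelder n) tT).
by rewrite frac_integral_picard_coef.
Qed.

Lemma picard_term_bound : exists2 C : R, 0 <= C & forall n t, 0 <= t <= T ->
  `|picard_term n t| <= C * 2^-1 ^+ n.
Proof.
have [eps eps0 [C1 C10 HC1]] :=
  mittag_leffler_noise_bound M0 AM T0 gamma0 hW alpha0 alpha_gamma.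
have Ta0 : 0 <= T `^ alpha by exact: powR_ge0.
have [C2 C20 HC2] := invGamma_geometric alpha0 (ltr01 : 0 < 1 :> R) (mulr_ge0 M0 Ta0).
exists (C2 * `|y| + C1); first by rewrite addr_ge0// mulr_ge0.
move=> n t tT; have /andP[t0 tT'] := tT.
rewrite /picard_term /picard_coef iter_linearD !iter_linearZ mulrDl.
rewrite (le_trans (ler_normD _ _))// lerD//; last exact: (HC1 n t tT).1.
have G1 : 0 < Gamma (alpha * n%:R + 1) by rewrite Gamma_gt0// ltr_wpDl.
rewrite !normrZ gtr0_norm ?invr_gt0// ger0_norm ?powR_ge0//.
apply: (@le_trans _ _ ((Gamma (alpha * n%:R + 1))^-1 * ((T `^ alpha) ^+ n * (M ^+ n * `|y|)))).
  rewrite ler_wpM2l ?invr_ge0 ?(ltW G1)// ler_pM ?powR_ge0 ?norm_iter_le//.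
  by rewrite -powR_mulrn// -powRrM ge0_ler_powR ?nnegrE ?(ltW T0).
rewrite [leLHS](_ : _ = (M * T `^ alpha) ^+ n / Gamma (alpha * n%:R + 1) * `|y|).
  by rewrite [leRHS]mulrAC ler_wpM2r.
by rewrite exprMn; ring.
Qed.

Let partial_sum N (t : R) : H := \sum_(0 <= n < N) picard_term n t.

Let partial_sumS N : partial_sum N.+1 = (fun t => partial_sum N t + picard_term N t).
Proof. by apply/funext => t; rewrite /partial_sum big_nat_recr. Qed.

Let partial_sum_hoelder N : hoelder_on T rho (partial_sum N).
Proof.
elim: N => [|N ih].
  by exists 0 => s t _ _; rewrite /partial_sum !big_geq// subrr normr0 mul0r.
by rewrite partial_sumS; apply: hoelder_addition ih (picard_term_hoelder N).
Qed.

Let partial_sum_picard N t : 0 <= t <= T ->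
  picard_term 0 t + A (frac_integral alpha (partial_sum N) t) = partial_sum N.+1 t.
Proof.
move=> tT; elim: N => [|N ih]; last first.
  rewrite {1}partial_sumS (frac_integralD norming alpha0 rho0 (partial_sum_hoelder N)
    (picard_term_hoelder N) tT).
  by rewrite linearD addrA ih picard_termS// [in RHS]partial_sumS.
rewrite partial_sumS {2}/partial_sum big_geq// add0r.
have h0 := partial_sum_hoelder 0.
have Z0 s : 0 <= s <= t -> `|partial_sum 0 s| <= 0.
  by rewrite /partial_sum big_geq// normr0.
have := norm_frac_integral_cst norming alpha0 rho0 h0 tT Z0.
by rewrite mul0r mulr0 normr_le0 => /eqP ->; rewrite linear0 addr0.
Qed.

Lemma picard_sum_ex : exists Y : R -> H, exists2 C : R, 0 <= C & forall t N, 0 <= t <= T ->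
  `|Y t - partial_sum N t| <= C * 2^-1 ^+ N.
Proof.
have [C C0 HC] := picard_term_bound.
have /choice[Y HY] : forall t, exists v : H, 0 <= t <= T -> forall N,
    `|v - partial_sum N t| <= 2 * C * 2^-1 ^+ N.
  (* Outside $[0,T]$ nothing is required of [Y], and any value will do. *)
  move=> t; have [tT|tT] := boolP (0 <= t <= T); last by exists 0.
  by have [v Hv] := geometric_series C0 (fun n => HC n t tT); exists v.
by exists Y; exists (2 * C); [rewrite mulr_ge0|move=> t N tT; exact: HY].
Qed.

Section limit.
Variables (Y : R -> H) (C : R).
Hypotheses (C0 : 0 <= C) (YC : forall t N, 0 <= t <= T ->
  `|Y t - partial_sum N t| <= C * 2^-1 ^+ N).

(** Only the term of index 0 uses its own Hoelder constant [L]. Each later term is [A] applied to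
    the fractional integral of its predecessor, whose sup bound is $C_12^{-n}$, so the constants sum
    to at most [M * K * C1 * 2]. *)
Lemma picard_limit_hoelder : hoelder_on T rho Y.
Proof.
have [C1 C10 HC1] := picard_term_bound.
have [K K0 HK] := frac_integral_hoelder norming alpha0 T0 rho0 rho01 rhoa.
have [L L0 HL] := hoelder_bound (picard_term_hoelder 0).
exists (L + M * K * C1 * 2) => s t sT tT.
apply/ler_addgt0Pr => e e0; have C20 : 0 <= 2 * C by rewrite mulr_ge0.
have [N HN] := half_expr_small C20 e0.
have step n : `|picard_term n.+1 t - picard_term n.+1 s| <=
    M * K * C1 * `|t - s| `^ rho * 2^-1 ^+ n.
  rewrite -!picard_termS// -linearB (le_trans (AM _))//.
  rewrite (_ : M * K * C1 * `|t - s| `^ rho * 2^-1 ^+ n =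
    M * (K * (C1 * 2^-1 ^+ n) * `|t - s| `^ rho)); last by ring.
  rewrite ler_wpM2l// HK//.
  - exact: picard_term_hoelder.
  - by rewrite mulr_ge0// exprn_ge0.
  - by move=> u uT; exact: HC1.
have sums : `|partial_sum N.+1 t - partial_sum N.+1 s| <=
    (L + M * K * C1 * 2) * `|t - s| `^ rho.
  rewrite /partial_sum -sumrB big_nat_recl// mulrDl.
  rewrite (le_trans (ler_normD _ _))// lerD//; first exact: HL.
  rewrite (le_trans (ler_norm_sum _ _ _))//.
  apply: (@le_trans _ _ (\sum_(0 <= n < N) M * K * C1 * `|t - s| `^ rho * 2^-1 ^+ n)).
    by apply: ler_sum => n _; exact: step.
  rewrite -mulr_sumr [leRHS](_ : _ = M * K * C1 * `|t - s| `^ rho * 2); last by ring.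
  by rewrite ler_wpM2l ?sum_half_expr// !mulr_ge0 ?powR_ge0.
rewrite (_ : Y t - Y s = (partial_sum N.+1 t - partial_sum N.+1 s) +
  ((Y t - partial_sum N.+1 t) - (Y s - partial_sum N.+1 s))); last first.
  by rewrite opprB [RHS]addrCA !subrKA.
rewrite (le_trans (ler_normD _ _))// lerD//.
rewrite (le_trans (ler_normB _ _))// (le_trans (lerD (YC _ tT) (YC _ sT)))//.
by rewrite -mulrDl (_ : C + C = 2 * C) ?ltW ?HN//; ring.
Qed.

(** The partial sums satisfy the equation up to an index shift; they converge uniformly, and
    [norm_frac_integral_cst] carries a uniform error through $I^\alpha$. *)
Lemma picard_limit_equation t : 0 <= t <= T ->
  Y t = picard_term 0 t + A (frac_integral alpha Y t).
Proof.
move=> tT; have /andP[t0 tT'] := tT.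
have hY := picard_limit_hoelder.
have Ga0 := Gamma_gt0 alpha0.
pose D := C + M * ((Gamma alpha)^-1 * (C * (t `^ alpha / alpha))).
have D0 : 0 <= D.
  by rewrite addr_ge0// !mulr_ge0 ?powR_ge0 ?invr_ge0 ?(ltW alpha0) ?(ltW Ga0).
apply/eqP; rewrite -subr_eq0 -normr_le0; apply/ler_addgt0Pr => e e0; rewrite add0r.
have [N HN] := half_expr_small D0 e0.
pose d s := partial_sum N s - Y s.
have hd : hoelder_on T rho d.
  apply: hoelder_addition (partial_sum_hoelder N) _.
  have [K HK] := hY; exists K => u v uT vT.
  by rewrite -opprD normrN HK.
have IS : frac_integral alpha (partial_sum N) t =
    frac_integral alpha Y t + frac_integral alpha d t.
  rewrite -(frac_integralD norming alpha0 rho0 hY hd tT); congr frac_integral.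
  by apply/funext => s; rewrite /d addrC subrK.
have Id : `|frac_integral alpha d t| <= (Gamma alpha)^-1 * (C * 2^-1 ^+ N * (t `^ alpha / alpha)).
  apply: (norm_frac_integral_cst norming alpha0 rho0 hd tT) => s /andP[s0 st].
  by rewrite /d distrC YC// s0 (le_trans st).
have := partial_sum_picard N tT; rewrite IS linearD addrA => /esym ES.
rewrite (_ : Y t - _ = (Y t - partial_sum N.+1 t) + A (frac_integral alpha d t)); last first.
  by rewrite ES; move: (picard_term 0 t + _) => X; rewrite opprD addrA subrK.
rewrite (le_trans (ler_normD _ _))//.
apply: (@le_trans _ _ (D * 2^-1 ^+ N)); last by rewrite ltW// HN.
rewrite /D mulrDl lerD//.
  rewrite (le_trans (YC _ tT))// ler_wpM2l// exprS ler_piMl ?exprn_ge0//.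
  by rewrite invf_le1// ler1n.
rewrite (le_trans (AM _))// -[leRHS]mulrA ler_wpM2l// (le_trans Id)//.
rewrite -[leRHS]mulrA ler_wpM2l ?invr_ge0 ?(ltW Ga0)//.
by rewrite mulrAC.
Qed.

Lemma picard_limit_unique (Z : R -> H) : hoelder_on T rho Z ->
  (forall t, 0 <= t <= T -> Z t = picard_term 0 t + A (frac_integral alpha Z t)) ->
  forall t, 0 <= t <= T -> Z t = Y t.
Proof.
move=> hZ HZ; have hY := picard_limit_hoelder.
pose d s := Z s - Y s.
have hd : hoelder_on T rho d.
  apply: hoelder_addition hZ _.
  have [K HK] := hY; exists K => u v uT vT.
  by rewrite -opprD normrN HK.
have [G G0 dG] := hoelder_bounded (ltW rho0) hd.
have dE t : 0 <= t <= T -> d t = A (frac_integral alpha d t).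
  move=> tT; rewrite /d HZ// picard_limit_equation// opprD addrACA subrr add0r -linearB.
  congr (A _); rewrite -/d; apply/eqP; rewrite subr_eq addrC; apply/eqP.
  rewrite -(frac_integralD norming alpha0 rho0 hY hd tT); congr frac_integral.
  by apply/funext => s; rewrite /d addrC subrK.
(* A scalar majorant: the n-th term of the Mittag-Leffler series at $Mt^\alpha$, times [G].
   Fractional integration of the power yields exactly the next Gamma factor, and the bound tends to
   0 by [invGamma_geometric]. *)
have dn n t : 0 <= t <= T -> `|d t| <=
    G * M ^+ n / Gamma (alpha * n%:R + 1) * t `^ (alpha * n%:R).
  elim: n t => [|n ih] t tT.
    by rewrite mulr0 powRr0 add0r Gamma1 expr0 divr1 !mulr1 dG.
  have /andP[t0 tT'] := tT.
  pose c := G * M ^+ n / Gamma (alpha * n%:R + 1).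
  have G1 : 0 < Gamma (alpha * n%:R + 1) by rewrite Gamma_gt0// ltr_wpDl.
  have c0 : 0 <= c by rewrite divr_ge0 ?(ltW G1)// mulr_ge0// exprn_ge0.
  rewrite dE// (le_trans (AM _))//.
  have mg : measurable_fun `[0, t] (fun s : R => c * s `^ (alpha * n%:R)).
    by apply: measurable_funM => //; apply: measurable_funTS; exact: measurable_powR.
  have bg s : 0 <= s <= t -> `|d s| <= c * s `^ (alpha * n%:R) <= c * t `^ (alpha * n%:R).
    move=> /andP[s0 st]; rewrite ih ?s0 ?(le_trans st)//= ler_wpM2l//.
    by rewrite ge0_ler_powR ?nnegrE ?(an0 n).
  apply: le_trans (ler_wpM2l M0 (norm_frac_integral_le norming alpha0 rho0 hd tT mg bg)) _.
  have mp : measurable_fun `[0, t] (fun s : R => s `^ (alpha * n%:R)).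
    by apply: measurable_funTS; exact: measurable_powR.
  have bp s : 0 <= s <= t -> `|s `^ (alpha * n%:R)| <= t `^ (alpha * n%:R).
    move=> /andP[s0 st]; rewrite ger0_norm ?powR_ge0//.
    by rewrite ge0_ler_powR ?nnegrE ?(an0 n).
  rewrite (scalar_frac_integralZ alpha0 t0 c mp bp) scalar_frac_integral_powR//.
  have -> : alpha + alpha * n%:R = alpha * n.+1%:R by rewrite -natr1; ring.
  have Ga0 := Gamma_gt0 alpha0.
  have G3 : 0 < Gamma (alpha * n.+1%:R + 1) by rewrite Gamma_gt0// ltr_wpDl.
  move: G1 Ga0 G3; rewrite le_eqVlt /c exprS.
  move: (Gamma (alpha * n%:R + 1)) (Gamma alpha) (Gamma (alpha * n.+1%:R + 1)) => g1 g2 g3.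
  move: (t `^ _) (M ^+ n) => p q g10 g20 g30.
  by apply/orP; left; apply/eqP; field; rewrite !gt_eqF.
move=> t tT; have /andP[t0 tT'] := tT.
have [K K0 HK] := invGamma_geometric alpha0 (ltr01 : 0 < 1 :> R) (mulr_ge0 M0 (powR_ge0 T alpha)).
apply/eqP; rewrite -subr_eq0 -normr_le0; apply/ler_addgt0Pr => e e0; rewrite add0r.
have [N /(_ N (leqnn N)) HN] := half_expr_small (mulr_ge0 G0 K0) e0.
apply: le_trans (dn N t tT) _; apply: le_trans (ltW HN).
have G1 : 0 < Gamma (alpha * N%:R + 1) by rewrite Gamma_gt0// ltr_wpDl.
rewrite -[leRHS]mulrA; apply: le_trans (ler_wpM2l G0 (HK N)).
rewrite exprMn -[(T `^ alpha) ^+ N]powR_mulrn ?powR_ge0// -powRrM -!mulrA ler_wpM2l// ler_wpM2l ?exprn_ge0//.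
rewrite mulrC ler_wpM2r ?invr_ge0 ?(ltW G1)//.
by rewrite ge0_ler_powR ?nnegrE ?(an0 N) ?(ltW T0).
Qed.

(** Each partial sum separates into a Mittag-Leffler partial sum at [y] and a partial sum of noise
    terms; both converge, and limits are unique. *)
Lemma picard_limit_formula t : 0 <= t <= T ->
  Y t = mittag_leffler alpha 1 A (t `^ alpha) y +
        volterra_integral (ml_noise_kernel alpha A) W t.
Proof.
move=> tT.
have [_ cV] := volterra_mittag_leffler M0 AM T0 gamma0 hW alpha0 alpha_gamma tT.
have cM := mittag_leffler_cvg M0 AM (x := y) alpha0 (ltr01 : 0 < 1 :> R) (powR_ge0 t alpha).
have cY : partial_sum N t @[N --> \oo] --> Y t.
  apply/cvgrPdist_lt => e e0; have [N HN] := half_expr_small C0 e0.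
  by exists N => // n /= /HN; apply: le_lt_trans; exact: YC.
have E N : partial_sum N t = mittag_leffler_sum alpha 1 A (t `^ alpha) N y +
    \sum_(0 <= n < N) mittag_leffler_noise_term A alpha W n t.
  rewrite /partial_sum /mittag_leffler_sum -big_split/=; apply: eq_bigr => n _.
  rewrite /picard_term /picard_coef iter_linearD !iter_linearZ; congr (_ + _).
  rewrite scalerA; congr (_ *: _).
  by rewrite -powR_mulrn ?powR_ge0// -powRrM mulrC.
apply: (cvg_unique _ cY) => //.
rewrite (_ : partial_sum ^~ t = (fun N => mittag_leffler_sum alpha 1 A (t `^ alpha) N y +
    \sum_(0 <= n < N) mittag_leffler_noise_term A alpha W n t)).
  exact: cvgD cM cV.
by apply/funext.
Qed.

End limit.
End solution.

Theorem theorem26 (R : realType) (H : completeNormedModType R)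
    (dot : {dot H for idfun}) (T gamma alpha : R) (W : R -> H)
    (A : {linear H -> H}) (y : H) :
  (forall x : H, `|x| ^+ 2 = dot x x) -> separable H ->
  0 < T ->
  0 < gamma < 1 -> hoelder_on T gamma W ->
  bounded_operator A ->
  1 - gamma < alpha ->
  let X := fun t =>
    (Gamma alpha)^-1 *: volterra_integral (frac_noise_kernel alpha) W t in
  (forall t, 0 <= t <= T ->
     volterra_integrable (frac_noise_kernel alpha) W t /\
     volterra_integrable (ml_noise_kernel alpha A) W t) /\
  forall rho, 0 < rho <= 1 -> rho < gamma + alpha - 1 ->
  exists Y : R -> H,
    [/\ hoelder_on T rho Y,
        is_solution T alpha A y X Y,
        forall Z : R -> H, hoelder_on T rho Z ->
          is_solution T alpha A y X Z ->
          forall t, 0 <= t <= T -> Z t = Y t &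
        forall t, 0 <= t <= T ->
          Y t = mittag_leffler alpha 1 A (t `^ alpha) y
                + volterra_integral (ml_noise_kernel alpha A) W t].
Proof.
move=> dotE _ T0 /andP[gamma0 gamma1] hW [M' AM'] alpha_gamma X.
have norming := dot_norming dotE.
have [M M0 AM] : exists2 M, 0 <= M & forall x, `|A x| <= M * `|x|.
  exists `|M'| => // x; apply: le_trans (AM' x) _.
  by rewrite ler_wpM2r// ler_norm.
have alpha0 : 0 < alpha by move: gamma1 alpha_gamma; lra.
split=> [t tT|rho rho01 rho_alpha].
  split; last exact: (volterra_mittag_leffler M0 AM T0 gamma0 hW alpha0 alpha_gamma tT).1.
  have [L L0 WL] := hoelder_bound hW.
  (* At most half of $\alpha-1+\gamma$ is given to the mesh, which leaves a positive telescoping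
     exponent. *)
  pose eps := Num.min gamma ((alpha - 1 + gamma) / 2).
  have eps0 : 0 < eps by rewrite lt_min gamma0 divr_gt0//; move: alpha_gamma; lra.
  have epsg : eps <= gamma by rewrite ge_min lexx.
  have q_gt0 : 0 < alpha - 1 + gamma - eps.
    rewrite subr_gt0; apply: (@le_lt_trans _ _ ((alpha - 1 + gamma) / 2)).
      by rewrite ge_min lexx orbT.
    by move: alpha_gamma; lra.
  exact: (frac_noise_cvg eps0 epsg L0 WL q_gt0 tT).1.
(* The limit is constructed without [rho]; only its regularity, and the arguments resting on it,
   refer to the exponent. *)
have [Y [C C0 YC]] := picard_sum_ex y M0 AM T0 gamma0 gamma1 hW alpha_gamma.
have hY := picard_limit_hoelder norming M0 AM T0 gamma0 gamma1 hW alpha_gamma rho01 rho_alpha C0 YC.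
have eqY := picard_limit_equation norming M0 AM T0 gamma0 gamma1 hW alpha_gamma rho01 rho_alpha C0 YC.
have uniqY := picard_limit_unique norming M0 AM T0 gamma0 gamma1 hW alpha_gamma rho01 rho_alpha C0 YC.
have formulaY := picard_limit_formula M0 AM T0 gamma0 gamma1 hW alpha_gamma C0 YC.
(* For [n = 0] the power of [t] is 1 even at [t = 0], $\Gamma(1)=1$, and the noise has order
   [alpha]. *)
have term0 t : picard_term A alpha W y 0 t = y + X t.
  rewrite /picard_term /picard_coef /= !mulr0 powRr0 !add0r Gamma1 invr1.
  by rewrite !scale1r.
have solutionE Z t : (Z t = y + A (frac_integral alpha Z t) + X t) <->
    (Z t = picard_term A alpha W y 0 t + A (frac_integral alpha Z t)).
  by rewrite term0 addrAC.
exists Y; split=> //.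
- move=> t tT; have /andP[t0 tT'] := tT; split; last by apply/solutionE; exact: eqY.
  by have /andP[rho0 _] := rho01; exact: frac_integrable_hoelder alpha0 t0 tT' rho0 hY.
- move=> Z hZ solZ; apply: (uniqY Z hZ) => t tT.
  by apply/solutionE; case: (solZ t tT).
Qed.
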